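(* Let $n\ge2$, let $\Omega\subset\mathbb R^{n+1}$ be an open set with $n$-Ahlfors regular boundary satisfying the local John condition, and let $\mathcal L=\operatorname{div}A\nabla$ be a real elliptic operator. There is a constant $C>0$ such that, for every Lipschitz function $f$ in $M^{1,1}(\partial\Omega)$, if $u$ is the solution of the continuous Dirichlet problem for $\mathcal L$ with boundary data $f$, then $$\|f\|_{\dot M^{1,1}(\sigma)}\le C\,\|\widetilde N(\nabla u)\|_{L^1(\sigma)}.$$
   Context: Geometry. $\sigma:=\mathcal H^n|_{\partial\Omega}$. A closed set $E$ is $n$-Ahlfors regular if there is $C_0>0$ with $C_0^{-1}r^n\le\mathcal H^n(E\cap B(x,r))\le C_0r^n$ for $x\in E$, $0<r\le\operatorname{diam}E$. $\Omega$ satisfies the local John condition if there is $\theta\in(0,1)$ such that for all $x\in\partial\Omega$ and $r\in(0,2\operatorname{diam}\Omega)$ there is $y\in B(x,r)\cap\Omega$ with $B(y,\theta r)\subset\Omega$ such that for every $z\in B(x,r)\cap\partial\Omega$ there is a rectifiable path $\gamma_z:[0,1]\to\overline\Omega$ of length at most $\theta^{-1}|x-y|$ with $\gamma_z(0)=z$, $\gamma_z(1)=y$ and $\operatorname{dist}(\gamma_z(t),\partial\Omega)\ge\theta|\gamma_z(t)-z|$ for all $t\in[0,1]$. $\Omega$ may be bounded, unbounded with compact boundary, or unbounded with unbounded boundary. Operator. $\mathcal L=\operatorname{div}A\nabla$ with $A$ a real, measurable, not necessarily symmetric $(n+1)\times(n+1)$ matrix on $\Omega$ with $\lambda|\xi|^2\le\sum_{i,j}A_{ij}(x)\xi_i\xi_j$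 and $\|A\|_{L^\infty(\Omega)}\le1/\lambda$ for $x\in\Omega$, $\xi\in\mathbb R^{n+1}$, $\lambda\in(0,1)$. Continuous Dirichlet problem. For continuous boundary data $f$ vanishing at infinity (when $\partial\Omega$ is unbounded), the solution is the function $u\in C(\overline\Omega)\cap W^{1,2}_{loc}(\Omega)$ with $\mathcal Lu=0$ weakly in $\Omega$, $u=f$ on $\partial\Omega$, and (if $\Omega$ is unbounded) $u$ vanishing at infinity; equivalently $u(x)=\int f\,d\omega_{\mathcal L}^x$ with $\omega_{\mathcal L}^x$ the $\mathcal L$-elliptic measure. Hajłasz-Sobolev spaces. For $f:\partial\Omega\to\mathbb R$, $D(f)$ is the set of non-negative $g$ with $|f(x)-f(y)|\le|x-y|(g(x)+g(y))$ for $\sigma$-a.e. $x,y\in\partial\Omega$; $\|f\|_{\dot M^{1,1}(\sigma)}=\inf_{g\in D(f)}\|g\|_{L^1(\sigma)}$; $M^{1,1}(\partial\Omega)$ is the set of $f\in L^1(\sigma)$ with $D(f)\cap L^1(\sigma)\neq\varnothing$. Non-tangential maximal function. For a fixed aperture $\alpha>0$ and $x\in\partial\Omega$, $\gamma_\alpha(x)=\{y\in\Omega:|x-y|<(1+\alpha)\operatorname{dist}(y,\partial\Omega)\}$ and $\widetilde N(u)(x)=\sup_{y\in\gamma_\alpha(x)}\Big(\frac1{|B_y|}\int_{B_y}|u(z)|^2dz\Big)^{1/2}$, $B_y=B(y,\tfrac14\operatorname{dist}(y,\partial\Omega))$. Different apertures give comparable $L^p(\sigma)$ norms. *)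

(* Defs.v *)
From HB Require Import structures.
From mathcomp Require Import all_boot all_order all_algebra.
From mathcomp Require Import all_classical all_reals all_analysis.
From mathcomp Require Import ess_sup_inf.

Set Implicit Arguments.
Unset Strict Implicit.
Unset Printing Implicit Defensive.

Import Order.TTheory GRing.Theory Num.Theory.
Import numFieldNormedType.Exports.

Local Open Scope classical_set_scope.
Local Open Scope ring_scope.

(* The ambient space R^{n+1} is 'rV[R]_n.+1. Its library norm is the max norm;
   it is used only through the topology (open, closure, compact, continuous),
   which is the Euclidean one. All metric notions below are Euclidean. *)
Section euclidean.
Context {R : realType} {n : nat}.
Notation V := 'rV[R]_n.+1.
Implicit Types (x y : V) (E U : set V).

Definition enorm x : R := Num.sqrt (\sum_i x 0 i ^+ 2).

Definition eball x (r : R) : set V := [set y | enorm (y - x) < r].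

(* The maximum with 0 gives the empty set diameter 0. *)
Definition ediam U : \bar R :=
  maxe 0%E (ereal_sup [set (enorm (x - y))%:E | x in U & y in U]).

Definition dist x E : R := inf [set enorm (x - y) | y in E].

Definition boundary E : set V := closure E `\` E°.

End euclidean.

(* A copy of T in which every set is measurable: mu_ext of a gauge on this type
   is Caratheodory's construction with arbitrary covering sets. *)
Definition all_sets (T : Type) : Type := T.

Section all_sets.
Variable T : pointedType.

HB.instance Definition _ := Pointed.on (all_sets T).
HB.instance Definition _ := @isMeasurable.Build default_measure_display
  (all_sets T) discrete_measurable discrete_measurable0
  discrete_measurableC discrete_measurableU.

End all_sets.

Section measures.
Context (R : realType) (n : nat).
Notation V := 'rV[R]_n.+1.
Local Open Scope ereal_scope.

Definition box (a b : V) : set V :=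
  [set x | forall i, (a 0 i <= x 0 i <= b 0 i)%R].

(* The volume of the smallest box containing U, +oo if there is none. *)
Definition box_gauge (U : set (all_sets V)) : \bar R :=
  ereal_inf [set (\prod_i (ab.2 0 i - ab.1 0 i))%:E | ab in
    [set ab : V * V | (forall i, ab.1 0 i <= ab.2 0 i)%R /\
                      U `<=` box ab.1 ab.2]].

Lemma box_gauge_ge0 U : 0 <= box_gauge U.
Proof.
apply: le_ereal_inf_tmp => _ [[a b] [/= ab _] <-].
by rewrite lee_fin; apply: prodr_ge0 => i _; rewrite subr_ge0.
Qed.

Lemma box_gauge0 : box_gauge set0 = 0.
Proof.
apply/eqP; rewrite eq_le box_gauge_ge0 andbT.
apply: ereal_inf_lbound; exists (0%R, 0%R); first by split.
by rewrite /= big_ord_recl subrr mul0r.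
Qed.

Definition lebesgue_outer : set V -> \bar R :=
  mu_ext box_gauge.

HB.instance Definition _ := isOuterMeasure.Build R V lebesgue_outer
  (mu_ext0 box_gauge0 box_gauge_ge0) (mu_ext_ge0 box_gauge_ge0)
  (@le_mu_ext _ _ _ box_gauge) (mu_ext_sigma_subadditive box_gauge_ge0).

Definition diam_gauge (s : nat) (d : R) (U : set (all_sets V)) : \bar R :=
  if U == set0 then 0 else if ediam U <= d%:E then ediam U ^+ s else +oo.

Lemma diam_gauge_ge0 s d U : 0 <= diam_gauge s d U.
Proof.
rewrite /diam_gauge; case: ifP => // _; case: ifP => // _.
by rewrite expe_ge0// /ediam le_max lexx.
Qed.

Lemma diam_gauge0 s d : diam_gauge s d set0 = 0.
Proof. by rewrite /diam_gauge eqxx. Qed.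

Definition hausdorff_pre (s : nat) (d : R) : set V -> \bar R :=
  mu_ext (diam_gauge s d).

(* The s-dimensional Hausdorff measure, normalized by diam ^ s without the
   volume factor of the s-dimensional ball. *)
Definition hausdorff_outer (s : nat) (A : set V) : \bar R :=
  ereal_sup [set hausdorff_pre s d A | d in [set d | (0 < d)%R]].

Lemma hausdorff_pre_ge0 s d A : 0 <= hausdorff_pre s d A.
Proof. exact: mu_ext_ge0 (diam_gauge_ge0 s d) A. Qed.

Lemma hausdorff_pre_le s d A : (0 < d)%R ->
  hausdorff_pre s d A <= hausdorff_outer s A.
Proof. by move=> d0; apply: ereal_sup_ubound; exists d. Qed.

Lemma hausdorff_outer_ge0 s A : 0 <= hausdorff_outer s A.
Proof.
exact: (le_trans (hausdorff_pre_ge0 s 1 A) (hausdorff_pre_le s A ltr01)).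
Qed.

Lemma hausdorff_outer0 s : hausdorff_outer s set0 = 0.
Proof.
apply/eqP; rewrite eq_le hausdorff_outer_ge0 andbT.
apply: ge_ereal_sup => _ [d _ <-].
by rewrite /hausdorff_pre (mu_ext0 (diam_gauge0 s d) (diam_gauge_ge0 s d)).
Qed.

Lemma le_hausdorff_outer s :
  {homo hausdorff_outer s : A B / A `<=` B >-> A <= B}.
Proof.
move=> A B AB; apply: ge_ereal_sup => _ [d d0 <-].
apply: le_trans (hausdorff_pre_le s B d0).
exact: (@le_mu_ext _ _ _ (diam_gauge s d)) AB.
Qed.

Lemma hausdorff_outer_sigma_subadditive s :
  sigma_subadditive (hausdorff_outer s).
Proof.
move=> F; apply: ge_ereal_sup => _ [d d0 <-].
apply: le_trans (mu_ext_sigma_subadditive (diam_gauge_ge0 s d) F) _.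
apply: lee_nneseries => [i _ _|i _]; first exact: hausdorff_pre_ge0.
exact: hausdorff_pre_le.
Qed.

HB.instance Definition _ s := isOuterMeasure.Build R V (hausdorff_outer s)
  (hausdorff_outer0 s) (hausdorff_outer_ge0 s) (le_hausdorff_outer s)
  (hausdorff_outer_sigma_subadditive s).

(* Lebesgue measure on the Lebesgue measurable sets, and H^n on the sets that
   are Caratheodory measurable for it. *)
Definition lebT : Type := caratheodory_type lebesgue_outer.
Definition hausT : Type := caratheodory_type (hausdorff_outer n).

HB.instance Definition _ := Measurable.on lebT.
HB.instance Definition _ := Measurable.on hausT.

Definition lebesgueRn : set lebT -> \bar R := lebesgue_outer.
Definition hausdorffRn : set hausT -> \bar R := hausdorff_outer n.

HB.instance Definition _ := isMeasure.Build _ lebT R lebesgueRn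
  (caratheodory_measure0 lebesgue_outer)
  (caratheodory_measure_ge0 (mu := lebesgue_outer))
  (@caratheodory_measure_sigma_additive _ _ lebesgue_outer).
HB.instance Definition _ := isMeasure.Build _ hausT R hausdorffRn
  (caratheodory_measure0 (hausdorff_outer n))
  (caratheodory_measure_ge0 (mu := hausdorff_outer n))
  (@caratheodory_measure_sigma_additive _ _ (hausdorff_outer n)).

End measures.

Section domains.
Context {R : realType} {n : nat}.
Notation V := 'rV[R]_n.+1.
Implicit Types (E Omega : set V).

Definition ahlfors_regular E : Prop :=
  closed E /\ exists C0 : R, 0 < C0 /\
    forall x (r : R), E x -> 0 < r -> (r%:E <= ediam E)%E ->
      ((C0^-1 * r ^+ n)%:E <= hausdorff_outer n (E `&` eball x r)
        <= (C0 * r ^+ n)%:E)%E.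

Definition path_length (p : R -> V) : \bar R :=
  ereal_sup [set (\sum_(0 <= k < size s)
      enorm (p (nth 1 (0 :: s) k.+1) - p (nth 1 (0 :: s) k)))%:E |
    s in itv_partition 0 1].

Definition local_john Omega : Prop :=
  exists theta : R, 0 < theta < 1 /\
    forall x (r : R), boundary Omega x ->
      0 < r -> (r%:E < 2%:E * ediam Omega)%E ->
    exists y, [/\ eball x r y, Omega y, eball y (theta * r) `<=` Omega &
      forall z, eball x r z -> boundary Omega z ->
      exists p : R -> V,
        [/\ {within `[0, 1], continuous p},
            forall t, 0 <= t <= 1 -> closure Omega (p t),
            (path_length p <= (theta^-1 * enorm (x - y))%:E)%E,
            p 0 = z /\ p 1 = y &
            forall t, 0 <= t <= 1 ->
              theta * enorm (p t - z) <= dist (p t) (boundary Omega)]].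

End domains.

Section pde.
Context {R : realType} {n : nat}.
Notation V := 'rV[R]_n.+1.
Implicit Types (Omega : set V) (A : V -> 'M[R]_n.+1).

Definition mx_opnorm (M : 'M[R]_n.+1) : R :=
  sup [set enorm (xi *m M^T) | xi in [set xi : V | enorm xi <= 1]].

Definition elliptic Omega (lambda : R) A : Prop :=
  [/\ forall i j, measurable_fun (Omega : set (lebT R n)) (fun x : lebT R n => A x i j),
      forall x (xi : V), Omega x ->
        lambda * enorm xi ^+ 2 <= \sum_i \sum_j A x i j * xi 0 i * xi 0 j &
      (ess_sup (@lebesgueRn R n)
         (fun x => (\1_Omega x * mx_opnorm (A x))%:E) <= (lambda^-1)%:E)%E].

Definition partial (i : 'I_n.+1) (phi : V -> R) : V -> R :=
  fun x => 'D_(delta_mx 0 i) phi x.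

Definition smooth (phi : V -> R) : Prop :=
  forall s : seq 'I_n.+1, let psi := foldr partial phi s in
    continuous psi /\ forall x i, derivable psi x (delta_mx 0 i).

Definition test_function Omega (phi : V -> R) : Prop :=
  let K := closure [set x | phi x != 0] in
  [/\ smooth phi, compact K & K `<=` Omega].

Definition Lploc Omega (p : nat) (h : V -> R) : Prop :=
  measurable_fun (Omega : set (lebT R n)) (h : lebT R n -> R) /\
  forall K : set V, compact K -> K `<=` Omega ->
    (@lebesgueRn R n).-integrable K (fun x => (`|h x| ^+ p)%:E).

(* gradu is the distributional gradient of u in Omega; it is determined almost
   everywhere in Omega. *)
Definition weak_gradient Omega (u : V -> R) (gradu : V -> V) : Prop :=
  forall i, Lploc Omega 1 (fun x => gradu x 0 i) /\
    forall phi, test_function Omega phi ->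
      (\int[@lebesgueRn R n]_(x in Omega) (u x * partial i phi x)%:E =
       - \int[@lebesgueRn R n]_(x in Omega) (gradu x 0 i * phi x)%:E)%E.

Definition W12loc Omega (u : V -> R) : Prop :=
  Lploc Omega 2 u /\ exists gradu, weak_gradient Omega u gradu /\
    forall i, Lploc Omega 2 (fun x => gradu x 0 i).

Definition weak_solution Omega A (u : V -> R) : Prop :=
  forall gradu, weak_gradient Omega u gradu ->
  forall phi, test_function Omega phi ->
    (\int[@lebesgueRn R n]_(x in Omega)
      (\sum_i \sum_j A x i j * gradu x 0 j * partial i phi x)%:E = 0)%E.

Definition vanishes_at_infinity (E : set V) (u : V -> R) : Prop :=
  forall eps : R, 0 < eps -> exists M : R,
    forall x, E x -> M < enorm x -> `|u x| < eps.

Definition dirichlet_solution Omega A (f u : V -> R) : Prop :=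
  [/\ {within closure Omega, continuous u},
      W12loc Omega u,
      weak_solution Omega A u,
      forall x, boundary Omega x -> u x = f x &
      ~ bounded_set Omega -> vanishes_at_infinity (closure Omega) u].

(* The maximum with 0 covers the boundary points whose cone is empty. *)
Definition nt_maximal (alpha : R) Omega (F : V -> V) (x : V) : \bar R :=
  let d y := dist y (boundary Omega) in
  let B y := eball y (4^-1 * d y) in
  maxe 0%E (ereal_sup
    [set sqrte (((fine (lebesgueRn (B y)))^-1)%:E *
           \int[@lebesgueRn R n]_(z in B y) (enorm (F z) ^+ 2)%:E)%E |
      y in [set y | Omega y /\ enorm (x - y) < (1 + alpha) * d y]]).

End pde.

(* Hajlasz-Sobolev spaces on a subset E of R^{n+1} with the measure H^n. *)
Section hajlasz.
Context {R : realType} {n : nat}.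
Notation V := 'rV[R]_n.+1.
Implicit Types (E : set V) (f : V -> R).

Definition lipschitz_fun E f : Prop :=
  exists L : R, forall x y, E x -> E y -> `|f x - f y| <= L * enorm (x - y).

Definition hajlasz_gradient E f : set (V -> R) :=
  [set g | [/\ measurable_fun (E : set (hausT R n)) (g : hausT R n -> R),
    forall x, E x -> 0 <= g x &
    exists N : set V, (@hausdorffRn R n).-negligible N /\
      forall x y, (E `\` N) x -> (E `\` N) y ->
        `|f x - f y| <= enorm (x - y) * (g x + g y)]].

Definition hajlasz_seminorm E f : \bar R :=
  ereal_inf [set (\int[@hausdorffRn R n]_(x in E) `|g x|%:E)%E |
    g in hajlasz_gradient E f].

Definition M11 E f : Prop :=
  (@hausdorffRn R n).-integrable E (EFin \o f) /\
  exists2 g, hajlasz_gradient E f g &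
    (@hausdorffRn R n).-integrable E (EFin \o g).

End hajlasz.

(* Main.v *)
Require Import Defs.
From HB Require Import structures.
From mathcomp Require Import all_boot all_order all_algebra.
From mathcomp Require Import all_classical all_reals all_analysis.
From mathcomp Require Import measurable_realfun.
From mathcomp Require Import ring lra.
Set Implicit Arguments.
Unset Strict Implicit.
Unset Printing Implicit Defensive.
Import Order.TTheory GRing.Theory Num.Theory.
Import numFieldNormedType.Exports.
Local Open Scope classical_set_scope.
Local Open Scope ring_scope.

(* The equation plays no role: the inequality holds for every function that is
   continuous up to the boundary and has a locally square integrable weak
   gradient.  Averages of [u] against two bumps of comparable size differ by the
   integral of the gradient of [u] against an explicit smooth field, because the
   difference of two translated and dilated bumps is a divergence.  Hence along a
   John path ending at the boundary point [x], the averages of [u] at scale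
   comparable to the distance to [x] form a Lipschitz function of the point, with
   constant a multiple of the nontangential maximal function [N] at [x] for a
   large aperture.  Two boundary points [x], [z] are joined through a John centre
   by paths of length at most C |x - z|, so that
   |f x - f z| <= C |x - z| (N x + N z), i.e. a multiple of [N] is a Hajlasz
   gradient of [f].  A Vitali covering argument on level sets, valid because
   the surface measure is doubling, bounds the L^1 norm of [N] by that of the
   maximal function with the given aperture. *)

(** * Euclidean norm and distance *)

(** The bumps are products of one-dimensional bumps, each of which has an explicit primitive. When a
    bump is moved and dilated one coordinate at a time, each change of the test function is the
    partial derivative, in that coordinate, of a compactly supported product. It is therefore paid
    for by a single component of the weak gradient, integrated over a cube inside the ball whose
    radius is a quarter of the distance to the boundary, and the powers of the scale cancel. The
    bump at a point [q] of the path has size proportional to [|q - x|], so it shrinks to [x] along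
    the path, where continuity of [u] up to the boundary turns averages into [u x] times the
    integral of the unit bump. To divide by that integral one needs it to be positive, hence a lower
    bound for Lebesgue outer measure, which is defined by coverings. The cone containing the John
    paths has aperture [theta^-1], imposed by the domain, whereas [alpha] is given: this forces the
    comparison of apertures. All constants are fixed before [f] and [u]. *)

Section enorm_theory.
Context {R : realType} {n : nat}.
Notation V := 'rV[R]_n.+1.
Implicit Types (x y z : V) (E : set V).

Lemma enorm_ge0 x : 0 <= enorm x.
Proof. exact: sqrtr_ge0. Qed.

Lemma sqr_enorm x : enorm x ^+ 2 = \sum_i x 0 i ^+ 2.
Proof. by rewrite sqr_sqrtr// sumr_ge0// => i _; exact: sqr_ge0. Qed.

Lemma enormN x : enorm (- x) = enorm x.
Proof. by congr Num.sqrt; apply: eq_bigr => i _; rewrite mxE sqrrN. Qed.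

Lemma enorm_distC x y : enorm (x - y) = enorm (y - x).
Proof. by rewrite -enormN opprB. Qed.

Lemma enorm0 : enorm (0 : V) = 0.
Proof.
by rewrite /enorm big1 ?sqrtr0// => i _; rewrite mxE expr0n.
Qed.

Lemma coord_le_enorm x i : `|x 0 i| <= enorm x.
Proof.
rewrite -(ler_pXn2r (n:=2))// ?nnegrE ?enorm_ge0// sqr_enorm real_normK ?num_real//.
by rewrite (bigD1 i)//= lerDl sumr_ge0// => j _; exact: sqr_ge0.
Qed.

Lemma enorm_eq0 x : enorm x = 0 -> x = 0.
Proof.
move=> x0; apply/rowP => i; rewrite mxE; apply/eqP; rewrite -normr_le0 -x0.
exact: coord_le_enorm.
Qed.

Lemma enorm_gt0 x : x != 0 -> 0 < enorm x.
Proof.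
move=> x0; rewrite lt_neqAle enorm_ge0 andbT eq_sym.
by apply: contraNneq x0 => /enorm_eq0 ->.
Qed.

Lemma enorm_le_coord x (c : R) : (forall i, `|x 0 i| <= c) ->
  enorm x <= n.+1%:R * c.
Proof.
move=> xc; have c0 : 0 <= c by exact: le_trans (xc 0).
have le1 : enorm x ^+ 2 <= n.+1%:R * c ^+ 2.
  rewrite sqr_enorm (@le_trans _ _ (\sum_(i < n.+1) c ^+ 2))//.
    apply: ler_sum => i _; rewrite -[_ ^+ 2]real_normK ?num_real//.
    by rewrite lerXn2r ?nnegrE.
  by rewrite big_const_ord iter_addr_0 mulr_natl.
rewrite -(ler_pXn2r (n:=2))// ?nnegrE ?enorm_ge0 ?mulr_ge0//.
apply: le_trans le1 _; rewrite exprMn ler_wpM2r ?sqr_ge0//.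
by rewrite expr2 ler_peMr// ler1n.
Qed.

Lemma enormD x y : enorm (x + y) <= enorm x + enorm y.
Proof.
have CS : \sum_i x 0 i * y 0 i <= enorm x * enorm y.
  have [->|x0] := eqVneq x 0.
    by rewrite enorm0 mul0r big1// => i _; rewrite mxE mul0r.
  have [->|y0] := eqVneq y 0.
    by rewrite enorm0 mulr0 big1// => i _; rewrite mxE mulr0.
  have a0 := enorm_gt0 x0; have b0 := enorm_gt0 y0.
  have : 0 <= \sum_i (x 0 i * enorm y - y 0 i * enorm x) ^+ 2.
    by apply: sumr_ge0 => i _; exact: sqr_ge0.
  rewrite (eq_bigr (fun i => enorm y ^+ 2 * x 0 i ^+ 2 + enorm x ^+ 2 * y 0 i ^+ 2 -
     2 * enorm x * enorm y * (x 0 i * y 0 i))); last by move=> i _; ring.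
  rewrite sumrB big_split/= -!mulr_sumr -!sqr_enorm.
  move=> h; have : 0 <= 2 * (enorm x * enorm y) * (enorm x * enorm y - \sum_i x 0 i * y 0 i).
    by apply: le_trans h _; rewrite le_eqVlt; apply/orP; left; apply/eqP; ring.
  by rewrite pmulr_rge0 ?subr_ge0// mulr_gt0// mulr_gt0.
rewrite -(ler_pXn2r (n:=2))// ?nnegrE ?enorm_ge0 ?addr_ge0 ?enorm_ge0//.
rewrite sqr_enorm (eq_bigr (fun i => x 0 i ^+ 2 + y 0 i ^+ 2 + 2 * (x 0 i * y 0 i))); last first.
  by move=> i _; rewrite mxE; ring.
rewrite !big_split/= -mulr_sumr -!sqr_enorm sqrrD.
by move: CS; rewrite -mulr_natl; lra.
Qed.

Lemma enorm_triangle y x z : enorm (x - z) <= enorm (x - y) + enorm (y - z).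
Proof. by have := enormD (x - y) (y - z); rewrite addrA subrK. Qed.

Lemma lip_enorm x y : `|enorm x - enorm y| <= enorm (x - y).
Proof.
have h1 := enormD (x - y) y; have h2 := enormD (y - x) x.
rewrite !subrK in h1 h2; rewrite (enorm_distC y x) in h2.
by rewrite ler_norml; apply/andP; split; lra.
Qed.

Lemma enormZ (a : R) x : enorm (a *: x) = `|a| * enorm x.
Proof.
rewrite /enorm (eq_bigr (fun i => a ^+ 2 * x 0 i ^+ 2)); last first.
  by move=> i _; rewrite mxE exprMn.
by rewrite -mulr_sumr sqrtrM ?sqr_ge0// sqrtr_sqr.
Qed.

Lemma enorm_normr x : enorm x <= n.+1%:R * `|x|.
Proof. by apply: enorm_le_coord => i; rewrite [leRHS]mx_normrE; exact: (le_bigmax _ (fun ij => `|x ij.1 ij.2|) (0, i)). Qed.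

Lemma normr_enorm x : `|x| <= enorm x.
Proof.
rewrite [leLHS]mx_normrE; apply: bigmax_le => [|[i j] _]; first exact: enorm_ge0.
by rewrite /= (ord1 i); exact: coord_le_enorm.
Qed.

Lemma ballE_normr x (r : R) y : ball x r y <-> `|x - y| < r.
Proof. by rewrite -ball_normE. Qed.

Lemma ball_sub_eball x (r : R) : ball x (r / n.+1%:R) `<=` eball x r.
Proof.
move=> y /ballE_normr xy; rewrite /eball/= enorm_distC (le_lt_trans (enorm_normr _))//.
by rewrite mulrC -ltr_pdivlMr// ltr0n.
Qed.

Lemma eball_sub_ball x (r : R) : eball x r `<=` ball x r.
Proof.
move=> y; rewrite /eball/= enorm_distC => xy; apply/ballE_normr.
exact: le_lt_trans (normr_enorm _) xy.
Qed.

Lemma nbhs_eball x (r : R) : 0 < r -> nbhs x (eball x r).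
Proof.
move=> r0; apply/nbhs_ballP; exists (r / n.+1%:R); last exact: ball_sub_eball.
by rewrite /= divr_gt0// ltr0n.
Qed.

Lemma nbhs_eballP x (A : set V) :
  nbhs x A <-> exists2 r : R, 0 < r & eball x r `<=` A.
Proof.
split=> [/nbhs_ballP[r/= r0 rA]|[r r0 rA]].
  by exists r => //; exact: subset_trans (@eball_sub_ball _ _) rA.
exact: filterS rA (nbhs_eball x r0).
Qed.

Lemma eballxx x (r : R) : 0 < r -> eball x r x.
Proof. by rewrite /eball/= subrr enorm0. Qed.

Lemma eball_open x (r : R) : open (eball x r).
Proof.
rewrite openE => y xy; apply/nbhs_eballP; exists (r - enorm (y - x)).
  by rewrite subr_gt0.
move=> z; rewrite /eball/= => yz; have := enorm_triangle y z x.
by move=> h; apply: le_lt_trans h _; lra.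
Qed.

Lemma dist_has_lb x E : has_lbound [set enorm (x - y) | y in E].
Proof. by exists 0 => _ [z _ <-]; exact: enorm_ge0. Qed.

Lemma dist_le x y E : E y -> dist x E <= enorm (x - y).
Proof. by move=> Ey; apply: ge_inf; [exact: dist_has_lb|exists y]. Qed.

Lemma dist_near x E (e : R) : E !=set0 -> dist x E < e ->
  exists2 y, E y & enorm (x - y) < e.
Proof.
move=> [y Ey] xe.
have S0 : [set enorm (x - z) | z in E] !=set0 by exists (enorm (x - y)), y.
have [t [z Ez zt] te] := inf_lt S0 xe.
by exists z => //; rewrite zt.
Qed.

Lemma dist_lip x y E : E !=set0 -> dist x E <= enorm (x - y) + dist y E.
Proof.
move=> E0; rewrite -lerBlDl; apply: lb_le_inf.
  by case: E0 => z Ez; exists (enorm (y - z)), z.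
move=> _ [z Ez <-]; rewrite lerBlDl.
exact: le_trans (dist_le x Ez) (enorm_triangle y x z).
Qed.

Lemma dist_gt0 x E : closed E -> E !=set0 -> ~ E x -> 0 < dist x E.
Proof.
move=> cE E0 Ex; have : nbhs x (~` E).
  by apply: open_nbhs_nbhs; split => //; rewrite openC.
move=> /nbhs_eballP[r r0 rE]; apply: lt_le_trans r0 _; apply: lb_le_inf.
  by case: E0 => z Ez; exists (enorm (x - z)), z.
move=> _ [z Ez <-]; rewrite leNgt; apply/negP => xz; apply: (rE z) => //.
by rewrite /eball/= enorm_distC.
Qed.

(** A countable base of the topology, in the max norm because its balls are intersections of
    coordinate strips and so are measurable coordinate by coordinate. It serves both measurability
    of open sets and the Lindeloef argument. *)
Definition rat_ball (qs : 'rV[rat]_n.+1 * rat) : set V :=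
  ball (map_mx (@ratr R) qs.1) (ratr qs.2).

Lemma rat_ball_base x (A : set V) : nbhs x A ->
  exists qs, rat_ball qs x /\ rat_ball qs `<=` A.
Proof.
move=> /nbhs_ballP[r/= r0 rA].
have r40 : r / 4 < r / 2 by lra.
have [s + ] := rat_in_itvoo r40; rewrite in_itv/= => /andP[rs sr].
have hq i : exists q : rat, x 0 i - r / 4 < ratr q < x 0 i + r / 4.
  have h : x 0 i - r / 4 < x 0 i + r / 4 by lra.
  by have [q] := rat_in_itvoo h; rewrite in_itv/= => h'; exists q.
have [q qP] := choice hq.
have qx : `|map_mx (@ratr R) (\row_i q i) - x| <= r / 4.
  rewrite [leLHS]mx_normrE.
  apply: bigmax_le => [|[i j] _ /=]; first lra.
  by rewrite !mxE ord1 ler_norml; have /andP[] := qP j => ? ?; apply/andP; split; lra.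
exists (\row_i q i, s); split.
  by apply/ballE_normr; exact: le_lt_trans qx rs.
move=> y /ballE_normr/= yq; apply: rA; apply/ballE_normr.
set q0 := map_mx _ _ in yq qx.
have := ler_distD q0 x y; rewrite (distrC x q0) => h.
by apply: le_lt_trans h _; lra.
Qed.

End enorm_theory.

(** * Lebesgue measure of boxes and affine changes of variables *)

Section box_volume.
Context {R : realType}.
Local Open Scope ereal_scope.

(* Fubini-free: fix the first coordinate t, apply the induction hypothesis with
   the weights w k * \1_[a k 0, b k 0] t and integrate in t over [0, 1]. *)
Lemma unit_cube_cover (d : nat) (w : nat -> R) (a b : nat -> 'I_d -> R) :
  (forall k, 0 <= w k)%R -> (forall k i, a k i <= b k i)%R ->
  (forall x : 'I_d -> R, (forall i, 0 <= x i <= 1)%R ->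
    1 <= \sum_(k <oo) (w k * \prod_i \1_(`[a k i, b k i]%classic) (x i))%:E) ->
  1 <= \sum_(k <oo) (w k * \prod_i (b k i - a k i))%:E.
Proof.
elim: d w a b => [|d IH] w a b w0 ab cov.
  have := cov (fun=> 0%R) _; under eq_eseriesr do rewrite big_ord0.
  under [X in _ -> _ <= X]eq_eseriesr do rewrite big_ord0.
  by apply; case.
pose c k := (w k * \prod_(i < d) (b k (lift ord0 i) - a k (lift ord0 i)))%R.
have c0 k : (0 <= c k)%R.
  by rewrite mulr_ge0// prodr_ge0// => i _; rewrite subr_ge0.
have step (t : R) : (0 <= t <= 1)%R ->
    1 <= \sum_(k <oo) (c k * \1_(`[a k ord0, b k ord0]%classic) t)%:E.
  move=> t01.
  have := IH (fun k => w k * \1_(`[a k ord0, b k ord0]%classic) t)%R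
    (fun k i => a k (lift ord0 i)) (fun k i => b k (lift ord0 i)).
  move=> /(_ _ _ _)H; apply: (@le_trans _ _ (\sum_(k <oo) (w k * \1_(`[a k ord0, b k ord0]%classic) t *
     \prod_(i < d) (b k (lift ord0 i) - a k (lift ord0 i)))%:E)).
    apply: H => [k|k i|x x01]; first by rewrite mulr_ge0.
      exact: ab.
    have := cov (fun i => if unlift ord0 i is Some j then x j else t) _.
    move=> /(_ _)H; apply: le_trans (H _) _ => [i|]; first by case: unliftP.
    apply: lee_nneseries => [k _ _|k _].
      by rewrite lee_fin mulr_ge0// prodr_ge0.
    rewrite lee_fin big_ord_recl unlift_none mulrA ler_wpM2l ?mulr_ge0//.
    by apply: ler_prod => i _; rewrite liftK lexx andbT.
  apply: lee_nneseries => [k _ _|k _].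
    by rewrite lee_fin !mulr_ge0// prodr_ge0// => i _; rewrite subr_ge0.
  by rewrite lee_fin /c mulrAC.
pose mu : {measure set (measurableTypeR R) -> \bar R} := @lebesgue_measure R.
have mI k : @measurable_fun _ _ (measurableTypeR R) (\bar R) `[0%R, 1%R]%classic (fun t => (c k * \1_(`[a k ord0, b k ord0]%classic) t)%:E).
  by apply/measurable_EFinP; apply: measurable_funM => //; exact: measurable_indic.
have -> : 1 = \int[mu]_(t in `[0%R, 1%R]) (1 : \bar R).
  rewrite integral_cst//= mul1e /mu lebesgue_measure_itv/= lte_fin ltr01.
  by rewrite oppr0 adde0.
apply: (@le_trans _ _ (\int[mu]_(t in `[0%R, 1%R])
    \sum_(k <oo) (c k * \1_(`[a k ord0, b k ord0]%classic) t)%:E)).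
  apply: ge0_le_integral => //=.
  apply: ge0_emeasurable_sum => //= k t _ _.
  by rewrite lee_fin mulr_ge0.
rewrite integral_nneseries//; last first.
  by move=> k t _; rewrite lee_fin mulr_ge0.
apply: lee_nneseries => [k _ _|k _].
  by apply: integral_ge0 => t _; rewrite lee_fin mulr_ge0.
under eq_integral do rewrite EFinM.
rewrite ge0_integralZl//; last 2 first.
- by apply/measurable_EFinP; exact: measurable_indic.
- by rewrite lee_fin.
rewrite integral_indic// [leRHS](_ : _ = (c k)%:E * (b k ord0 - a k ord0)%:E); last first.
  by rewrite -EFinM /c big_ord_recl; congr EFin; rewrite mulrAC mulrA.
apply: lee_wpmul2l; first by rewrite lee_fin.
apply: (@le_trans _ _ (mu (`[a k ord0, b k ord0]%classic))).
  by apply: le_measure; rewrite ?inE//; exact: measurableI.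
rewrite [leLHS]lebesgue_measure_itv/=; case: ifP => //.
by rewrite lee_fin subr_ge0.
Qed.

End box_volume.

Section lebesgue_theory.
Context {R : realType} {n : nat}.
Notation V := 'rV[R]_n.+1.
Implicit Types (x y : V) (A U X : set V).
Local Open Scope ereal_scope.

Lemma mu_ext_le_gauge (g : set (all_sets V) -> \bar R) U :
  (forall X, 0 <= g X) -> g set0 = 0 -> mu_ext g U <= g U.
Proof.
move=> g0 gs0; apply: ereal_inf_lbound.
exists (fun k => if k == 0%N then U else set0).
  by split=> // t Ut; exists 0%N.
rewrite nneseries_recl//= eseries0 ?adde0//.
by case=> // k _ _.
Qed.

Lemma box_gauge_le (a b : V) U : (forall i, a 0%R i <= b 0%R i)%R ->
  U `<=` box a b -> box_gauge U <= (\prod_i (b 0%R i - a 0%R i))%:E.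
Proof. by move=> ab Uab; apply: ereal_inf_lbound; exists (a, b). Qed.

Lemma lebesgue_outer_box (a b : V) : (forall i, a 0%R i <= b 0%R i)%R ->
  lebesgue_outer (box a b) <= (\prod_i (b 0%R i - a 0%R i))%:E.
Proof.
move=> ab; apply: le_trans (box_gauge_le ab (@subset_refl _ _)).
by apply: mu_ext_le_gauge; [exact: box_gauge_ge0|exact: box_gauge0].
Qed.

(** Each covering set is replaced by an almost optimal box, with excess [e / 2 ^ k.+1]; the
    indicators of these boxes then sum to at least 1 on the unit cube, and [unit_cube_cover] applies
    with weights 1. *)
Lemma lebesgue_outer_unit_box : 1 <= lebesgue_outer (box (0%R : V) (const_mx 1%R)).
Proof.
apply: le_ereal_inf_tmp => _ [F [_ cov] <-].
have [[k Fk]|Ffin] := pselect (exists k, box_gauge (F k) = +oo).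
  rewrite (eseries_pinfty _ isT Fk) ?leey// => i _.
  by rewrite gt_eqF// (lt_le_trans _ (box_gauge_ge0 _)).
apply/lee_addgt0Pr => e e0.
have box_of k : exists ab : V * V, [/\ (forall i, ab.1 0%R i <= ab.2 0%R i)%R,
    F k `<=` box ab.1 ab.2 &
    (\prod_i (ab.2 0%R i - ab.1 0%R i))%:E <= box_gauge (F k) + (e / (2 ^ k.+1)%:R)%:E].
  have fk : box_gauge (F k) \is a fin_num.
    rewrite ge0_fin_numE ?box_gauge_ge0// ltey; apply/eqP => Fk.
    by apply: Ffin; exists k.
  have ek : (0 < e / (2 ^ k.+1)%:R)%R by rewrite divr_gt0// ltr0n expn_gt0.
  have [_ [ab [/= h1 h2] <-] /ltW h3] := lb_ereal_inf_adherent ek fk.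
  by exists ab; split.
have [ab abP] := choice box_of.
have covR : 1 <= \sum_(k <oo) (1 * \prod_i ((ab k).2 0 i - (ab k).1 0 i))%:E.
  apply: (@unit_cube_cover R n.+1 (fun=> 1%R) (fun k i => (ab k).1 0%R i)
      (fun k i => (ab k).2 0%R i)) => [//|k i|x x01].
    by have [] := abP k.
  have [|k _ Fk] := cov (\row_i x i).
    by move=> i /=; rewrite !mxE; exact: x01.
  apply: (@le_trans _ _ (\sum_(0 <= j < k.+1)
     (1 * \prod_i \1_(`[(ab j).1 0%R i, (ab j).2 0%R i]%classic) (x i))%:E)); last first.
    by apply: nneseries_lim_ge => j _ _; rewrite lee_fin mul1r prodr_ge0.
  rewrite big_nat_recr//= mul1r [X in _ + X](_ : _ = 1); last first.
    congr EFin; apply: big1 => i _; rewrite indicE mem_set//=.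
    have [_ /(_ _ Fk)/(_ i) + _] := abP k.
    by rewrite mxE in_itv.
  by rewrite leeDr// sume_ge0// => j _; rewrite lee_fin mul1r prodr_ge0.
apply: (le_trans covR); apply: le_trans (epsilon_trick _ _ (ltW e0)) => //; last first.
  by move=> k; exact: box_gauge_ge0.
apply: lee_nneseries => [k _ _|k _]; rewrite mul1r; have [h1 h2 h3] := abP k => //.
by rewrite lee_fin prodr_ge0// => i _; rewrite subr_ge0.
Qed.

(** Carries the cube with corner [y] and side [r] to the unit cube. Its inverse has the same form,
    so an upper bound for the measure of a preimage, applied twice, gives equality. *)
Definition rescale y (r : R) (z : V) : V := (r^-1 *: (z - y))%R.

Lemma rescaleK y (r : R) z : (0 < r)%R ->
  rescale y r (rescale (- r^-1 *: y)%R r^-1 z) = z.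
Proof.
move=> r0; rewrite /rescale invrK; apply/rowP => i; rewrite !mxE.
by field; rewrite gt_eqF.
Qed.

Lemma rescaleVK y (r : R) z : (0 < r)%R ->
  rescale (- r^-1 *: y)%R r^-1 (rescale y r z) = z.
Proof.
move=> r0; rewrite /rescale invrK; apply/rowP => i; rewrite !mxE.
by field; rewrite gt_eqF.
Qed.

Lemma box_gauge_rescale y (r : R) U : (0 < r)%R ->
  box_gauge (rescale y r @^-1` U) <= (r ^+ n.+1)%:E * box_gauge U.
Proof.
move=> r0; rewrite -lee_pdivrMl ?exprn_gt0//.
apply: le_ereal_inf_tmp => _ [[a b] [/= ab Uab] <-].
rewrite lee_pdivrMl ?exprn_gt0// -EFinM.
apply: le_trans (@box_gauge_le (y + r *: a)%R (y + r *: b)%R _ _ _) _.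
- by move=> i; rewrite !mxE lerD2l ler_pM2l.
- move=> z /= /Uab h i; have := h i; rewrite /rescale !mxE => /andP[h1 h2].
  rewrite mulrC ler_pdivlMr// in h1; rewrite mulrC ler_pdivrMr// in h2.
  by rewrite (mulrC r) (mulrC r); apply/andP; split; lra.
- rewrite lee_fin (eq_bigr (fun i => r * (b 0 i - a 0 i)))%R; last first.
    by move=> i _; rewrite !mxE; ring.
  by rewrite big_split/= prodr_const card_ord.
Qed.

Lemma lebesgue_outer_rescale_le y (r : R) A : (0 < r)%R ->
  lebesgue_outer (rescale y r @^-1` A) <= (r ^+ n.+1)%:E * lebesgue_outer A.
Proof.
move=> r0; rewrite -lee_pdivrMl ?exprn_gt0//.
apply: le_ereal_inf_tmp => _ [F [_ cov] <-].
rewrite lee_pdivrMl ?exprn_gt0// -nneseriesZl; last first.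
  by move=> *; exact: box_gauge_ge0.
apply: (@le_trans _ _ (\sum_(k <oo) box_gauge (rescale y r @^-1` F k))).
  apply: ereal_inf_lbound; exists (fun k => rescale y r @^-1` F k) => //.
  by split => // z /= /cov[k _ Fk]; exists k.
apply: lee_nneseries => [k _ _|k _]; first exact: box_gauge_ge0.
exact: box_gauge_rescale.
Qed.

Lemma lebesgue_outer_rescale y (r : R) A : (0 < r)%R ->
  lebesgue_outer (rescale y r @^-1` A) = (r ^+ n.+1)%:E * lebesgue_outer A.
Proof.
move=> r0; apply/eqP; rewrite eq_le lebesgue_outer_rescale_le//=.
rewrite -lee_pdivlMl ?exprn_gt0//.
have r10 : (0 < r^-1)%R by rewrite invr_gt0.
have := @lebesgue_outer_rescale_le (- r^-1 *: y)%R r^-1 (rescale y r @^-1` A) r10.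
rewrite exprVn; apply: le_trans; rewrite le_eqVlt; apply/orP; left; apply/eqP.
by congr lebesgue_outer; apply/seteqP; split=> z /=; rewrite rescaleK.
Qed.

Lemma caratheodory_rescale y (r : R) A : (0 < r)%R ->
  (@lebesgue_outer R n).-caratheodory A ->
  (@lebesgue_outer R n).-caratheodory (rescale y r @^-1` A).
Proof.
move=> r0 mA X.
pose X' := rescale (- r^-1 *: y)%R r^-1 @^-1` X.
have XE : X = rescale y r @^-1` X'.
  by apply/seteqP; split=> z; rewrite /X' /= rescaleVK.
rewrite XE lebesgue_outer_rescale// (mA X') muleDr ?ge0_adde_def ?inE ?outer_measure_ge0//.
by rewrite -!(lebesgue_outer_rescale y _ r0).
Qed.

End lebesgue_theory.

(** * Lebesgue measurability of open sets and the measure of balls *)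

Section lebesgue_measurability.
Context {R : realType} {n : nat}.
Notation V := 'rV[R]_n.+1.
Notation leb := (@lebesgueRn R n).
Implicit Types (x y : V) (A U X : set V).
Local Open Scope ereal_scope.

(** A hyperplane orthogonal to an axis cuts a box into two boxes whose volumes add up. Summed over a
    covering, this makes half spaces Caratheodory measurable. *)
Lemma box_gauge_half_space U i (c : R) :
  box_gauge (U `&` [set x : V | (x 0 i <= c)%R]) +
  box_gauge (U `&` ~` [set x : V | (x 0 i <= c)%R]) <= box_gauge U.
Proof.
apply: le_ereal_inf_tmp => _ [[a b] [/= ab Uab] <-].
have le_box X : X `<=` box a b -> box_gauge X <= (\prod_j (b 0 j - a 0 j))%:E.
  exact: box_gauge_le.
have [ca|ac] := ltP c (a 0%R i).
  rewrite [X in box_gauge X + _](_ : _ = set0).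
    by rewrite box_gauge0 add0e; apply: le_box => x [/Uab].
  apply/seteqP; split=> // x [/Uab/(_ i)/andP[h _] /= xc].
  by have := le_lt_trans xc ca; rewrite ltNge h.
have [bc|cb] := leP (b 0%R i) c.
  rewrite [X in _ + box_gauge X](_ : _ = set0).
    by rewrite box_gauge0 adde0; apply: le_box => x [/Uab].
  apply/seteqP; split=> // x [/Uab/(_ i)/andP[_ h] /= xc].
  by apply: xc; exact: le_trans bc.
pose b' : V := \row_j if j == i then c else b 0%R j.
pose a' : V := \row_j if j == i then c else a 0%R j.
apply: (@le_trans _ _ ((\prod_j (b' 0 j - a 0 j))%:E + (\prod_j (b 0 j - a' 0 j))%:E)).
  apply: leeD; apply: box_gauge_le.
  - by move=> j; rewrite mxE; case: eqP => [->|].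
  - move=> x [/Uab xab /= xc] j; rewrite mxE; have /andP[h1 h2] := xab j.
    by rewrite h1/=; case: eqP => [->|].
  - by move=> j; rewrite mxE; case: eqP => [->|]//; rewrite ltW.
  - move=> x [/Uab xab /= /negP]; rewrite -ltNge => xc j.
    rewrite mxE; have /andP[h1 h2] := xab j.
    by rewrite h2 andbT; case: eqP => [->|//]; rewrite ltW.
rewrite -EFinD lee_fin [X in (X + _ <= _)%R](bigD1 i)//=.
rewrite [X in (_ + X <= _)%R](bigD1 i)//= [X in (_ <= X)%R](bigD1 i)//= !mxE eqxx.
rewrite (eq_bigr (fun j => b 0 j - a 0 j)%R) => [|j ji]; last first.
  by rewrite mxE (negbTE ji).
rewrite [X in (_ + _ * X)%R](eq_bigr (fun j => b 0 j - a 0 j)%R) => [|j ji]; last first.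
  by rewrite mxE (negbTE ji).
by rewrite -mulrDl; have -> : (c - a 0 i + (b 0 i - c) = b 0 i - a 0 i)%R by ring.
Qed.

Lemma caratheodory_half_space i (c : R) :
  (@lebesgue_outer R n).-caratheodory [set x : V | (x 0 i <= c)%R].
Proof.
apply: le_caratheodory_measurable => X.
apply: le_ereal_inf_tmp => _ [F [_ cov] <-].
apply: (@le_trans _ _ (\sum_(k <oo) (box_gauge (F k `&` [set x : V | (x 0 i <= c)%R]) +
  box_gauge (F k `&` ~` [set x : V | (x 0 i <= c)%R])))); last first.
  apply: lee_nneseries => [k _ _|k _]; last exact: box_gauge_half_space.
  by rewrite adde_ge0// box_gauge_ge0.
rewrite nneseriesD//; [|by move=> *; exact: box_gauge_ge0..].
apply: leeD; apply: ereal_inf_lbound.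
- exists (fun k => F k `&` [set x : V | (x 0 i <= c)%R]) => //.
  by split => // x [/cov[k _ Fk] xc]; exists k.
- exists (fun k => F k `&` ~` [set x : V | (x 0 i <= c)%R]) => //.
  by split => // x [/cov[k _ Fk] xc]; exists k.
Qed.

Lemma measurable_coord i : measurable_fun [set: lebT R n] (fun x : lebT R n => (x : V) 0%R i).
Proof.
apply: (measurability _ (RGenOInfty.measurableE R)) => _ [_ [c ->] <-].
rewrite setTI.
have -> : (fun x : lebT R n => (x : V) 0%R i) @^-1` `]c, +oo[%classic =
    ~` [set x : V | (x 0%R i <= c)%R].
  by apply/seteqP; split=> x; rewrite /= in_itv/= andbT ltNge; move/negP.
by apply: caratheodory_measurable_setC; exact: caratheodory_half_space.
Qed.

Lemma measurable_ball_leb x (r : R) : measurable (ball x r : set (lebT R n)).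
Proof.
have [r0|r0] := ltP 0%R r; last first.
  rewrite (_ : ball x r = set0); first exact: measurable0.
  by apply/seteqP; split=> // y [/(le_lt_trans r0)]; rewrite ltxx.
have -> : ball x r = \bigcap_(i in [set: 'I_n.+1])
    ((fun y : lebT R n => (y : V) 0%R i) @^-1` (ball (x 0%R i) r)).
  apply/seteqP; split => [y [_ xy] i _|y xy]; first exact: xy.
  split => // i j.
  by rewrite (ord1 i); exact: xy.
apply: fin_bigcap_measurable => // i _; rewrite -[X in measurable X]setTI.
by apply: measurable_coord => //; exact: measurable_ball.
Qed.

Lemma open_lebesgue_measurable A : open A -> measurable (A : set (lebT R n)).
Proof.
move=> oA; have -> : A = \bigcup_(qs : 'rV[rat]_n.+1 * rat)
    (if `[< rat_ball qs `<=` A >] then @rat_ball R n qs else set0).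
  apply/seteqP; split=> [x Ax|x [qs _]]; last by case: asboolP => // h /h.
  have [qs [qx qA]] := rat_ball_base (open_nbhs_nbhs (conj oA Ax)).
  by exists qs => //; case: asboolP.
apply: countable_bigcupT_measurable => [|qs]; first exact: countableP.
by case: asboolP => // _; exact: measurable_ball_leb.
Qed.

Lemma closed_lebesgue_measurable A : closed A -> measurable (A : set (lebT R n)).
Proof.
move=> cA; rewrite -(setCK A); apply: measurableC.
by apply: open_lebesgue_measurable; rewrite openC.
Qed.

Lemma continuous_lebesgue_measurable (f : V -> R) : continuous f ->
  measurable_fun [set: lebT R n] (f : lebT R n -> R).
Proof.
move=> cf; apply: (measurability _ (RGenOpens.measurableE R)) => _ [_ [a [b ->] <-]].
rewrite setTI; apply: open_lebesgue_measurable.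
by apply: open_comp => // x _; exact: cf.
Qed.

Lemma measurable_rescale y (r : R) : (0 < r)%R ->
  measurable_fun [set: lebT R n] (rescale y r : lebT R n -> lebT R n).
Proof.
by move=> r0 _ A mA; rewrite setTI; exact: caratheodory_rescale.
Qed.

(** The image of Lebesgue measure under [rescale y r] is [r ^+ n.+1] times Lebesgue measure. *)
Lemma integral_rescale y (r : R) (f : V -> \bar R) : (0 < r)%R ->
  measurable_fun [set: lebT R n] (f : lebT R n -> \bar R) -> (forall x, 0 <= f x) ->
  \int[leb]_x f (rescale y r x) = (r ^+ n.+1)%:E * \int[leb]_x f x.
Proof.
move=> r0 mf f0.
have rn0 : (0 <= r ^+ n.+1)%R by rewrite exprn_ge0// ltW.
have := @ge0_integral_pushforward _ _ (lebT R n) (lebT R n) R _ (measurable_rescale y r0) leb setT f measurableT mf (fun x _ => f0 x).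
rewrite preimage_setT => <-.
rewrite -(@ge0_integral_mscale _ (lebT R n) R leb setT _ (NngNum rn0) f)//.
apply: eq_measure_integral => [|mr A _ _]; first exact: measurable_rescale.
exact: (lebesgue_outer_rescale y A r0).
Qed.

Lemma leb_box_gt0 (a : V) (s : R) : (0 < s)%R -> 0 < leb (box a (a + const_mx s)%R).
Proof.
move=> s0; have -> : box a (a + const_mx s)%R = rescale a s @^-1` (box 0%R (const_mx 1%R)).
  apply/seteqP; split=> z h i; have := h i; rewrite /rescale !mxE => /andP[h1 h2].
    rewrite mulr_ge0 ?invr_ge0 ?subr_ge0 ?(ltW s0)//=.
    by rewrite mulrC ler_pdivrMr// mul1r lerBlDl.
  rewrite mulrC ler_pdivrMr// mul1r in h2; rewrite mulrC ler_pdivlMr// mul0r in h1.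
  by apply/andP; split; lra.
rewrite /lebesgueRn lebesgue_outer_rescale// mule_gt0// ?lte_fin ?exprn_gt0//.
exact: lt_le_trans lte01 (lebesgue_outer_unit_box).
Qed.

Lemma leb_eball_le x (r : R) : (0 <= r)%R -> leb (eball x r) <= ((2 * r) ^+ n.+1)%:E.
Proof.
move=> r0; apply: (@le_trans _ _ (lebesgue_outer (box (x - const_mx r)%R (x + const_mx r)%R))).
  apply: le_outer_measure => y; rewrite /eball/= => xy i.
  have := le_lt_trans (coord_le_enorm (y - x) i) xy.
  by rewrite !mxE ltr_norml => /andP[? ?]; apply/andP; split; lra.
apply: le_trans (lebesgue_outer_box _) _ => [i|].
  by rewrite !mxE; lra.
rewrite lee_fin (eq_bigr (fun=> 2 * r))%R ?prodr_const ?card_ord// => i _.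
by rewrite !mxE; ring.
Qed.

Lemma leb_eball_gt0 x (r : R) : (0 < r)%R -> 0 < leb (eball x r).
Proof.
(* A box of side [s] with corner [x] stays within distance [n.+1 * s] of [x]; this side makes that
   distance [r / 2]. *)
move=> r0; have s0 : (0 < r / (2 * n.+1%:R))%R by rewrite divr_gt0// mulr_gt0.
apply: lt_le_trans (leb_box_gt0 x s0) _.
apply: le_outer_measure => y xy; rewrite /eball/=.
apply: le_lt_trans (@enorm_le_coord _ _ _ (r / (2 * n.+1%:R))%R _) _ => [i|].
  have := xy i; rewrite !mxE => /andP[]; move: (r / _)%R => s h1 h2.
  by rewrite ger0_norm ?subr_ge0// lerBlDl.
have -> : (n.+1%:R * (r / (2 * n.+1%:R)) = r / 2 :> R)%R by field; rewrite gt_eqF.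
by rewrite ltr_pdivrMr// ltr_pMr// ltr1n.
Qed.

End lebesgue_measurability.

(** * Smooth bumps *)

Section smooth1.
Context {R : realType}.
Implicit Types (f g h : R -> R) (s t : R).

(* Infinite differentiability without iterated derivatives: [f] lies in a family
   of functions closed under differentiation. *)
Definition smooth1 f := exists C : set (R -> R), C f /\
  forall h, C h -> exists2 h', C h' & forall s, is_derive s 1 h (h' s).

Lemma smooth1_derive f : smooth1 f ->
  exists2 f', smooth1 f' & forall s, is_derive s 1 f (f' s).
Proof.
move=> [C [Cf CC]]; have [f' Cf' df] := CC _ Cf.
by exists f' => //; exists C.
Qed.

Lemma smooth1_continuous f : smooth1 f -> continuous f.
Proof.
move=> /smooth1_derive[f' _ df] s; apply/differentiable_continuous/derivable1_diffP.
exact: ex_derive.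
Qed.

Lemma smooth1_affine f (a b c : R) : smooth1 f ->
  smooth1 (fun s => c * f (a * s + b)).
Proof.
move=> [C [Cf CC]].
exists [set h | exists c0 f0, C f0 /\ h = fun s => c0 * f0 (a * s + b)].
split; first by exists c, f.
move=> _ [c0 [f0 [Cf0 ->]]]; have [f' Cf' df] := CC _ Cf0.
exists (fun s => (c0 * a) * f' (a * s + b)); first by exists (c0 * a), f'.
move=> s; have dl : is_derive s 1 (fun s => a * s + b) a.
  have := is_deriveD (is_deriveZ a (is_derive_id s (1 : R))) (is_derive_cst b s (1 : R)).
  by move=> H; apply: (is_derive_eq H); rewrite addr0 [LHS]mulr1.
have dc := @is_derive1_comp _ f0 (fun t => a * t + b) s _ _ (df (a * s + b)) dl.
have H := is_deriveZ c0 dc; apply: (is_derive_eq H).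
by rewrite /GRing.scale/=; ring.
Qed.

Lemma smooth1B f g : smooth1 f -> smooth1 g -> smooth1 (fun s => f s - g s).
Proof.
move=> [C [Cf CC]] [D [Dg DD]].
exists [set h | exists f0 g0, [/\ C f0, D g0 & h = fun s => f0 s - g0 s]].
split; first by exists f, g.
move=> _ [f0 [g0 [Cf0 Dg0 ->]]]; have [f' Cf' df] := CC _ Cf0.
have [g' Dg' dg] := DD _ Dg0.
by exists (fun s => f' s - g' s); [exists f', g'|move=> s; exact: is_deriveB].
Qed.

Inductive generated (B : set (R -> R)) : (R -> R) -> Prop :=
| generated_in f : B f -> generated B f
| generated_cst c : generated B (fun=> c)
| generatedD f g : generated B f -> generated B g -> generated B (fun s => f s + g s)
| generatedM f g : generated B f -> generated B g -> generated B (fun s => f s * g s).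

(** By the Leibniz rule the generated algebra is stable under differentiation once the derivatives
    of its generators lie in it; it is then itself a family as required by [smooth1]. *)
Lemma generated_smooth1 (B : set (R -> R)) f :
  (forall h, B h -> exists2 h', generated B h' & forall s, is_derive s 1 h (h' s)) ->
  generated B f -> smooth1 f.
Proof.
move=> BB gf; exists (generated B); split=> // h; elim=> {h}.
- exact: BB.
- by move=> c; exists (fun=> 0); [exact: generated_cst|move=> s; exact: is_derive_cst].
- move=> g h _ [g' gg' dg] _ [h' gh' dh].
  by exists (fun s => g' s + h' s); [exact: generatedD|move=> s; exact: is_deriveD].
- move=> g h gg [g' gg' dg] gh [h' gh' dh].
  exists (fun s => g s * h' s + h s * g' s).
    by apply: generatedD; exact: generatedM.
  by move=> s; exact: is_deriveM.
Qed.

Lemma is_derive0_quadratic f (C : R) : f 0 = 0 -> (forall t, `|f t| <= C * t ^+ 2) ->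
  is_derive (0 : R) 1 f 0.
Proof.
move=> f0 fC; have C0 : 0 <= C by have := fC 1; rewrite expr1n mulr1; exact: le_trans.
have H : h^-1 *: ((f \o shift 0) (h *: (1 : R)) - f 0) @[h --> (0 : R)^'] --> (0 : R).
  apply/cvgrPdist_le => eps eps0; near=> h.
  have h0 : h != 0 by near: h; exact: nbhs_dnbhs_neq.
  have -> : h *: (1 : R) = h by exact: mulr1.
  rewrite f0 subr0 sub0r normrN /= addr0 normrM normfV.
  rewrite ler_pdivrMl ?normr_gt0//; apply: le_trans (fC h) _.
  rewrite -[h ^+ 2]real_normK ?num_real// expr2 mulrCA ler_wpM2l//.
  have hd : `|h| <= eps / (C + 1).
    by near: h; apply: dnbhs0_le; rewrite divr_gt0// ltr_wpDl.
  apply: le_trans (ler_wpM2l C0 hd) _.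
  by rewrite mulrCA ger_pMr// ler_pdivrMr ?ltr_wpDl// mul1r lerDl.
by apply: DeriveDef; [exact: cvgP H|exact: cvg_lim H].
Unshelve. all: by end_near. Qed.

(** The classical flat function [exp (- 1 / s)] multiplied by a power of [1 / s]. The powers are
    included because the derivative of the [k]-th function combines those of index [k.+1] and
    [k.+2], so the whole family is stable under differentiation. *)
Definition flat (k : nat) s : R := if 0 < s then s^-1 ^+ k * expR (- s^-1) else 0.

Lemma flat_ge0 k s : 0 <= flat k s.
Proof.
rewrite /flat; case: ifP => // s0.
by rewrite mulr_ge0 ?expR_ge0// exprn_ge0// invr_ge0 ltW.
Qed.

Lemma flat_gt0 k s : 0 < s -> 0 < flat k s.
Proof. by move=> s0; rewrite /flat s0 mulr_gt0 ?expR_gt0// exprn_gt0// invr_gt0. Qed.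

Lemma flat_le0 k s : s <= 0 -> flat k s = 0.
Proof. by rewrite /flat leNgt => /negbTE ->. Qed.

Lemma flatS k s : flat k s = s * flat k.+1 s.
Proof.
rewrite /flat; case: ifP => [s0|]; last by rewrite mulr0.
by rewrite exprS !mulrA mulfV ?gt_eqF// mul1r.
Qed.

(** Raise [t <= expR t] to the power [k.+1], with [t = s^-1 / k.+1]. Together with
    [flat k s = s ^+ 2 * flat k.+2 s] it gives the quadratic decay that settles differentiability at
    0. *)
Lemma flat_le k s : flat k.+1 s <= k.+1%:R ^+ k.+1.
Proof.
rewrite /flat; case: ifP => [s0|]; last by rewrite exprn_ge0.
rewrite expRN ler_pdivrMr ?expR_gt0//.
have k0 : (k.+1%:R : R) != 0 by rewrite pnatr_eq0.
have [t t0 ->] : exists2 t, 0 <= t & s^-1 = k.+1%:R * t.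
  exists (s^-1 / k.+1%:R); first by rewrite divr_ge0// invr_ge0 ltW.
  by rewrite mulrC divfK.
rewrite exprMn ler_wpM2l ?exprn_ge0// expRM_natl lerXn2r ?nnegrE ?expR_ge0//.
by apply: le_trans (expR_ge1Dx _); rewrite lerDr.
Qed.

Lemma is_derive_flat k s :
  is_derive s 1 (flat k) (- k%:R * flat k.+1 s + flat k.+2 s).
Proof.
have [s0|s0|->] := ltgtP s 0.
- rewrite !flat_le0 ?(ltW s0)// mulr0 addr0.
  apply: (@near_eq_is_derive _ _ _ (cst 0)).
  near=> t; rewrite flat_le0//= ltW//; near: t.
  exact: lt_nbhsl.
- apply: (@near_eq_is_derive _ _ _ (fun t => t^-1 ^+ k * expR (- t^-1))).
    near=> t; rewrite /flat ifT//; near: t; exact: lt_nbhsr.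
  rewrite /flat s0.
  have sn0 : s != 0 by rewrite gt_eqF.
  have dV : is_derive s 1 (fun t => t^-1) (- s ^- 2).
    by apply: (is_derive_eq (is_deriveV sn0 (is_derive_id s (1 : R)))); rewrite [LHS]mulr1.
  have dX : is_derive s 1 (fun t => t^-1 ^+ k) ((k%:R * s^-1 ^+ k.-1) * (- s ^- 2)).
    by have := is_deriveX k dV; rewrite exprfctE.
  have dE : is_derive s 1 (fun t => expR (- t^-1)) (expR (- s^-1) * (s ^- 2)).
    apply: (@is_derive1_comp _ expR (fun t => - t^-1)).
    by apply: (is_derive_eq (is_deriveN dV)); rewrite opprK.
  have H := is_deriveM dX dE; apply: (is_derive_eq H).
  rewrite /GRing.scale/= -exprVn {H dX}; case: k => [|k]; rewrite ?exprS/=; last ring.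
  ring.
- rewrite !flat_le0// mulr0 addr0.
  apply: (@is_derive0_quadratic _ (k.+2%:R ^+ k.+2)); first by rewrite flat_le0.
  move=> h; rewrite ger0_norm ?flat_ge0// flatS flatS mulrA -expr2 mulrC.
  by rewrite ler_wpM2r ?sqr_ge0// flat_le.
Unshelve. all: by end_near. Qed.

(* [expR 1 * flat 0 s] reaches 1 at [s = 1], from where on the outer [flat 0]
   vanishes. *)
Definition step s : R := - flat 0 (1 - expR 1 * flat 0 s).
Definition bump s : R := expR 1 * flat 2 (1 - expR 1 * flat 0 s) * flat 2 s.

Lemma is_derive_inner k s : is_derive s 1 (fun t => flat k (1 - expR 1 * flat 0 t))
   ((- k%:R * flat k.+1 (1 - expR 1 * flat 0 s) + flat k.+2 (1 - expR 1 * flat 0 s)) *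
    (- expR 1 * flat 2 s)).
Proof.
apply: (@is_derive1_comp _ (flat k) (fun t => 1 - expR 1 * flat 0 t)).
  exact: is_derive_flat.
have d0 := is_derive_flat 0 s.
have H := is_deriveB (is_derive_cst (1 : R) s 1) (is_deriveZ (expR 1) d0).
by apply: (is_derive_eq H); rewrite /GRing.scale/=; ring.
Qed.

(** The bump is obtained as the derivative of an explicit function because integration by parts
    against differences of bumps needs their primitives. *)
Lemma is_derive_step s : is_derive s 1 step (bump s).
Proof.
have H := is_deriveN (is_derive_inner 0 s); apply: (is_derive_eq H).
by rewrite /bump; ring.
Qed.

Lemma smooth1_step : smooth1 step.
Proof.
(* [generated] provides sums and products but no composition, so the composites with the inner
   function are generators as well. *)
pose B : set (R -> R) := [set h | (exists k, h = flat k) \/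
  exists k, h = fun s => flat k (1 - expR 1 * flat 0 s)].
have Bf k : generated B (flat k) by apply: generated_in; left; exists k.
have Bi k : generated B (fun s => flat k (1 - expR 1 * flat 0 s)).
  by apply: generated_in; right; exists k.
apply: (@generated_smooth1 B).
  move=> _ [[k ->]|[k ->]].
    exists (fun s => (- k%:R) * flat k.+1 s + flat k.+2 s); last exact: is_derive_flat.
    by apply: generatedD => //; apply: generatedM => //; exact: generated_cst.
  eexists; last exact: is_derive_inner.
  apply: generatedM; last by apply: generatedM => //; exact: generated_cst.
  by apply: generatedD => //; apply: generatedM => //; exact: generated_cst.
have -> : step = fun s => (-1) * flat 0 (1 - expR 1 * flat 0 s).
  by apply/funext => s; rewrite mulN1r.
by apply: generatedM => //; exact: generated_cst.
Qed.

Lemma smooth1_bump : smooth1 bump.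
Proof.
have [f' sf df] := smooth1_derive smooth1_step.
suff -> : bump = f' by [].
by apply/funext => s; rewrite -(@derive_val _ _ _ _ _ _ _ (is_derive_step s))
  (@derive_val _ _ _ _ _ _ _ (df s)).
Qed.

Lemma bump_ge0 s : 0 <= bump s.
Proof. by rewrite /bump !mulr_ge0 ?expR_ge0 ?flat_ge0. Qed.

Lemma step_arg_le0 s : 1 <= s -> 1 - expR 1 * flat 0 s <= 0.
Proof.
move=> s1; have s0 : 0 < s by exact: lt_le_trans s1.
rewrite /flat s0 expr0 mul1r subr_le0 -expRD -[leLHS]expR0 ler_expR.
by rewrite subr_ge0 invf_le1.
Qed.

Lemma bump_out s : ~~ (0 <= s <= 1) -> bump s = 0.
Proof.
rewrite negb_and -!ltNge => /orP[s0|s1]; rewrite /bump.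
  by rewrite (flat_le0 2 (ltW s0)) mulr0.
by rewrite (flat_le0 2 (step_arg_le0 (ltW s1))) mulr0 mul0r.
Qed.

Lemma step_le0 s : s <= 0 -> step s = step 0.
Proof. by move=> s0; rewrite /step (flat_le0 _ s0) (flat_le0 _ (lexx 0)). Qed.

Lemma step_ge1 s : 1 <= s -> step s = 0.
Proof. by move=> s1; rewrite /step flat_le0 ?oppr0// step_arg_le0. Qed.

(** Each factor 4 is the bound [2 ^+ 2] that [flat_le] gives for [flat 2]. *)
Definition bump_sup : R := expR 1 * 4 * 4.

Lemma bump_le s : bump s <= bump_sup.
Proof.
have h t : flat 2 t <= 4 by apply: le_trans (flat_le 1 t) _; lra.
rewrite /bump /bump_sup ler_pM ?mulr_ge0 ?expR_ge0 ?flat_ge0//.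
by rewrite ler_wpM2l ?expR_ge0.
Qed.

Lemma bump_sup_gt0 : 0 < bump_sup.
Proof. by rewrite /bump_sup !mulr_gt0 ?expR_gt0. Qed.

Lemma step_lipschitz s t : `|step s - step t| <= bump_sup * `|s - t|.
Proof.
wlog st : s t / t <= s.
  move=> H; have [|/ltW] := leP t s; first exact: H.
  by move=> ts; rewrite -normrN opprB -(normrN (s - t)) opprB; exact: H.
have cs : {within `[t, s], continuous step}.
  by apply: continuous_subspaceT => x; exact: smooth1_continuous smooth1_step _.
have [c _ ->] := MVT_segment st (fun x _ => is_derive_step x) cs.
by rewrite normrM ler_wpM2r// ger0_norm ?bump_ge0 ?bump_le.
Qed.

Lemma bump_half_gt0 : 0 < bump 2^-1.
Proof.
have p : 0 < 1 - expR 1 * flat 0 (2^-1 : R).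
  rewrite /flat invr_gt0 ltr0n expr0 mul1r invrK -expRD subr_gt0.
  by rewrite -[ltRHS]expR0 ltr_expR; lra.
by rewrite /bump !mulr_gt0 ?expR_gt0 ?flat_gt0// invr_gt0.
Qed.

End smooth1.

(** * Product test functions *)

Section product_functions.
Context {R : realType} {n : nat}.
Notation V := 'rV[R]_n.+1.
Implicit Types (h : 'I_n.+1 -> R -> R) (z : V).

Definition prodf h z : R := \prod_i h i (z 0 i).

Definition upd h k (f : R -> R) : 'I_n.+1 -> R -> R :=
  fun i => if i == k then f else h i.

Lemma prodf_upd h k f z : prodf (upd h k f) z = f (z 0 k) * \prod_(i | i != k) h i (z 0 i).
Proof.
rewrite /prodf (bigD1 k)//= /upd eqxx; congr (_ * _).
by apply: eq_bigr => i /negbTE ->.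
Qed.

Lemma upd_id h k : upd h k (h k) = h.
Proof. by apply/funext => i; rewrite /upd; case: eqP => [->|]. Qed.

Lemma is_derive_prodf h k f' z : is_derive (z 0 k) 1 (h k) (f' (z 0 k)) ->
  is_derive z (delta_mx 0 k) (prodf h) (prodf (upd h k f') z).
Proof.
move=> [dh dhE]; set c := \prod_(i | i != k) h i (z 0 i).
have H : t^-1 *: ((prodf h \o shift z) (t *: delta_mx 0 k) - prodf h z) @[t --> 0^'] -->
    prodf (upd h k f') z.
  rewrite prodf_upd -/c mulrC.
  have -> : (fun t : R => t^-1 *: ((prodf h \o shift z) (t *: delta_mx 0 k) - prodf h z)) =
    (fun t : R => c *: (t^-1 *: ((h k \o shift (z 0 k)) (t *: (1 : R)) - h k (z 0 k)))).
    apply/funext => t; rewrite -{1 2}(upd_id h k) /= !prodf_upd -/c !mxE !eqxx/=.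
    rewrite (eq_bigr (fun i => h i (z 0 i))); last first.
      by move=> i ik; rewrite !mxE eqxx (negbTE ik) mulr0 add0r.
    by rewrite -/c -mulrBl [RHS]mulrC [LHS]mulrA.
  by apply: cvgZr; rewrite -dhE; exact: dh.
by apply: DeriveDef; [exact: cvgP H|exact: cvg_lim H].
Qed.

Lemma prodf_continuous h : (forall i, continuous (h i)) -> continuous (prodf h).
Proof.
move=> hc z; rewrite /prodf.
elim: (index_enum _) => [|i s IH].
  have -> : (fun x : V => \prod_(i <- [::]) h i (x 0 i)) = cst 1.
    by apply/funext => x; rewrite big_nil.
  exact: cst_continuous.
have -> : (fun x : V => \prod_(j <- i :: s) h j (x 0 j)) =
    (fun x : V => h i (x 0 i) * \prod_(j <- s) h j (x 0 j)).
  by apply/funext => x; rewrite big_cons.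
have hi : {for z, continuous (h i \o (fun x : V => x 0 i))}.
  by apply: continuous_comp; [exact: coord_continuous|exact: hc].
exact: (@cvgM _ _ (nbhs z) _ _ _ _ _ hi IH).
Qed.

(** A partial derivative of a product function replaces one factor by its derivative, so all
    iterated partial derivatives are again products of smooth factors. *)
Lemma prodf_smooth h : (forall i, smooth1 (h i)) -> smooth (prodf h).
Proof.
move=> hs s.
have [h' [h's ->]] : exists h', (forall i, smooth1 (h' i)) /\
    foldr (@partial R n) (prodf h) s = prodf h'.
  elim: s => [|k s [h' [h's /= ->]]]; first by exists h.
  have [f' f's df] := smooth1_derive (h's k).
  exists (upd h' k f'); split; first by move=> i; rewrite /upd; case: ifP.
  apply/funext => z; rewrite /partial.
  exact: (@derive_val _ _ _ _ _ _ _ (is_derive_prodf (df _))).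
split; first by apply: prodf_continuous => i; exact: smooth1_continuous.
move=> z i; have [f' f's df] := smooth1_derive (h's i).
exact: (@ex_derive _ _ _ _ _ _ _ (is_derive_prodf (df _))).
Qed.

Lemma box_closed (a b : V) : closed (box a b).
Proof.
have -> : box a b = \bigcap_(i in [set: 'I_n.+1])
    ((fun x : V => x 0 i) @^-1` `[a 0 i, b 0 i]).
  apply/seteqP; split=> [x xab i _|x xab i]; first by rewrite /= in_itv; exact: xab.
  by have := xab i I; rewrite /= in_itv.
apply: closed_bigI => i _; apply: preimage_closed; last exact: itv_closed.
by move=> x _; exact: coord_continuous.
Qed.

Lemma box_compact (a b : V) : compact (box a b).
Proof.
apply: bounded_closed_compact; last exact: box_closed.
exists (`|a| + `|b|); split; first exact: num_real.
move=> M abM x xab; rewrite /= (le_trans _ (ltW abM))//.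
rewrite [leLHS]mx_normrE; apply: bigmax_le => [|[i j] _ /=]; first exact: addr_ge0.
rewrite (ord1 i).
have [h1 h2] := andP (xab j).
have ha : `|a 0 j| <= `|a|.
  by rewrite [leRHS]mx_normrE; exact: (le_bigmax _ (fun ij => `|a ij.1 ij.2|) (0, j)).
have hb : `|b 0 j| <= `|b|.
  by rewrite [leRHS]mx_normrE; exact: (le_bigmax _ (fun ij => `|b ij.1 ij.2|) (0, j)).
have a0 := normr_ge0 a; have b0 := normr_ge0 b.
move: ha hb; rewrite !ler_norml => /andP[? ?] /andP[? ?].
by apply/andP; split; lra.
Qed.

Lemma prodf_out h (a b : V) z : (forall i s, ~~ (a 0 i <= s <= b 0 i) -> h i s = 0) ->
  ~ box a b z -> prodf h z = 0.
Proof.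
move=> hab; rewrite /box/= -existsNE => -[i /negP zi].
by rewrite /prodf (bigD1 i)//= hab// mul0r.
Qed.

Lemma prodf_test_function Omega h (a b : V) : (forall i, smooth1 (h i)) ->
  (forall i s, ~~ (a 0 i <= s <= b 0 i) -> h i s = 0) ->
  box a b `<=` Omega -> test_function Omega (prodf h).
Proof.
move=> hs hab abO.
have Kab : closure [set x | prodf h x != 0] `<=` box a b.
  rewrite ((closure_id _).1 (@box_closed a b)).
  apply: closureS => x /= x0; apply: contrapT => /(prodf_out hab) hx.
  by rewrite hx eqxx in x0.
split; first exact: prodf_smooth.
  by apply: subclosed_compact Kab; [exact: closed_closure|exact: box_compact].
exact: subset_trans abO.
Qed.

End product_functions.

(** * Averages of a function with a weak gradient *)

Section measure_space.
Context d (T : measurableType d) (R : realType) (mu : {measure set T -> \bar R}).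
Implicit Types (D : set T) (f g : T -> R).
Local Open Scope ereal_scope.

Lemma le_abse_integral_prod D f g (M : R) : measurable D -> measurable_fun D f ->
  measurable_fun D g -> (forall x, D x -> (`|g x| <= M)%R) ->
  `|\int[mu]_(x in D) (f x * g x)%:E| <= M%:E * \int[mu]_(x in D) `|f x|%:E.
Proof.
move=> mD mf mg gM.
have mfg : measurable_fun D (fun x => (f x * g x)%:E).
  by apply/measurable_EFinP; exact: measurable_funM.
apply: le_trans (le_abse_integral mu mD mfg) _.
have [[x Dx]|D0] := pselect (D !=set0); last first.
  have -> : D = set0 by apply/seteqP; split=> // x Dx; apply: D0; exists x.
  by rewrite !integral_set0 mule0.
have M0 : (0 <= M)%R by apply: le_trans (gM _ Dx).
rewrite -ge0_integralZl//; last by apply/measurable_EFinP; exact: measurableT_comp.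
apply: ge0_le_integral => //.
- exact: measurableT_comp.
- by apply/measurable_EFinP; apply: measurable_funM => //; exact: measurableT_comp.
- by move=> y Dy; rewrite -EFinM lee_fin normrM mulrC ler_wpM2r// gM.
Qed.

(* AM-GM: |f| <= g <= (t + g ^ 2 / t) / 2. *)
Lemma integral_le_mean_square D f g (t : R) : measurable D -> measurable_fun D f ->
  measurable_fun D g -> (forall x, D x -> (`|f x| <= g x)%R) -> (0 < t)%R ->
  0 < mu D < +oo ->
  sqrte ((fine (mu D))^-1%:E * \int[mu]_(x in D) (g x ^+ 2)%:E) <= t%:E ->
  \int[mu]_(x in D) `|f x|%:E <= t%:E * mu D.
Proof.
move=> mD mf mg fg t0 /andP[D0 Doo] ht.
have Dfin : mu D \is a fin_num by rewrite ge0_fin_numE.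
have v0 : (0 < fine (mu D))%R by rewrite fine_gt0// D0.
have I0 : 0 <= \int[mu]_(x in D) (g x ^+ 2)%:E.
  by apply: integral_ge0 => x _; rewrite lee_fin sqr_ge0.
have {}ht : \int[mu]_(x in D) (g x ^+ 2)%:E <= (t ^+ 2 * fine (mu D))%:E.
  have : sqrte ((fine (mu D))^-1%:E * \int[mu]_(x in D) (g x ^+ 2)%:E) <= sqrte (t ^+ 2)%:E.
    by rewrite /= sqrtr_sqr gtr0_norm.
  by rewrite lee_sqrt ?lee_fin ?sqr_ge0// lee_pdivrMl// -EFinM mulrC.
have mg2 : measurable_fun D (fun x => (g x ^+ 2)%:E).
  by apply/measurable_EFinP; exact: measurable_funX.
have t20 : (0 <= (2 * t)^-1)%R by rewrite invr_ge0 mulr_ge0// ltW.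
apply: (@le_trans _ _ (\int[mu]_(x in D) ((t / 2)%:E + (2 * t)^-1%:E * (g x ^+ 2)%:E))).
  apply: ge0_le_integral => //.
  - by apply/measurable_EFinP; exact: measurableT_comp.
  - apply: emeasurable_funD => //; apply: emeasurable_funM => //.
  - move=> x Dx; rewrite -EFinM -EFinD lee_fin; apply: le_trans (fg x Dx) _.
    rewrite -subr_ge0 (_ : _ - _ = (2 * t)^-1 * (g x - t) ^+ 2)%R.
      by apply: mulr_ge0 => //; exact: sqr_ge0.
    by field; rewrite gt_eqF.
rewrite ge0_integralD//; last 3 first.
- by move=> x _; rewrite lee_fin divr_ge0// ltW.
- by move=> x _; rewrite mule_ge0 ?lee_fin ?sqr_ge0.
- exact: emeasurable_funM.
rewrite integral_cst// ge0_integralZl//; last first.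
  by move=> x _; rewrite lee_fin sqr_ge0.
apply: (@le_trans _ _ ((t / 2)%:E * mu D + (2 * t)^-1%:E * (t ^+ 2 * fine (mu D))%:E)).
  by rewrite leeD2l// lee_wpmul2l.
rewrite -(fineK Dfin)/= -!EFinM -EFinD lee_fin le_eqVlt; apply/orP; left; apply/eqP.
by field; rewrite gt_eqF.
Qed.

End measure_space.

Section weak_gradient_averages.
Context {R : realType} {n : nat}.
Notation V := 'rV[R]_n.+1.
Notation leb := (@lebesgueRn R n).
Implicit Types (h : 'I_n.+1 -> R -> R) (x y z : V).

Lemma eq_integral_support (A B : set V) (f : V -> \bar R) :
  (forall x, A x -> ~ B x -> f x = 0%E) -> (forall x, B x -> ~ A x -> f x = 0%E) ->
  (\int[leb]_(x in A) f x = \int[leb]_(x in B) f x)%E.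
Proof.
move=> hA hB; rewrite integral_mkcond [RHS]integral_mkcond.
congr (integral _ _ _); apply/funext => x; rewrite !patchE.
case: ifPn; case: ifPn => //; rewrite ?notin_setE ?in_setE => h1 h2.
  exact: hA.
by rewrite hB.
Qed.

(** On a set of finite measure, [|u| <= 1 + |u| ^+ p] reduces the claim to local integrability of
    the power. *)
Lemma Lploc_integrable (Omega : set V) p (u : V -> R) K : open Omega -> (0 < p)%N ->
  Lploc Omega p u -> compact K -> K `<=` Omega ->
  measurable (K : set (lebT R n)) -> (leb K < +oo)%E ->
  leb.-integrable K (EFin \o u).
Proof.
move=> oO p0 [mu pu] cK KO mK Kfin.
apply: (@le_integrable _ (lebT R n) R leb K mK _
    (fun x => ((1 : R)%:E + (`|u x| ^+ p)%:E)%E)).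
- apply/measurable_EFinP; apply: (@measurable_funS _ _ (lebT R n) R Omega) => //.
  exact: open_lebesgue_measurable.
- move=> x Kx /=; rewrite lee_fin.
  rewrite [leRHS]ger0_norm ?addr_ge0//; have [u1|u1] := leP `|u x| 1.
    by rewrite (le_trans u1)// lerDl.
  rewrite (@le_trans _ _ (`|u x| ^+ p))//; last by rewrite lerDr.
  by rewrite ler_eXnr// ltW.
- apply: integrableD => //; last exact: pu.
  apply/integrableP; split => //.
  under eq_integral do rewrite /= normr1.
  by rewrite integral_cst// mul1e.
Qed.

Context (Omega : set V) (Omega_open : open Omega).
Context (u : V -> R) (gradu : V -> V).
Hypothesis u_loc : Lploc Omega 2 u.
Hypothesis u_grad : weak_gradient Omega u gradu.

Lemma leb_box_fin (a b : V) : (leb (box a b) < +oo)%E.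
Proof.
have [ab|ab] := pselect (forall i, a 0 i <= b 0 i).
  exact: le_lt_trans (lebesgue_outer_box ab) (ltry _).
rewrite (_ : box a b = set0) ?measure0//.
apply/seteqP; split=> // x xab; apply: ab => i.
by have /andP[] := xab i; exact: le_trans.
Qed.

Lemma measurable_box (a b : V) : measurable (box a b : set (lebT R n)).
Proof. by apply: closed_lebesgue_measurable; exact: box_closed. Qed.

Definition pairing h : R := fine (\int[leb]_(x in Omega) (u x * prodf h x)%:E).

Definition admissible h (a b : V) := (forall i, smooth1 (h i)) /\
  (forall i s, ~~ (a 0 i <= s <= b 0 i) -> h i s = 0).

Lemma bounded_on_box (f : V -> R) (a b : V) : continuous f ->
  [bounded f x | x in box a b].
Proof.
move=> cf; have := @box_compact _ _ a b.
move=> /(continuous_compact (continuous_subspaceT cf))/compact_bounded[M [Mr MP]].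
by exists M; split => // M' MM' x xab; apply: (MP _ MM'); exists x.
Qed.

Lemma measurable_prodf h (D : set (lebT R n)) : measurable D ->
  (forall i, smooth1 (h i)) ->
  measurable_fun D (prodf h : lebT R n -> R).
Proof.
move=> mD hs; apply: measurable_funTS; apply: continuous_lebesgue_measurable.
by apply: prodf_continuous => i; exact: smooth1_continuous.
Qed.

Lemma pairing_box h a b (v : V -> R) : admissible h a b -> box a b `<=` Omega ->
  (\int[leb]_(x in Omega) (v x * prodf h x)%:E =
   \int[leb]_(x in box a b) (v x * prodf h x)%:E)%E.
Proof.
move=> [hs hab] abO; apply: eq_integral_support => x; last by move=> /abO.
by move=> _ xab; rewrite (prodf_out hab xab) mulr0.
Qed.

Lemma integrable_prodf h a b p (v : V -> R) : (0 < p)%N -> Lploc Omega p v ->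
  admissible h a b -> box a b `<=` Omega ->
  leb.-integrable (box a b) (fun x => (v x * prodf h x)%:E).
Proof.
move=> p0 vp [hs hab] abO.
have mb := measurable_box a b.
have iv : leb.-integrable (box a b) (EFin \o v).
  apply: (Lploc_integrable Omega_open p0 vp) => //; first exact: box_compact.
  exact: leb_box_fin.
apply: (@integrableMl _ (lebT R n) R leb (box a b) mb _ (prodf h) iv).
  exact: measurable_prodf.
apply: bounded_on_box; apply: prodf_continuous => i; exact: smooth1_continuous.
Qed.

(** The product with factor [P'] in position [k] is the [k]-th partial derivative of the test
    function with factor [P]. The definition of the weak gradient moves the derivative onto [u], and
    the remaining product is bounded by [M]. *)
Lemma pairing_diff h k (P P' : R -> R) (a b : V) (M : R) :
  admissible h a b -> smooth1 P -> smooth1 P' ->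
  (forall s : R, is_derive s 1 P (P' s)) ->
  (forall s, ~~ (a 0 k <= s <= b 0 k) -> P s = 0) ->
  (forall s, ~~ (a 0 k <= s <= b 0 k) -> P' s = 0) ->
  box a b `<=` Omega ->
  (forall x, `|prodf (upd h k P) x| <= M) ->
  (`|pairing (upd h k P')|%:E <= M%:E * \int[leb]_(x in box a b) `|gradu x 0 k|%:E)%E.
Proof.
move=> [hs hab] sP sP' dP Pab P'ab abO hM.
have adm Q : smooth1 Q -> (forall s, ~~ (a 0 k <= s <= b 0 k) -> Q s = 0) ->
    admissible (upd h k Q) a b.
  move=> sQ Qab; split=> i; rewrite /upd; first by case: ifP.
  by case: eqP => [->|_] s; [exact: Qab|exact: hab].
have aP := adm P sP Pab; have aP' := adm P' sP' P'ab.
have mb := measurable_box a b.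
have M0 : 0 <= M by apply: le_trans (hM 0).
have [gl gw] := u_grad k.
have mg : measurable_fun (box a b : set (lebT R n)) (fun x : lebT R n => gradu x 0 k).
  by apply: (@measurable_funS _ _ (lebT R n) R Omega) gl.1 => //; exact: open_lebesgue_measurable.
have parE x : partial k (prodf (upd h k P)) x = prodf (upd h k P') x.
  have := @is_derive_prodf _ _ (upd h k P) k P' x.
  rewrite {1}/upd eqxx => /(_ (dP _)) H; rewrite /partial (derive_val (is_derive := H)).
  by congr (prodf _ _); apply/funext => i; rewrite /upd; case: eqP.
have := gw _ (prodf_test_function aP.1 aP.2 abO).
rewrite /pairing.
under eq_integral do rewrite parE.
move=> ->; rewrite (pairing_box (fun x => gradu x 0 k) aP abO).
have iG := integrable_prodf (p:=1) isT gl aP abO.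
rewrite fineN normrN.
have fG := integrable_fin_num mb iG.
apply: le_trans (@le_abse_integral_prod _ (lebT R n) R leb (box a b)
  (fun x => gradu x 0 k) (prodf (upd h k P)) M mb mg _ _).
- by rewrite -abse_EFin fineK.
- by apply: measurable_prodf => //; exact: aP.1.
- by move=> x _; exact: hM.
Qed.

End weak_gradient_averages.

(** * One-dimensional bumps of given position and scale *)

Section scaled_bump.
Context {R : realType}.
Implicit Types (a r s : R).

(** The factor [r^-1] keeps the integral independent of [r] and makes [step1] a primitive. *)
Definition bump1 a r s : R := r^-1 * bump (r^-1 * s - r^-1 * a).
Definition step1 a r s : R := step (r^-1 * s - r^-1 * a).

Lemma smooth1_bump1 a r : smooth1 (bump1 a r).
Proof. exact: (smooth1_affine r^-1 (- (r^-1 * a)) r^-1 smooth1_bump). Qed.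

Lemma smooth1_step1 a r : smooth1 (step1 a r).
Proof.
have -> : step1 a r = fun s => 1 * step (r^-1 * s - r^-1 * a).
  by apply/funext => s; rewrite mul1r.
exact: (smooth1_affine r^-1 (- (r^-1 * a)) 1 smooth1_step).
Qed.

Lemma is_derive_step1 a r s : is_derive s 1 (step1 a r) (bump1 a r s).
Proof.
have dl : is_derive s 1 (fun t => r^-1 * t - r^-1 * a) r^-1.
  have H := is_deriveB (is_deriveZ r^-1 (is_derive_id s (1 : R)))
    (is_derive_cst (r^-1 * a) s (1 : R)).
  by apply: (is_derive_eq H); rewrite subr0 [LHS]mulr1.
have H := @is_derive1_comp _ step (fun t => r^-1 * t - r^-1 * a) s _ _ (is_derive_step _) dl.
by apply: (is_derive_eq H); rewrite mulrC.
Qed.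

Lemma bump1_ge0 a r s : 0 < r -> 0 <= bump1 a r s.
Proof. by move=> r0; rewrite mulr_ge0 ?bump_ge0// invr_ge0 ltW. Qed.

Lemma bump1_le a r s : 0 < r -> bump1 a r s <= r^-1 * bump_sup.
Proof. by move=> r0; rewrite ler_wpM2l ?bump_le// invr_ge0 ltW. Qed.

Lemma bump1_out a r s : 0 < r -> ~~ (a <= s <= a + r) -> bump1 a r s = 0.
Proof.
move=> r0 sar; rewrite /bump1 bump_out ?mulr0//; apply: contra sar.
rewrite -mulrBr (mulrC r^-1) ler_pdivrMr// ler_pdivlMr// mul0r mul1r.
by move=> /andP[h1 h2]; apply/andP; split; lra.
Qed.

Lemma step1_left a r s : 0 < r -> s <= a -> step1 a r s = step 0.
Proof.
move=> r0 sa; rewrite /step1 step_le0// -mulrBr pmulr_rle0 ?invr_gt0//.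
by rewrite subr_le0.
Qed.

Lemma step1_right a r s : 0 < r -> a + r <= s -> step1 a r s = 0.
Proof.
move=> r0 sa; rewrite /step1 step_ge1// -mulrBr (mulrC r^-1) ler_pdivlMr// mul1r.
by rewrite lerBrDl.
Qed.

(** [bump_sup] is the Lipschitz constant of [step]. The arguments of the two steps differ by [(a' -
    a) / r + (s - a') (r' - r) / (r r')], which is at most [(tau + 1) delta / (tau ^+ 2 * rho)] when
    both radii are at least [tau * rho]; then [tau <= 1] gives the 2. *)
Definition mollifier_lip (tau rho delta : R) := bump_sup * (2 * delta / (tau ^+ 2 * rho)).

(** A single step has no compact support, being a nonzero constant on the left. Two steps share
    their constants on both sides, so their difference is a legitimate factor of a test function. *)
Lemma step1_diff_out A rho a r a' r' s : 0 < r -> 0 < r' -> A <= a -> a + r <= A + rho ->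
  A <= a' -> a' + r' <= A + rho -> ~~ (A <= s <= A + rho) ->
  step1 a r s - step1 a' r' s = 0.
Proof.
move=> r0 r'0 h1 h2 h3 h4; rewrite negb_and -!ltNge => /orP[sA|As].
  by rewrite !step1_left ?subrr//; lra.
by rewrite !step1_right ?subrr//; lra.
Qed.

Lemma step1_diff_le A tau rho delta a r a' r' s : 0 < tau <= 1 -> 0 < rho ->
  tau * rho <= r -> tau * rho <= r' -> A <= a -> a + r <= A + rho ->
  A <= a' -> a' + r' <= A + rho -> `|a - a'| <= delta -> `|r - r'| <= delta ->
  `|step1 a r s - step1 a' r' s| <= mollifier_lip tau rho delta.
Proof.
move=> /andP[t0 t1] rho0 hr hr' h1 h2 h3 h4 ha hrr.
have tr0 : 0 < tau * rho by rewrite mulr_gt0.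
have r0 : 0 < r by exact: lt_le_trans hr.
have r'0 : 0 < r' by exact: lt_le_trans hr'.
have d0 : 0 <= delta by exact: le_trans ha.
have [sA|sA] := boolP (A <= s <= A + rho); last first.
  rewrite (step1_diff_out r0 r'0 h1 h2 h3 h4 sA) normr0.
  have X0 : 0 <= (tau ^+ 2 * rho)^-1 by rewrite invr_ge0 ltW// mulr_gt0// exprn_gt0.
  by rewrite mulr_ge0 ?(ltW bump_sup_gt0)// mulr_ge0// mulr_ge0.
apply: le_trans (step_lipschitz _ _) _; rewrite ler_wpM2l ?(ltW bump_sup_gt0)//.
have -> : r^-1 * s - r^-1 * a - (r'^-1 * s - r'^-1 * a') =
    r^-1 * (a' - a) + r^-1 * r'^-1 * ((s - a') * (r' - r)).
  by field; rewrite !gt_eqF.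
have rV : r^-1 <= (tau * rho)^-1 by rewrite lef_pV2.
have r'V : r'^-1 <= (tau * rho)^-1 by rewrite lef_pV2.
have r0V : 0 <= r^-1 by rewrite invr_ge0 ltW.
have r'0V : 0 <= r'^-1 by rewrite invr_ge0 ltW.
have sa' : `|s - a'| <= rho.
  by case/andP: sA => ? ?; rewrite ler_norml; apply/andP; split; lra.
apply: le_trans (ler_normD _ _) _.
rewrite !normrM (ger0_norm r0V) (ger0_norm r'0V) (distrC a') (distrC r').
apply: (@le_trans _ _ ((tau * rho)^-1 * delta + (tau * rho)^-1 * (tau * rho)^-1 * (rho * delta))).
  by rewrite lerD// !ler_pM// mulr_ge0.
have -> : (tau * rho)^-1 * delta + (tau * rho)^-1 * (tau * rho)^-1 * (rho * delta) =
   (tau + 1) * delta / (tau ^+ 2 * rho) by field; rewrite !gt_eqF.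
have X0 : 0 <= (tau ^+ 2 * rho)^-1 by rewrite invr_ge0 ltW// mulr_gt0// exprn_gt0.
rewrite (ler_wpM2r X0)// ler_wpM2r//; lra.
Qed.

End scaled_bump.

Section mollification.
Context {R : realType} {n : nat}.
Notation V := 'rV[R]_n.+1.
Notation leb := (@lebesgueRn R n).
Context (Omega : set V) (Omega_open : open Omega).
Context (u : V -> R) (gradu : V -> V).
Hypothesis u_loc : Lploc Omega 2 u.
Hypothesis u_grad : weak_gradient Omega u gradu.

Lemma pairingB h k (P Q : R -> R) (a b : V) : admissible h a b ->
  smooth1 P -> smooth1 Q ->
  (forall s, ~~ (a 0 k <= s <= b 0 k) -> P s = 0) ->
  (forall s, ~~ (a 0 k <= s <= b 0 k) -> Q s = 0) -> box a b `<=` Omega ->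
  pairing Omega u (upd h k (fun s => P s - Q s)) =
  pairing Omega u (upd h k P) - pairing Omega u (upd h k Q).
Proof.
move=> [hs hab] sP sQ Pab Qab abO.
have adm S : smooth1 S -> (forall s, ~~ (a 0 k <= s <= b 0 k) -> S s = 0) ->
    admissible (upd h k S) a b.
  move=> sS Sab; split=> i; rewrite /upd; first by case: ifP.
  by case: eqP => [->|_] s; [exact: Sab|exact: hab].
have aP := adm P sP Pab; have aQ := adm Q sQ Qab.
have aD : admissible (upd h k (fun s => P s - Q s)) a b.
  apply: adm; first exact: smooth1B.
  by move=> s ss; rewrite Pab// Qab// subrr.
have iP := integrable_prodf Omega_open (p:=2) isT u_loc aP abO.
have iQ := integrable_prodf Omega_open (p:=2) isT u_loc aQ abO.
have mb := measurable_box a b.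
rewrite /pairing (pairing_box u aP abO) (pairing_box u aQ abO) (pairing_box u aD abO).
rewrite -fineB; [|exact: (integrable_fin_num mb iP)|exact: (integrable_fin_num mb iQ)].
rewrite -(integralB_EFin mb iP iQ); congr fine; apply: eq_integral => x _.
by rewrite -EFinB !prodf_upd; congr EFin; ring.
Qed.

Definition mollifier (y : V) (r : R) : 'I_n.+1 -> R -> R := fun i => bump1 (y 0 i) r.

(** There are [n.+1] coordinate switches. Each costs the sup of a difference of steps, times [n]
    bumps of height at most [(tau * rho)^-1 * bump_sup], times the integral [I] of one gradient
    component over a cube containing both supports. *)
Lemma mollifier_lipschitz (b y y' : V) (tau rho delta r r' I : R) :
  0 < tau <= 1 -> 0 < rho -> box b (b + const_mx rho) `<=` Omega ->
  tau * rho <= r -> tau * rho <= r' ->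
  (forall i, b 0 i <= y 0 i /\ y 0 i + r <= b 0 i + rho) ->
  (forall i, b 0 i <= y' 0 i /\ y' 0 i + r' <= b 0 i + rho) ->
  (forall i, `|y 0 i - y' 0 i| <= delta) -> `|r - r'| <= delta ->
  (forall k, (\int[leb]_(x in box b (b + const_mx rho)) `|gradu x 0 k|%:E <= I%:E)%E) ->
  `|pairing Omega u (mollifier y r) - pairing Omega u (mollifier y' r')| <=
  n.+1%:R * (mollifier_lip tau rho delta * ((tau * rho)^-1 * bump_sup) ^+ n * I).
Proof.
move=> t01 rho0 bO hr hr' hy hy' yy' rr' hI.
have tr0 : 0 < tau * rho by rewrite mulr_gt0//; case/andP: t01.
have r0 : 0 < r by exact: lt_le_trans hr.
have r'0 : 0 < r' by exact: lt_le_trans hr'.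
(* The coordinates are switched one at a time: switching coordinate [k] changes
   the test function by a derivative in the direction [k]. *)
pose mix (k : nat) (i : 'I_n.+1) := if (i < k)%N then bump1 (y' 0 i) r' else bump1 (y 0 i) r.
have admix k : admissible (mix k) b (b + const_mx rho).
  split=> i; rewrite /mix; first by case: ifP => _; exact: smooth1_bump1.
  move=> s; rewrite !mxE => sb.
  have [h1 h2] := hy i; have [h3 h4] := hy' i.
  by case: ifP => _; apply: bump1_out => //; apply: contra sb => /andP[? ?];
    apply/andP; split; lra.
have mix_le k i s : `|mix k i s| <= (tau * rho)^-1 * bump_sup.
  rewrite /mix; case: ifP => _; rewrite ger0_norm ?bump1_ge0//.
    apply: le_trans (bump1_le _ _ r'0) _.
    by rewrite ler_wpM2r ?(ltW bump_sup_gt0)// lef_pV2.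
  apply: le_trans (bump1_le _ _ r0) _.
  by rewrite ler_wpM2r ?(ltW bump_sup_gt0)// lef_pV2.
set M := mollifier_lip tau rho delta * _ ^+ n.
have step_le (k : 'I_n.+1) : `|pairing Omega u (mix k) - pairing Omega u (mix k.+1)| <= M * I.
  have E1 : mix k = upd (mix k) k (bump1 (y 0 k) r).
    by apply/funext => i; rewrite /mix /upd; case: eqP => [->|//]; rewrite ltnn.
  have E2 : mix k.+1 = upd (mix k) k (bump1 (y' 0 k) r').
    apply/funext => i; rewrite /mix /upd ltnS; case: eqP => [->|ik]; first by rewrite leqnn.
    by rewrite leq_eqVlt (_ : (i == k :> nat) = false)//; apply/eqP => /val_inj.
  rewrite E1 E2.
  have [h1 h2] := hy k; have [h3 h4] := hy' k.
  have bo s : ~~ (b 0 k <= s <= (b + const_mx rho) 0 k) -> bump1 (y 0 k) r s = 0.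
    rewrite !mxE => sb; apply: bump1_out => //; apply: contra sb => /andP[? ?].
    by apply/andP; split; lra.
  have bo' s : ~~ (b 0 k <= s <= (b + const_mx rho) 0 k) -> bump1 (y' 0 k) r' s = 0.
    rewrite !mxE => sb; apply: bump1_out => //; apply: contra sb => /andP[? ?].
    by apply/andP; split; lra.
  rewrite -(pairingB (admix k) (smooth1_bump1 _ _) (smooth1_bump1 _ _) bo bo' bO).
  rewrite -lee_fin.
  apply: le_trans (@pairing_diff _ _ _ Omega_open _ _ u_grad (mix k) k
    (fun s => step1 (y 0 k) r s - step1 (y' 0 k) r' s) _ b (b + const_mx rho) M
    (admix k) _ _ _ _ _ bO _) _.
  - by apply: smooth1B; exact: smooth1_step1.
  - by apply: smooth1B; exact: smooth1_bump1.
  - by move=> s; exact: is_deriveB (is_derive_step1 _ _ _) (is_derive_step1 _ _ _).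
  - by move=> s; rewrite !mxE => sb; exact: (step1_diff_out r0 r'0 h1 h2 h3 h4).
  - by move=> s sb; rewrite bo// bo'// subrr.
  - move=> x; rewrite prodf_upd normrM.
    rewrite ler_pM// ?(step1_diff_le _ t01 rho0 hr hr' h1 h2 h3 h4)//.
    rewrite normr_prod (@le_trans _ _ (\prod_(i < n.+1 | i != k) ((tau * rho)^-1 * bump_sup)))//.
      by apply: ler_prod => i _; rewrite normr_ge0 mix_le.
    by rewrite (eq_bigl (fun i => i \in predC1 k))// prodr_const cardC1 card_ord.
  - rewrite (EFinM M I) lee_wpmul2l// lee_fin mulr_ge0//.
      by apply: le_trans (step1_diff_le 0 t01 rho0 hr hr' h1 h2 h3 h4 (yy' k) rr').
    by rewrite exprn_ge0// mulr_ge0 ?(ltW bump_sup_gt0)// invr_ge0 ltW.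
have tele k : (k <= n.+1)%N ->
    `|pairing Omega u (mix 0%N) - pairing Omega u (mix k)| <= k%:R * (M * I).
  elim: k => [|k IH] kn; first by rewrite subrr normr0 mul0r.
  have := step_le (Ordinal kn); have := IH (ltnW kn) => /= h1 h2.
  have := ler_distD (pairing Omega u (mix k)) (pairing Omega u (mix 0%N)) (pairing Omega u (mix k.+1)).
  rewrite -natr1 mulrDl mul1r => h3; apply: le_trans h3 _; exact: lerD.
have -> : mollifier y r = mix 0%N by [].
have -> : mollifier y' r' = mix n.+1.
  by apply/funext => i; rewrite /mix ltn_ord.
exact: tele.
Qed.

End mollification.

Lemma integral_weighted_near d (T : measurableType d) (R : realType)
  (mu : {measure set T -> \bar R}) (D : set T) (f g : T -> R) (v eps : R) :
  measurable D -> mu.-integrable D (fun x => (f x * g x)%:E) ->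
  mu.-integrable D (fun x => (g x)%:E) ->
  (forall x, D x -> 0 <= g x) -> (forall x, D x -> `|f x - v| <= eps) ->
  `|fine (\int[mu]_(x in D) (f x * g x)%:E) - v * fine (\int[mu]_(x in D) (g x)%:E)|
    <= eps * fine (\int[mu]_(x in D) (g x)%:E).
Proof.
move=> mD ifg ig g0 fv.
have ivg c : mu.-integrable D (fun x => (c * g x)%:E).
  by under eq_fun do rewrite EFinM; exact: integrableZl.
have vE c : c * fine (\int[mu]_(x in D) (g x)%:E) = fine (\int[mu]_(x in D) (c * g x)%:E).
  under [in RHS]eq_integral do rewrite EFinM.
  by rewrite (integralZl mD ig) fineM// integrable_fin_num.
rewrite !vE -fineB; [|exact: (integrable_fin_num mD ifg)|exact: (integrable_fin_num mD (ivg v))].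
rewrite -(integralB_EFin mD ifg (ivg v)).
rewrite -lee_fin (fineK (integrable_fin_num mD (ivg eps))).
have id : mu.-integrable D (fun x => ((f x * g x)%:E - (v * g x)%:E)%E).
  by apply: integrableB => //; exact: ivg.
rewrite -abse_EFin (fineK (integrable_fin_num mD id)).
apply: le_trans (le_abse_integral mu mD (measurable_int _ id)) _.
apply: ge0_le_integral => //.
- by apply: measurableT_comp => //; exact: measurable_int id.
- exact: measurable_int (ivg eps).
- move=> x Dx; rewrite -EFinB -mulrBl abse_EFin lee_fin normrM (ger0_norm (g0 x Dx)).
  by rewrite ler_wpM2r ?g0// fv.
Qed.

(** * The integral of a bump, and averages near a constant *)

Section mollifier_mass.
Context {R : realType} {n : nat}.
Notation V := 'rV[R]_n.+1.
Notation leb := (@lebesgueRn R n).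

Definition unit_bump : V -> R := prodf (fun=> bump).
(** The bumps are not normalised: averages of [u] are compared with [mass] times values of [u], and
    [mass] is divided out only in the final pointwise estimate. *)
Definition mass : R := fine (\int[leb]_x (unit_bump x)%:E).

Lemma unit_bump_admissible : admissible (fun=> @bump R) (0 : V) (const_mx 1).
Proof.
split=> i; first exact: smooth1_bump.
by move=> s; rewrite !mxE; exact: bump_out.
Qed.

Lemma unit_bump_ge0 x : 0 <= unit_bump x.
Proof. by apply: prodr_ge0 => i _; exact: bump_ge0. Qed.

Lemma integral_unit_bump : (\int[leb]_x (unit_bump x)%:E =
  \int[leb]_(x in box (0%R : V) (const_mx 1%R)) (unit_bump x)%:E)%E.
Proof.
apply: eq_integral_support => [x _ xab|x _ /(_ I)//].
by rewrite /unit_bump (prodf_out unit_bump_admissible.2 xab).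
Qed.

Lemma measurable_unit_bump (D : set (lebT R n)) : measurable D ->
  measurable_fun D (fun x : lebT R n => (unit_bump x)%:E).
Proof.
move=> mD; apply/measurable_EFinP; apply: measurable_prodf => // i.
exact: smooth1_bump.
Qed.

Lemma integral_unit_bump_fin : (\int[leb]_x (unit_bump x)%:E)%E \is a fin_num.
Proof.
rewrite integral_unit_bump.
have mb := measurable_box (0%R : V) (const_mx 1%R).
rewrite ge0_fin_numE; last first.
  by apply: integral_ge0 => x _; rewrite lee_fin unit_bump_ge0.
apply: (@le_lt_trans _ _ (\int[leb]_(x in box (0%R : V) (const_mx 1%R)) (bump_sup ^+ n.+1)%:E)%E).
  apply: (@ge0_le_integral _ (lebT R n) R leb _ mb) => //.
  - by move=> x _; rewrite lee_fin unit_bump_ge0.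
  - exact: measurable_unit_bump.
  - move=> x _; rewrite lee_fin -(card_ord n.+1) -prodr_const.
    by apply: ler_prod => i _; rewrite bump_ge0 bump_le.
rewrite (@integral_cst _ (lebT R n) R leb _ mb).
by rewrite lte_mul_pinfty ?leb_box_fin// lee_fin exprn_ge0// ltW// bump_sup_gt0.
Qed.

(** By continuity every factor is at least half of [bump 2^-1 > 0] on a small interval starting at
    [2^-1], and a cube of positive side has positive measure. *)
Lemma mass_gt0 : 0 < mass.
Proof.
have [e e0 He] : exists2 e : R, 0 < e & forall s, `|2^-1 - s| < e -> bump (2^-1 : R) / 2 <= bump s.
  have b0 := @bump_half_gt0 R.
  have c := @smooth1_continuous R bump smooth1_bump 2^-1.
  have b20 : 0 < bump (2^-1 : R) / 2 by rewrite divr_gt0.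
  move/cvgrPdist_lt : c => /(_ _ b20)/nbhs_ballP[e /= e0 H]; exists e => // s se.
  have := H s; rewrite -ball_normE /= => /(_ se).
  by rewrite ltr_norml => /andP[_]; lra.
pose a : V := const_mx 2^-1; pose B := box a (a + const_mx (e / 2)).
have mB : measurable (B : set (lebT R n)) := measurable_box _ _.
have c0 : 0 < (bump (2^-1 : R) / 2) ^+ n.+1 by rewrite exprn_gt0// divr_gt0// bump_half_gt0.
have B0 : (0 < leb B)%E by apply: leb_box_gt0; rewrite divr_gt0.
rewrite fine_gt0//; apply/andP; split; last first.
  by have := integral_unit_bump_fin; rewrite fin_numE -ltey => /andP[].
apply: (@lt_le_trans _ _ (\int[leb]_(x in B) ((bump (2^-1 : R) / 2) ^+ n.+1)%:E)%E).
  by rewrite (@integral_cst _ (lebT R n) R leb _ mB) mule_gt0.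
apply: (@le_trans _ _ (\int[leb]_(x in B) (unit_bump x)%:E)%E).
  apply: (@ge0_le_integral _ (lebT R n) R leb _ mB) => //.
  - by move=> x _; rewrite lee_fin ltW.
  - exact: measurable_unit_bump.
  - move=> x xB; rewrite lee_fin -(card_ord n.+1) -prodr_const.
    apply: ler_prod => i _; rewrite divr_ge0 ?bump_ge0//=.
    apply: He; have := xB i; rewrite !mxE => /andP[? ?].
    by rewrite ltr_norml; apply/andP; split; lra.
apply: (@ge0_subset_integral _ (lebT R n) R leb B setT mB) => //.
- exact: measurable_unit_bump.
- by move=> x _; rewrite lee_fin unit_bump_ge0.
Qed.

Lemma prodf_mollifier (y x : V) (r : R) :
  prodf (mollifier y r) x = r^-1 ^+ n.+1 * unit_bump (rescale y r x).
Proof.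
rewrite /prodf /mollifier /bump1 /unit_bump /prodf big_split/= prodr_const card_ord.
by congr (_ * _); apply: eq_bigr => i _; rewrite /rescale !mxE mulrBr.
Qed.

Lemma prodf_mollifier_ge0 (y x : V) (r : R) : 0 < r -> 0 <= prodf (mollifier y r) x.
Proof. by move=> r0; apply: prodr_ge0 => i _; exact: bump1_ge0. Qed.

Lemma mollifier_admissible (y : V) (r : R) : 0 < r ->
  admissible (mollifier y r) y (y + const_mx r).
Proof.
move=> r0; split=> i; first exact: smooth1_bump1.
by move=> s; rewrite !mxE; exact: bump1_out.
Qed.

Lemma integral_mollifier (y : V) (r : R) : 0 < r ->
  (\int[leb]_(x in box y (y + const_mx r)) (prodf (mollifier y r) x)%:E = mass%:E)%E.
Proof.
move=> r0; have -> : (\int[leb]_(x in box y (y + const_mx r)) (prodf (mollifier y r) x)%:E =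
    \int[leb]_x (prodf (mollifier y r) x)%:E)%E.
  apply: eq_integral_support => [x _ /(_ I)//|x _ xb].
  by rewrite (prodf_out (mollifier_admissible y r0).2 xb).
have rV0 : 0 <= r^-1 ^+ n.+1 by rewrite exprn_ge0// invr_ge0 ltW.
pose F (x : V) := (r^-1 ^+ n.+1 * unit_bump x)%:E.
have mF : measurable_fun [set: lebT R n] (F : lebT R n -> \bar R).
  apply/measurable_EFinP; apply: measurable_funM => //.
  by apply/measurable_EFinP; exact: measurable_unit_bump.
have F0 x : (0 <= F x)%E by rewrite lee_fin mulr_ge0// unit_bump_ge0.
transitivity (\int[leb]_x F (rescale y r x))%E.
  by apply: eq_integral => x _; rewrite prodf_mollifier.
rewrite integral_rescale// /F.
under eq_integral do rewrite EFinM.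
rewrite (@ge0_integralZl _ (lebT R n) R leb setT measurableT (fun x => (unit_bump x)%:E))//.
- rewrite muleA -EFinM exprVn mulfV ?gt_eqF ?exprn_gt0// mul1e.
  by rewrite fineK// integral_unit_bump_fin.
- exact: measurable_unit_bump.
- by move=> x _; rewrite lee_fin unit_bump_ge0.
Qed.

Lemma pairing_mollifier_near (Omega : set V) (u : V -> R) (y : V) (r v eps : R) :
  open Omega -> Lploc Omega 2 u -> 0 < r -> box y (y + const_mx r) `<=` Omega ->
  (forall x, box y (y + const_mx r) x -> `|u x - v| <= eps) ->
  `|pairing Omega u (mollifier y r) - v * mass| <= eps * mass.
Proof.
move=> oO ul r0 bO uv; have adm := mollifier_admissible y r0.
have mb := measurable_box y (y + const_mx r).
have iu := integrable_prodf oO (p:=2) isT ul adm bO.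
have i1 : leb.-integrable (box y (y + const_mx r)) (fun x => (prodf (mollifier y r) x)%:E).
  apply/integrableP; split.
    by apply/measurable_EFinP; exact: (measurable_prodf mb adm.1).
  under eq_integral do rewrite abse_EFin ger0_norm ?prodf_mollifier_ge0//.
  by rewrite integral_mollifier// ltry.
have := @integral_weighted_near _ (lebT R n) R leb _ u (prodf (mollifier y r)) v eps
  mb iu i1 (fun x _ => prodf_mollifier_ge0 y x r0) uv.
by rewrite integral_mollifier// /pairing (pairing_box u adm bO).
Qed.

End mollifier_mass.

(** * Carrot paths in John domains *)

Section mean_value_form.
Context {R : realType} {n : nat}.
Notation V := 'rV[R]_n.+1.
Notation leb := (@lebesgueRn R n).

(** The quantity whose supremum over a cone is [nt_maximal], with centre and radius made
    explicit. *)
Definition sqrt_mean_square (gradu : V -> V) (c : V) (r : R) : \bar R :=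
  sqrte ((fine (leb (eball c r)))^-1%:E *
         \int[leb]_(z in eball c r) (enorm (gradu z) ^+ 2)%:E)%E.

(** This is [mollifier_lipschitz] with [I = t * (2 * Lam * rho) ^+ n.+1], where a cube of side
    [2 * R0 <= 2 * Lam * rho] bounds the measure of the ball. The powers of [rho] cancel, so the
    constant does not depend on the scale. *)
Definition lipC (tau Lam : R) : R :=
  n.+1%:R * (bump_sup * (2 / tau ^+ 2) * (bump_sup / tau) ^+ n * (2 * Lam) ^+ n.+1).

Lemma lipC_ge0 (tau Lam : R) : 0 < tau -> 0 < Lam -> 0 <= lipC tau Lam.
Proof.
move=> t0 L0; have K0 := @bump_sup_gt0 R.
by rewrite ltW// /lipC !mulr_gt0// ?invr_gt0 ?exprn_gt0 ?divr_gt0 ?mulr_gt0.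
Qed.

Lemma mollifier_lipschitz_mean (Omega : set V) (u : V -> R) (gradu : V -> V)
  (c b y y' : V) (tau Lam rho R0 delta r r' t : R) :
  open Omega -> Lploc Omega 2 u -> weak_gradient Omega u gradu ->
  0 < R0 -> eball c R0 `<=` Omega -> 0 < t ->
  (sqrt_mean_square gradu c R0 <= t%:E)%E ->
  0 < tau <= 1 -> 0 < rho -> box b (b + const_mx rho) `<=` eball c R0 ->
  R0 <= Lam * rho ->
  tau * rho <= r -> tau * rho <= r' ->
  (forall i, b 0 i <= y 0 i /\ y 0 i + r <= b 0 i + rho) ->
  (forall i, b 0 i <= y' 0 i /\ y' 0 i + r' <= b 0 i + rho) ->
  enorm (y - y') <= delta -> `|r - r'| <= delta ->
  `|pairing Omega u (mollifier y r) - pairing Omega u (mollifier y' r')| <=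
  lipC tau Lam * delta * t.
Proof.
move=> oO ul ug R00 cO t0 mt t01 rho0 bc RL hr hr' hy hy' yy' rr'.
have mB : measurable (eball c R0 : set (lebT R n)).
  by apply: open_lebesgue_measurable; exact: eball_open.
have mO : measurable (Omega : set (lebT R n)) by exact: open_lebesgue_measurable.
have mgO k : measurable_fun (Omega : set (lebT R n)) (fun x : lebT R n => gradu x 0 k).
  by have [[]] := ug k.
have mg k : measurable_fun (eball c R0 : set (lebT R n)) (fun x : lebT R n => gradu x 0 k).
  by apply: (@measurable_funS _ _ (lebT R n) R Omega) (mgO k).
have mbx := measurable_box b (b + const_mx rho).
have mN : measurable_fun (eball c R0 : set (lebT R n)) (fun x : lebT R n => enorm (gradu x)).
  have -> : (fun x : lebT R n => enorm (gradu x)) =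
      Num.sqrt \o (fun x => \sum_i gradu x 0 i ^+ 2) by [].
  apply: measurableT_comp; first by apply: continuous_measurable_fun; exact: sqrt_continuous.
  by apply: measurable_sum => i; exact: measurable_funX.
have ball_bd : (0 < leb (eball c R0) < +oo)%E.
  rewrite leb_eball_gt0//=; apply: le_lt_trans (leb_eball_le _ (ltW R00)) _.
  exact: ltry.
pose I := t * (2 * Lam * rho) ^+ n.+1.
have hI k : (\int[leb]_(x in box b (b + const_mx rho)) `|gradu x 0 k|%:E <= I%:E)%E.
  apply: (@le_trans _ _ (\int[leb]_(x in eball c R0) `|gradu x 0 k|%:E)%E).
    apply: (@ge0_subset_integral _ (lebT R n) R leb _ _ mbx mB) => //.
    by apply/measurable_EFinP; apply: measurableT_comp => //; exact: mg.
  apply: le_trans (@integral_le_mean_square _ (lebT R n) R leb _ (fun x => gradu x 0 k)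
    (fun x => enorm (gradu x)) t mB (mg k) mN _ t0 ball_bd mt) _.
    by move=> x _; exact: coord_le_enorm.
  rewrite /I EFinM lee_wpmul2l ?lee_fin ?(ltW t0)//.
  apply: le_trans (leb_eball_le _ (ltW R00)) _; rewrite lee_fin.
  have RLr : 2 * R0 <= 2 * Lam * rho by rewrite -mulrA ler_wpM2l.
  have R20 : 0 <= 2 * R0 by rewrite mulr_ge0// ltW.
  by rewrite lerXn2r ?nnegrE// (le_trans R20).
have bO : box b (b + const_mx rho) `<=` Omega by exact: subset_trans cO.
have yyi i : `|y 0 i - y' 0 i| <= delta.
  by apply: le_trans yy'; have := coord_le_enorm (y - y') i; rewrite !mxE.
apply: le_trans (mollifier_lipschitz oO ul ug t01 rho0 bO hr hr' hy hy' yyi rr' hI) _.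
rewrite le_eqVlt; apply/orP; left; apply/eqP.
rewrite /lipC /I /mollifier_lip.
have [t00 _] := andP t01.
have -> : (tau * rho)^-1 * bump_sup = (bump_sup / tau) * rho^-1.
  by rewrite invfM; ring.
rewrite [in LHS]exprMn [(2 * Lam * rho) ^+ _]exprMn exprVn [rho ^+ n.+1]exprS.
have r1 : rho ^+ n != 0 by rewrite expf_neq0// gt_eqF.
move: (rho ^+ n) r1 ((bump_sup / tau) ^+ n) ((2 * Lam) ^+ n.+1) => A A0 B C.
by field; rewrite A0 !gt_eqF.
Qed.

End mean_value_form.

Section domain_geometry.
Context {R : realType} {n : nat}.
Notation V := 'rV[R]_n.+1.
Implicit Types (Omega A : set V) (x p : V).

Lemma boundary_closed Omega : closed (boundary Omega).
Proof.
rewrite /boundary setDE; apply: closedI; first exact: closed_closure.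
by rewrite closedC; exact: open_interior.
Qed.

Lemma closure_not_boundary Omega p : closure Omega p -> ~ boundary Omega p -> Omega p.
Proof.
by move=> cp bp; apply: interior_subset; apply: contrapT => ip; apply: bp; split.
Qed.

Lemma boundary_not_open Omega p : open Omega -> boundary Omega p -> ~ Omega p.
Proof. by move=> oO [_ ip] Op; apply: ip; rewrite (interior_id _).1. Qed.

Lemma within_continuous_dist (T : pseudoMetricType R) (W : normedModType R) (A : set T) (f : T -> W) (x : T) :
  {within A, continuous f} -> A x -> forall e : R, 0 < e ->
  exists2 d : R, 0 < d & forall y, A y -> ball x d y -> `|f x - f y| < e.
Proof.
move=> /subspace_continuousP cf Ax e e0.
have /cvgrPdist_lt /(_ e e0) := cf x Ax.
rewrite /within/= => /nbhs_ballP[d d0 dP]; exists d => // y Ay xy.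
exact: dP.
Qed.

(** A segment from [p] inside the ball does not meet the boundary, and a connected set that starts
    in [Omega] and avoids its boundary stays in [Omega]. *)
Lemma open_eball_dist Omega p (r : R) : open Omega -> Omega p ->
  boundary Omega !=set0 -> r <= dist p (boundary Omega) -> eball p r `<=` Omega.
Proof.
move=> oO Op b0 rd q; rewrite /eball/= => qp.
pose g (s : R) : V := p + s *: (q - p).
have gball s : 0 <= s <= 1 -> ~ boundary Omega (g s).
  move=> /andP[s0 s1] bg; have := dist_le p bg.
  rewrite /g opprD addrA subrr add0r enormN enormZ ger0_norm// => h.
  have := enorm_ge0 (q - p); have := ler_wpM2r (enorm_ge0 (q - p)) s1.
  by rewrite mul1r => h1 h2; lra.
have gc : continuous g.
  by move=> s; apply: cvgD; [exact: cvg_cst|apply: cvgZr_tmp; exact: cvg_id].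
(* [B] is relatively open as the trace of [Omega], and relatively closed as the trace of
   [closure Omega], since boundary points are excluded by [gball]. *)
pose B : set R := `[0, 1] `&` g @^-1` Omega.
have BE : B = `[0, 1]%classic.
  apply: (@segment_connected R 0 1).
  - by exists 0; split=> /=; rewrite ?in_itv/= ?lexx ?ler01// /g scale0r addr0.
  - by exists (g @^-1` Omega) => //; apply: open_comp => // s _; exact: gc.
  - exists (g @^-1` closure Omega).
      by apply: preimage_closed; [move=> s _; exact: gc|exact: closed_closure].
    apply/seteqP; split=> s [s01 Os]; split=> //.
      exact: subset_closure.
    by apply: closure_not_boundary => //; apply: gball; move: s01; rewrite /= in_itv.
have : B 1 by rewrite BE /= in_itv/= ler01 lexx.
by move=> [_]; rewrite /g /= scale1r addrC subrK.
Qed.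

Lemma path_length_ge (p : R -> V) (M : nat) : (0 < M)%N ->
  ((\sum_(0 <= k < M) enorm (p (k.+1%:R / M%:R) - p (k%:R / M%:R)))%:E
    <= path_length p)%E.
Proof.
move=> M0; apply: ereal_sup_ubound.
have MR : (0 : R) < M%:R by rewrite ltr0n.
pose s := [seq k.+1%:R / M%:R : R | k <- iota 0 M].
have ss : size s = M by rewrite size_map size_iota.
have sn k : (k <= M)%N -> nth 1 (0 :: s) k = k%:R / M%:R.
  case: k => [|k] kM /=; first by rewrite mul0r.
  by rewrite (nth_map 0%N) ?size_iota// nth_iota.
exists s.
  split; last first.
    by rewrite (last_nth 1) ss sn// divff// gt_eqF.
  apply/(pathP 1) => k; rewrite ss => kM.
  rewrite (sn k (ltnW kM)) (_ : nth 1 s k = nth 1 (0 :: s) k.+1)// sn//.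
  by rewrite ltr_pM2r ?invr_gt0// ltr_nat.
congr EFin; rewrite ss; apply: eq_big_nat => k /andP[_ kM].
by rewrite !sn// ltnW.
Qed.

(** Heine's theorem by compactness. Passing from the max norm of the topology to [enorm] costs the
    factor [n.+1]. *)
Lemma path_unif_continuous (p : R -> V) (e : R) : {within `[0, 1], continuous p} ->
  0 < e -> exists2 d : R, 0 < d & forall s t, 0 <= s <= 1 -> 0 <= t <= 1 ->
    `|s - t| < d -> enorm (p s - p t) < e.
Proof.
move=> cp e0; have /compact_near_coveringP := @segment_compact R 0 1.
pose P (d : R) (s : R) := forall t, 0 <= s <= 1 -> 0 <= t <= 1 -> `|s - t| < d -> enorm (p s - p t) < e.
move=> /(_ R (0 : R)^'+ P _)[].
  move=> s s01.
  have e'0 : 0 < e / (2 * n.+1%:R) by rewrite divr_gt0// mulr_gt0.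
  have [d d0 dP] := within_continuous_dist cp s01 e'0.
  have d20 : 0 < d / 2 by rewrite divr_gt0.
  exists (ball s (d / 2), [set x | x < d / 2]).
    by split=> /=; [exact: nbhsx_ballx|exact: nbhs_right_lt].
  move=> [s' d'] /= [ss' dd'] t s'01 t01 st.
  rewrite -ball_normE/= in ss'.
  have h1 : `|p s - p s'| < e / (2 * n.+1%:R).
    by apply: dP; rewrite -?ball_normE/= ?in_itv//; lra.
  have h2 : `|p s - p t| < e / (2 * n.+1%:R).
    apply: dP; rewrite -?ball_normE/= ?in_itv//.
    by have := ler_distD s' s t; lra.
  have h3 := ler_distD (p s) (p s') (p t); rewrite distrC in h1.
  apply: le_lt_trans (enorm_normr _) _.
  rewrite mulrC -ltr_pdivlMr ?ltr0n//.
  apply: le_lt_trans h3 _.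
  have -> : e / n.+1%:R = e / (2 * n.+1%:R) + e / (2 * n.+1%:R).
    by rewrite invfM mulrA -mulrDl -splitr.
  by rewrite ltrD.
move=> d /= d0 dP; exists (d / 2); first by rewrite divr_gt0.
move=> s t s01 t01 st; apply: (dP (d / 2)) => //=.
- by rewrite sub0r normrN gtr0_norm ?divr_gt0// ltr_pdivrMr// ltr_pMr// ltr1n.
- by rewrite divr_gt0.
Qed.

End domain_geometry.

Section carrot_paths.
Context {R : realType} {n : nat}.
Notation V := 'rV[R]_n.+1.
Context (Omega : set V) (Omega_open : open Omega).
Context (u : V -> R) (gradu : V -> V).
Hypothesis u_loc : Lploc Omega 2 u.
Hypothesis u_grad : weak_gradient Omega u gradu.
Hypothesis u_cont : {within closure Omega, continuous u}.
Notation E := (boundary Omega).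
Notation U y r := (pairing Omega u (mollifier y r)).
Implicit Types (x y z c p q : V) (theta t : R).

(* With this constant the cube of half side [2 * kappa theta * enorm (q - x)] at a
   point [q] of a carrot path fits into the ball of radius a quarter of the
   distance of [q] to the boundary. *)
Definition kappa theta : R := theta / (16 * n.+1%:R).

Lemma kappa_bounds theta : 0 < theta < 1 ->
  [/\ 0 < kappa theta, kappa theta <= 1 & kappa theta * (16 * n.+1%:R) = theta].
Proof.
move=> /andP[t0 t1]; have N0 : (0 : R) < 16 * n.+1%:R by rewrite mulr_gt0.
split; first by rewrite divr_gt0.
  rewrite /kappa ler_pdivrMr// mul1r; apply: le_trans (ltW t1) _.
  by rewrite -natrM ler1n.
by rewrite /kappa divfK// gt_eqF.
Qed.

(** Control of the gradient on the cone where carrot paths to [x] live. That cone lies inside the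
    cone of [nt_maximal] with aperture [theta^-1], because [theta^-1 * d < (1 + theta^-1) * d]. *)
Definition mean_bound theta x t := forall y, Omega y ->
  theta * enorm (y - x) <= dist y E ->
  (sqrt_mean_square gradu y (4^-1 * dist y E) <= t%:E)%E.

Lemma box_eball c (a : V) (rho R0 : R) : (forall i, c 0 i - R0 <= a 0 i) ->
  (forall i, a 0 i + rho <= c 0 i + R0) ->
  forall R1, n.+1%:R * R0 < R1 -> box a (a + const_mx rho) `<=` eball c R1.
Proof.
move=> h1 h2 R1 hR y yab; rewrite /eball/=; apply: le_lt_trans hR.
apply: enorm_le_coord => i; have := yab i; rewrite !mxE => /andP[h3 h4].
by have := h1 i; have := h2 i => h5 h6; rewrite ler_norml; apply/andP; split; lra.
Qed.

(** In a step, both bumps have size at least [r / 2] and lie in a cube of side [3 * r], whence the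
    ratio [6^-1]. At the endpoint, the sizes lie between [kappa theta * d] and
    [kappa theta * d / theta], whence the ratio [theta]. *)
Definition stepC theta := lipC (n := n) 6^-1 (kappa theta)^-1.
Definition endC theta := lipC (n := n) theta (kappa theta)^-1.

(** With [r] the size of the bump at [q], a move by at most [r / 2] keeps the new size between
    [r / 2] and [3 * r / 2]. Both supports then fit in the cube with corner [q - r] and side
    [3 * r], which lies in the ball around [q] where [mean_bound] applies. *)
Lemma carrot_step theta x t q q' : 0 < theta < 1 -> 0 < t -> E x ->
  mean_bound theta x t -> Omega q -> q != x ->
  theta * enorm (q - x) <= dist q E ->
  enorm (q - q') <= kappa theta * enorm (q - x) / 2 ->
  `|U q (kappa theta * enorm (q - x)) - U q' (kappa theta * enorm (q' - x))| <=
  stepC theta * enorm (q - q') * t.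
Proof.
move=> th t0 Ex mb Oq qx car qq'.
have [k0 k1 kE] := kappa_bounds th; have [th0 th1] := andP th.
have N1 : (1 : R) <= n.+1%:R by rewrite ler1n.
have D0 : 0 < enorm (q - x) by rewrite enorm_gt0// subr_eq0.
set k := kappa theta in k0 k1 kE qq' *.
set r := k * enorm (q - x) in qq' *; set r' := k * enorm (q' - x).
have r0 : 0 < r by rewrite mulr_gt0.
have rr' : `|r - r'| <= enorm (q - q').
  rewrite /r /r' -mulrBr normrM gtr0_norm//.
  apply: (@le_trans _ _ (1 * `|enorm (q - x) - enorm (q' - x)|)); first by rewrite ler_wpM2r.
  rewrite mul1r; apply: le_trans (lip_enorm _ _) _.
  by rewrite opprB addrA subrK.
have r'2 : r / 2 <= r' by move: rr'; rewrite ler_norml => /andP[? ?]; lra.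
have r'3 : r' <= 3 * r / 2 by move: rr'; rewrite ler_norml => /andP[? ?]; lra.
have d16 : 16 * n.+1%:R * r <= dist q E by rewrite /r mulrA (mulrC _ k) kE.
have dr : dist q E <= k^-1 * r by rewrite /r mulrA mulVf ?gt_eqF// mul1r dist_le.
have Nr : r <= n.+1%:R * r by rewrite ler_peMl// ltW.
have b0 : E !=set0 by exists x.
have d0 : 0 < dist q E by lra.
have coord i : `|q 0 i - q' 0 i| <= r / 2.
  by have := coord_le_enorm (q - q') i; rewrite !mxE => h; exact: le_trans qq'.
apply: (@mollifier_lipschitz_mean R n Omega u gradu q (q - const_mx r) q q'
  6^-1 k^-1 (3 * r) (4^-1 * dist q E) (enorm (q - q')) r r' t) => //.
- by rewrite mulr_gt0.
- apply: (@open_eball_dist _ _ Omega q) => //; lra.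
- exact: mb.
- by rewrite invr_gt0 ltr0n/= invf_le1//; lra.
- by rewrite mulr_gt0.
- apply: (@box_eball _ _ _ (2 * r)) => [i|i|]; rewrite ?mxE; [lra|lra|].
  by rewrite mulrCA; lra.
- rewrite mulrCA; have : 0 <= k^-1 * r by rewrite mulr_ge0 ?invr_ge0// ltW.
  lra.
- lra.
- lra.
- by move=> i; rewrite !mxE; split; lra.
- move=> i; rewrite !mxE; have := coord i; rewrite ler_norml => /andP[? ?].
  by split; lra.
Qed.

(** The paths from [x] and from [z] arrive at the same centre with bumps of different sizes. Both
    sizes are comparable to the distance of [c] to the boundary, and they differ by at most
    [|x - z|]. *)
Lemma carrot_endpoint theta x z t c : 0 < theta < 1 -> 0 < t -> E x -> E z ->
  mean_bound theta x t -> Omega c ->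
  theta * enorm (c - x) <= dist c E -> theta * enorm (c - z) <= dist c E ->
  `|U c (kappa theta * enorm (c - x)) - U c (kappa theta * enorm (c - z))| <=
  endC theta * enorm (x - z) * t.
Proof.
move=> th t0 Ex Ez mb Oc cx cz.
have [k0 k1 kE] := kappa_bounds th; have [th0 th1] := andP th.
set k := kappa theta in k0 k1 kE *.
have N1 : (1 : R) <= n.+1%:R by rewrite ler1n.
have b0 : E !=set0 by exists x.
have d0 : 0 < dist c E.
  apply: dist_gt0 => //; first exact: boundary_closed.
  by move=> Ec; exact: (boundary_not_open Omega_open Ec).
set d := dist c E in cx cz d0 *.
have dx : d <= enorm (c - x) by exact: dist_le.
have dz : d <= enorm (c - z) by exact: dist_le.
pose rho := k * d / theta.
have rho0 : 0 < rho by rewrite divr_gt0// mulr_gt0.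
have thr : theta * rho = k * d by rewrite /rho mulrC divfK// gt_eqF.
have rx : k * enorm (c - x) <= rho.
  by rewrite /rho -mulrA ler_wpM2l ?(ltW k0)// ler_pdivlMr// mulrC.
have rz : k * enorm (c - z) <= rho.
  by rewrite /rho -mulrA ler_wpM2l ?(ltW k0)// ler_pdivlMr// mulrC.
have Nrho : 16 * n.+1%:R * rho = d.
  have -> : 16 * n.+1%:R * rho = k * (16 * n.+1%:R) * d / theta by rewrite /rho; ring.
  by rewrite kE mulrAC divff ?mul1r ?gt_eqF.
apply: (@mollifier_lipschitz_mean R n Omega u gradu c c c c
  theta k^-1 rho (4^-1 * d) (enorm (x - z)) _ _ t) => //.
- by rewrite mulr_gt0.
- apply: (@open_eball_dist _ _ Omega c) => //; rewrite -/d; lra.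
- exact: mb.
- by rewrite th0 ltW.
- apply: (@box_eball _ _ _ rho) => [i|i|]; [lra|lra|].
  have NR : 0 < n.+1%:R * rho by rewrite mulr_gt0.
  by rewrite -Nrho; lra.
- rewrite ler_pdivlMl//.
  have : k * d <= rho by rewrite -thr ler_piMl// ltW.
  have : 0 < k * d by rewrite mulr_gt0.
  lra.
- by rewrite thr ler_wpM2l// ltW.
- by rewrite thr ler_wpM2l// ltW.
- by move=> i; split => //; lra.
- by move=> i; split => //; lra.
- by rewrite subrr enorm0 enorm_ge0.
- rewrite -mulrBr normrM gtr0_norm//.
  apply: (@le_trans _ _ (1 * `|enorm (c - x) - enorm (c - z)|)); first by rewrite ler_wpM2r.
  rewrite mul1r; apply: le_trans (lip_enorm _ _) _.
  by rewrite opprB addrC addrA subrK enorm_distC.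
Qed.

(** The path is sampled finely and only followed from its last sample close to [x]. From there the
    steps telescope to at most the length of the path, and the starting average is close to
    [u x * mass] by continuity. *)
Lemma carrot_path theta x c t l (p : R -> V) : 0 < theta < 1 -> 0 < t -> E x -> ~ E c ->
  mean_bound theta x t -> {within `[0, 1], continuous p} ->
  (forall s, 0 <= s <= 1 -> closure Omega (p s)) -> (path_length p <= l%:E)%E ->
  p 0 = x -> p 1 = c ->
  (forall s, 0 <= s <= 1 -> theta * enorm (p s - x) <= dist (p s) E) ->
  `|u x * mass (n := n) - U c (kappa theta * enorm (c - x))| <= stepC theta * l * t.
Proof.
move=> th t0 Ex Ec mb cp pO pl p0 p1 car.
have [k0 k1 kE] := kappa_bounds th; have [th0 th1] := andP th.
have m0 := @mass_gt0 R n.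
have N1 : (1 : R) <= n.+1%:R by rewrite ler1n.
have C0 : 0 <= stepC theta by apply: lipC_ge0; rewrite invr_gt0.
have cx : c != x by apply/eqP => cx; apply: Ec; rewrite cx.
have cx0 : 0 < enorm (c - x) by rewrite enorm_gt0// subr_eq0.
have inO s : 0 <= s <= 1 -> p s != x -> Omega (p s).
  move=> s01 px; apply: closure_not_boundary; first exact: pO.
  move=> Ep; have := car s s01; have := dist_le (p s) Ep.
  rewrite subrr enorm0 => h1 h2.
  have : 0 < theta * enorm (p s - x) by rewrite mulr_gt0// enorm_gt0// subr_eq0.
  by lra.
apply/ler_addgt0Pr => e e0.
have em0 : 0 < e / mass (n := n) by rewrite divr_gt0.
have xO : closure Omega x by case: Ex.
have [d d0 dP] := within_continuous_dist u_cont xO em0.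
set k := kappa theta in k0 k1 kE *.
(* A bump centred within [eta] of [x] has its support within [3 * eta < d] of [x]; the second bound
   keeps [c] out of that neighbourhood, so the last close sample is not the endpoint. *)
pose eta := Num.min (d / 4) (enorm (c - x) / 2).
have eta0 : 0 < eta by rewrite lt_min !divr_gt0.
have etad : eta <= d / 4 by rewrite ge_min lexx.
have etac : eta <= enorm (c - x) / 2 by rewrite ge_min lexx orbT.
(* The retained samples satisfy [|q j - x| >= eta / 2], so a mesh of [k * eta / 4] is at most half
   the size of the bump, as [carrot_step] requires. *)
have ket : 0 < k * eta / 4 by rewrite divr_gt0// mulr_gt0.
have [del del0 delP] := path_unif_continuous cp ket.
pose M := (Num.truncn del^-1).+1.
have M0 : (0 : R) < M%:R by rewrite ltr0n.
have Mdel : M%:R^-1 < del.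
  by rewrite invf_plt ?posrE// truncnS_gt.
pose q (j : nat) : V := p (j%:R / M%:R).
have j01 j : (j <= M)%N -> 0 <= (j%:R / M%:R : R) <= 1.
  move=> jM; rewrite divr_ge0 ?ler0n//=.
  by rewrite ler_pdivrMr// mul1r ler_nat.
have q0 : q 0%N = x by rewrite /q mul0r.
have qM : q M = c by rewrite /q divff ?gt_eqF.
have qq j : (j < M)%N -> enorm (q j - q j.+1) < k * eta / 4.
  move=> jM; apply: delP; rewrite ?j01 ?(ltnW jM)//.
  rewrite -mulrBl normrM [X in _ * X]gtr0_norm ?invr_gt0// -natr1 opprD addrA subrr.
  by rewrite add0r normrN1 mul1r.
(* The last close sample is taken because the path may return near [x]. Being one mesh away from a
   sample outside the [eta] ball, it is itself at distance at least [eta / 2]. *)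
have [j0 [j0M [hj0 hj]]] : exists j0, (j0 < M)%N /\ enorm (q j0 - x) <= eta /\
    forall j, (j0 < j <= M)%N -> eta < enorm (q j - x).
  have ex0 : exists j, (j <= M)%N && (enorm (q j - x) <= eta).
    by exists 0%N; rewrite q0 subrr enorm0 ltW.
  have ub j : (j <= M)%N && (enorm (q j - x) <= eta) -> (j <= M)%N by case/andP.
  case: (ex_maxnP ex0 ub) => j0 /andP[j0M hj0] jmax; exists j0; split.
    rewrite ltn_neqAle j0M andbT; apply/eqP => jM; move: hj0; rewrite jM qM.
    by move=> h; lra.
  split=> // j /andP[jj jM]; rewrite ltNge; apply/negP => h.
  by have := jmax j; rewrite jM h => /(_ isT); rewrite leqNgt jj.
have hge j : (j0 <= j <= M)%N -> eta / 2 <= enorm (q j - x).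
  move=> /andP[jj jM]; have [<-|ne] := eqVneq j0 j; last first.
    by have := hj j; rewrite ltn_neqAle ne jj jM => /(_ isT); lra.
  have := hj j0.+1; rewrite ltnSn j0M => /(_ isT) h1.
  have := qq j0 j0M; have := enorm_triangle (q j0) (q j0.+1) x.
  rewrite (enorm_distC (q j0.+1) (q j0)) => h2 h3.
  have : k * eta <= eta by rewrite ler_piMl// ltW.
  by lra.
have qx j : (j0 <= j <= M)%N -> q j != x.
  move=> h; apply/eqP => e1; have := hge j h; rewrite e1 subrr enorm0; lra.
have qO j : (j0 <= j <= M)%N -> Omega (q j).
  by move=> h; apply: inO; [apply: j01; case/andP: h|exact: qx].
pose F j := U (q j) (k * enorm (q j - x)).
have Fstep j : (j0 <= j < M)%N -> `|F j - F j.+1| <= stepC theta * enorm (q j - q j.+1) * t.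
  move=> /andP[jj jM]; have h : (j0 <= j <= M)%N by rewrite jj ltnW.
  apply: carrot_step => //; [exact: qO|exact: qx|by apply: car; apply: j01; exact: ltnW|].
  apply: le_trans (ltW (qq j jM)) _; rewrite -/k.
  have := ler_wpM2l (ltW k0) (hge j h); lra.
have Fsum i : (j0 + i <= M)%N ->
    `|F j0 - F (j0 + i)%N| <= stepC theta * (\sum_(j0 <= j < j0 + i) enorm (q j - q j.+1)) * t.
  elim: i => [|i IH] hi; first by rewrite addn0 subrr normr0 big_geq// mulr0 mul0r.
  rewrite addnS in hi *; rewrite big_nat_recr ?leq_addr//=.
  have := ler_distD (F (j0 + i)%N) (F j0) (F (j0 + i).+1) => h; apply: le_trans h _.
  rewrite mulrDr mulrDl; apply: lerD; first exact: IH (ltnW hi).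
  by apply: Fstep; rewrite leq_addr.
have FM : `|F j0 - F M| <= stepC theta * l * t.
  have := Fsum (M - j0)%N; rewrite subnKC ?(ltnW j0M)// => /(_ (leqnn _)) h.
  apply: le_trans h _; rewrite ler_wpM2r ?(ltW t0)// ler_wpM2l// -lee_fin.
  apply: le_trans pl; apply: le_trans (@path_length_ge _ _ p M isT).
  rewrite lee_fin [leRHS](big_cat_nat (n := j0))//=; last exact: ltnW.
  rewrite (eq_bigr (fun j => enorm (p (j.+1%:R / M%:R) - p (j%:R / M%:R)))); last first.
    by move=> j _; rewrite enorm_distC.
  by rewrite lerDr sumr_ge0// => *; exact: enorm_ge0.
have hr0 : 0 < k * enorm (q j0 - x).
  by rewrite mulr_gt0// enorm_gt0// subr_eq0; apply: qx; rewrite leqnn ltnW.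
have F0 : `|F j0 - u x * mass (n := n)| <= e.
  have -> : e = e / mass (n := n) * mass (n := n) by rewrite divfK// gt_eqF.
  set r := k * enorm (q j0 - x) in hr0 *.
  have d16 : 16 * n.+1%:R * r <= dist (q j0) E.
    by rewrite /r mulrA (mulrC _ k) kE; apply: car; apply: j01; exact: ltnW.
  have Nr : 0 < n.+1%:R * r by rewrite mulr_gt0.
  have Nreta : n.+1%:R * r <= eta.
    rewrite /r mulrA (@le_trans _ _ (1 * enorm (q j0 - x)))//; last by rewrite mul1r.
    rewrite ler_wpM2r ?enorm_ge0// mulrC; have : 0 < k * n.+1%:R by rewrite mulr_gt0.
    by move: kE; rewrite mulrCA; lra.
  have bq : box (q j0) (q j0 + const_mx r) `<=` eball (q j0) (2 * (n.+1%:R * r)).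
    by apply: (@box_eball _ _ _ r) => [i|i|]; lra.
  have bO : box (q j0) (q j0 + const_mx r) `<=` Omega.
    apply: (subset_trans bq); apply: open_eball_dist => //; last lra.
    - by apply: qO; rewrite leqnn ltnW.
    - by exists x.
  apply: pairing_mollifier_near => // y yb.
  rewrite distrC ltW//; apply: dP; first by apply: subset_closure; exact: bO.
  apply: eball_sub_ball; rewrite /eball/=.
  have := bq y yb; rewrite /eball/=; have := enorm_triangle (q j0) y x; lra.
rewrite distrC in F0.
have <- : F M = U c (k * enorm (c - x)) by rewrite /F qM.
apply: (le_trans (ler_distD (F j0) (u x * mass (n := n)) (F M))).
rewrite [leRHS]addrC; apply: lerD; [exact: F0|exact: FM].
Qed.

End carrot_paths.

(** * The pointwise estimate in a John domain *)

Section john_domains.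
Context {R : realType} {n : nat}.
Notation V := 'rV[R]_n.+1.
Implicit Types (Omega : set V) (x z : V).

Lemma enorm_le_ediam Omega x z : closure Omega x -> closure Omega z ->
  ((enorm (x - z))%:E <= ediam Omega)%E.
Proof.
move=> cx cz; apply/lee_addgt0Pr => e e0.
have e20 : 0 < e / 2 by rewrite divr_gt0.
have [x' [Ox' xx']] := cx _ (nbhs_eball x e20).
have [z' [Oz' zz']] := cz _ (nbhs_eball z e20).
rewrite /eball/= in xx' zz'.
apply: (@le_trans _ _ ((enorm (x' - z'))%:E + e%:E)%E); last first.
  rewrite leeD2r// /ediam le_max; apply/orP; right; apply: ereal_sup_ubound.
  by exists x' => //; exists z'.
rewrite -EFinD lee_fin; have := enorm_triangle x' x z; have := enorm_triangle z' x' z.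
by rewrite (enorm_distC x x'); lra.
Qed.

Lemma mean_bound_nt_maximal Omega (gradu : V -> V) (theta : R) x (t : R) :
  open Omega -> 0 < theta -> boundary Omega x ->
  (nt_maximal theta^-1 Omega gradu x <= t%:E)%E -> mean_bound Omega gradu theta x t.
Proof.
move=> oO th0 Ex; rewrite /nt_maximal ge_max => /andP[_ Nt] y Oy yx.
apply: le_trans Nt; apply: ereal_sup_ubound; exists y => //=; split => //.
have d0 : 0 < dist y (boundary Omega).
  apply: dist_gt0; [exact: boundary_closed|by exists x|].
  by move=> Ey; exact: (boundary_not_open oO Ey).
rewrite enorm_distC mulrDl mul1r; apply: ltr_pwDl => //.
by rewrite ler_pdivlMl.
Qed.

(** The John condition at [x], at a scale comparable to [|x - z|], yields one centre [c] joined to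
    both points by paths no longer than a multiple of [|x - z|]. Two uses of [carrot_path] and one
    of [carrot_endpoint] compare [u x] with [u z]. *)
Lemma john_hajlasz Omega : open Omega -> local_john Omega ->
  exists2 theta : R, 0 < theta & exists2 C : R, 0 < C &
  forall (u : V -> R) (gradu : V -> V), Lploc Omega 2 u -> weak_gradient Omega u gradu ->
    {within closure Omega, continuous u} ->
  forall x z, boundary Omega x -> boundary Omega z ->
    (nt_maximal theta^-1 Omega gradu x < +oo)%E ->
    (nt_maximal theta^-1 Omega gradu z < +oo)%E ->
    `|u x - u z| <= enorm (x - z) *
      (C * fine (nt_maximal theta^-1 Omega gradu x) +
       C * fine (nt_maximal theta^-1 Omega gradu z)).
Proof.
move=> oO [theta [th john]]; have [th0 th1] := andP th.
have m0 := @mass_gt0 R n; have [k0 _ _] := @kappa_bounds R n theta th.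
exists theta => //.
pose sC := stepC (n := n) theta; pose eC := endC (n := n) theta.
have sC0 : 0 <= sC by apply: lipC_ge0; rewrite invr_gt0.
have eC0 : 0 <= eC by apply: lipC_ge0; rewrite // invr_gt0.
pose C1 := sC * (theta^-1 * (3 / 2)) + eC.
have tV0 : 0 <= theta^-1 by rewrite invr_ge0 ltW.
have C10 : 0 <= C1 by rewrite addr_ge0// mulr_ge0// mulr_ge0// divr_ge0.
(* The summand 1 makes the constant strictly positive. *)
exists (C1 / mass (n := n) + 1); first by rewrite ltr_wpDl// divr_ge0// ltW.
move=> u gradu ul ug uc x z Ex Ez Nx Nz.
have [->|xz] := eqVneq x z; first by rewrite !subrr normr0 enorm0 mul0r.
have D0 : 0 < enorm (x - z) by rewrite enorm_gt0// subr_eq0.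
have [clx _] := Ex; have [clz _] := Ez.
(* A factor above 1 places [z] in the open ball around [x]; a factor below 2 gives
   [r < 2 * ediam Omega]. *)
pose r := 3 / 2 * enorm (x - z).
have r0 : 0 < r by rewrite mulr_gt0.
have rd : (r%:E < 2%:E * ediam Omega)%E.
  apply: (@lt_le_trans _ _ (2%:E * (enorm (x - z))%:E)%E).
    by rewrite -EFinM lte_fin /r; lra.
  by rewrite lee_wpmul2l// enorm_le_ediam.
have [c [xc Oc _ paths]] := john x r Ex r0 rd.
have Ec : ~ boundary Omega c by move=> /(boundary_not_open oO).
have xr : eball x r x by exact: eballxx.
have zr : eball x r z by rewrite /eball/= enorm_distC /r; lra.
have [p [p_c p_O p_l [p_0 p_1] p_car]] := paths x xr Ex.
have [q [q_c q_O q_l [q_0 q_1] q_car]] := paths z zr Ez.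
set l := theta^-1 * enorm (x - c) in p_l q_l.
have ll : l <= theta^-1 * (3 / 2) * enorm (x - z).
  rewrite /l -mulrA ler_wpM2l ?invr_ge0 ?(ltW th0)//.
  by move: xc; rewrite /eball/= enorm_distC => /ltW.
set a := nt_maximal _ _ _ x in Nx *; set b := nt_maximal _ _ _ z in Nz *.
have a0 : (0 <= a)%E by rewrite /a /nt_maximal le_max lexx.
have b0 : (0 <= b)%E by rewrite /b /nt_maximal le_max lexx.
have afin : a = (fine a)%:E by rewrite fineK// ge0_fin_numE.
have bfin : b = (fine b)%:E by rewrite fineK// ge0_fin_numE.
have fa0 : 0 <= fine a by exact: fine_ge0.
have fb0 : 0 <= fine b by exact: fine_ge0.
(* The margin [e] gives the strictly positive bounds required by the carrot lemmas, as the maximal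
   function may vanish; [main0] lets it tend to 0. *)
have main e : 0 < e -> `|u x - u z| * mass (n := n) <=
    C1 * enorm (x - z) * (fine a + e + (fine b + e)).
  move=> e0; set s := fine a + e; set t := fine b + e.
  have s0 : 0 < s by rewrite ltr_wpDl.
  have t0 : 0 < t by rewrite ltr_wpDl.
  have mbx : mean_bound Omega gradu theta x s.
    by apply: mean_bound_nt_maximal => //; rewrite -/a afin lee_fin lerDl ltW.
  have mbz : mean_bound Omega gradu theta z t.
    by apply: mean_bound_nt_maximal => //; rewrite -/b bfin lee_fin lerDl ltW.
  have carx : theta * enorm (c - x) <= dist c (boundary Omega) by rewrite -p_1; apply: p_car; rewrite ler01 lexx.
  have carz : theta * enorm (c - z) <= dist c (boundary Omega) by rewrite -q_1; apply: q_car; rewrite ler01 lexx.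
  have h1 := carrot_path oO ul ug uc th s0 Ex Ec mbx p_c p_O p_l p_0 p_1 p_car.
  have h2 := carrot_path oO ul ug uc th t0 Ez Ec mbz q_c q_O q_l q_0 q_1 q_car.
  have h3 := carrot_endpoint oO ul ug th s0 Ex Ez mbx Oc carx carz.
  set Ux := pairing _ _ _ in h1 h3; set Uz := pairing _ _ _ in h2 h3.
  rewrite -[mass in X in X <= _](gtr0_norm m0) -normrM mulrBl.
  have -> : u x * mass (n := n) - u z * mass (n := n) =
    (u x * mass (n := n) - Ux) + (Ux - Uz) - (u z * mass (n := n) - Uz) by ring.
  apply: le_trans (ler_normB _ _) _.
  apply: le_trans (lerD (ler_normD _ _) (lexx _)) _.
  apply: le_trans (lerD (lerD h1 h3) h2) _.
  rewrite -/sC -/eC.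
  have g1 : sC * l * s <= sC * (theta^-1 * (3 / 2) * enorm (x - z)) * s.
    by rewrite ler_wpM2r ?(ltW s0)// ler_wpM2l.
  have g2 : sC * l * t <= sC * (theta^-1 * (3 / 2) * enorm (x - z)) * t.
    by rewrite ler_wpM2r ?(ltW t0)// ler_wpM2l.
  have g3 : 0 <= eC * enorm (x - z) * t.
    exact: mulr_ge0 (mulr_ge0 eC0 (ltW D0)) (ltW t0).
  have -> : C1 * enorm (x - z) * (s + t) =
    sC * (theta^-1 * (3 / 2) * enorm (x - z)) * s + eC * enorm (x - z) * s +
    (sC * (theta^-1 * (3 / 2) * enorm (x - z)) * t + eC * enorm (x - z) * t).
    by rewrite /C1; ring.
  apply: lerD; first by rewrite lerD2r.
  by apply: le_trans g2 _; rewrite lerDl.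
have main0 : `|u x - u z| * mass (n := n) <= C1 * enorm (x - z) * (fine a + fine b).
  apply/ler_addgt0Pr => e e0.
  pose K := 2 * (C1 * enorm (x - z)) + 1.
  have CD0 : 0 <= C1 * enorm (x - z) by rewrite mulr_ge0// ltW.
  have K0 : 0 < K by rewrite /K; lra.
  have := main (e / K) (divr_gt0 e0 K0) => h; apply: le_trans h _.
  have -> : C1 * enorm (x - z) * (fine a + e / K + (fine b + e / K)) =
    C1 * enorm (x - z) * (fine a + fine b) + 2 * (C1 * enorm (x - z)) * (e / K) by ring.
  rewrite lerD2l [leLHS]mulrA ler_pdivrMr// mulrC ler_wpM2l ?(ltW e0)// /K; lra.
rewrite -mulrDr; rewrite -(ler_pM2r m0); apply: le_trans main0 _.
have -> : enorm (x - z) * ((C1 / mass (n := n) + 1) * (fine a + fine b)) * mass (n := n) =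
  C1 * enorm (x - z) * (fine a + fine b) +
  enorm (x - z) * (fine a + fine b) * mass (n := n) by field; rewrite gt_eqF.
by rewrite lerDl !mulr_ge0 ?addr_ge0 ?(ltW D0) ?(ltW m0).
Qed.

End john_domains.

(** * Hausdorff measure is a metric outer measure *)

Section metric_outer_measure.
Context {R : realType} {n : nat}.
Notation V := 'rV[R]_n.+1.
Context (mu : {outer_measure set V -> \bar R}).
Hypothesis mu_metric : forall (A B : set V) (d : R), (0 < d)%R ->
  (forall x y, A x -> B y -> (d <= enorm (x - y))%R) -> (mu A + mu B <= mu (A `|` B))%E.
Local Open Scope ereal_scope.

(** The union of the earlier sets is at distance at least [d N] from [D N], so metric additivity
    adds one set at a time. *)
Lemma separated_sum_le (D : nat -> set V) (X : set V) (d : nat -> R) :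
  (forall k, D k `<=` X) -> (forall k, (0 < d k)%R) ->
  (forall j k x y, (j < k)%N -> D j x -> D k y -> (d k <= enorm (x - y))%R) ->
  forall N, \sum_(0 <= k < N) mu (D k) <= mu X.
Proof.
move=> DX d0 Dd N.
apply: (@le_trans _ _ (mu (\bigcup_(k in [set k | (k < N)%N]) D k))); last first.
  by apply: le_outer_measure => x [k _]; exact: DX.
elim: N => [|N IH]; first by rewrite big_geq.
rewrite big_nat_recr//=; apply: le_trans (leeD2r _ IH) _.
apply: le_trans (mu_metric (d0 N) _) _.
  by move=> x y [j /= jN Dx] Dy; exact: Dd jN Dx Dy.
apply: le_outer_measure => x [[k /= kN Dx]|Dx]; last by exists N => /=.
by exists k => //=; exact: ltnW.
Qed.

(* Shells around F at non-adjacent scales are separated, so the measures of the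
   shells are summable and X \ F is exhausted by the points of X far from F. *)
Lemma caratheodory_closed (F : set V) : closed F -> mu.-caratheodory F.
Proof.
move=> cF; have [F0|F0] := pselect (F !=set0); last first.
  rewrite (_ : F = set0); first exact: caratheodory_measurable_set0.
  by apply/seteqP; split=> // x Fx; apply: F0; exists x.
apply: le_caratheodory_measurable => X.
have [->|Xoo] := eqVneq (mu X) +oo; first exact: leey.
pose a (k : nat) : R := (k.+1%:R^-1)%R.
have a0 k : (0 < a k)%R by rewrite invr_gt0.
have alt j k : (j < k)%N -> (a k < a j)%R.
  by move=> jk; rewrite ltf_pV2 ?posrE// ltr_nat.
have ale j k : (j <= k)%N -> (a k <= a j)%R.
  by rewrite leq_eqVlt => /orP[/eqP ->|/alt/ltW].
pose A k := [set x | X x /\ (a k <= dist x F)%R].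
pose D k := [set x | X x /\ (a k.+1 <= dist x F < a k)%R].
have muXA k : mu (X `&` F) + mu (A k) <= mu X.
  apply: le_trans (mu_metric (a0 k) _) _.
    move=> x y [_ Fx] [_ ay]; apply: le_trans ay _; rewrite enorm_distC.
    exact: dist_le.
  by apply: le_outer_measure => x [[]|[]].
have sepD j k x y : (j.+1 < k)%N -> D j x -> D k y -> (a j.+1 - a k <= enorm (x - y))%R.
  move=> jk [_ /andP[h1 _]] [_ /andP[_ h2]].
  by have := dist_lip x y F0; lra.
(* Even shells for [i = 0] and odd ones for [i = 1]: skipping every other shell leaves a positive
   gap between consecutive terms. *)
have sum2 i N : \sum_(0 <= k < N) mu (D (i + k.*2)%N) <= mu X.
  apply: (@separated_sum_le (fun k => D (i + k.*2)%N) X (fun k => if k is k'.+1 then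
     a (i + k'.*2).+1 - a (i + k.*2)%N else 1)%R) => [k x []//|[|k]|j [//|k] x y jk Dx Dy].
  - by [].
  - by rewrite subr_gt0 alt// doubleS !addnS.
  - have jk2 : (i + j.*2 <= i + k.*2)%N by rewrite leq_add2l leq_double.
    have h : ((i + j.*2).+1 < i + k.+1.*2)%N by rewrite doubleS !addnS !ltnS.
    apply: le_trans (sepD _ _ _ _ h Dx Dy); rewrite lerD2r.
    by apply: ale.
pose f k := mu (D k.*2) + mu (D k.*2.+1).
have f0 k : 0 <= f k by rewrite adde_ge0// outer_measure_ge0.
have foo : \sum_(0 <= k <oo) f k < +oo.
  apply: (@le_lt_trans _ _ (mu X + mu X)); last first.
    by rewrite lte_add_pinfty// ltey.
  apply: lime_le; first exact: is_cvg_nneseries.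
  apply: nearW => N; rewrite big_split/= leeD//; first exact: (sum2 0%N).
  exact: (sum2 1%N).
have tail := nneseries_tail_cvg foo (fun k _ => f0 k).
have cover N : mu (X `&` ~` F) <= mu (A N.*2) + \sum_(N <= k <oo) f k.
  apply: (@le_trans _ _ (mu (A N.*2 `|` \bigcup_k (D (k + N).*2 `|` D (k + N).*2.+1)))).
    apply: le_outer_measure => x [Xx Fx].
    have dx := dist_gt0 cF F0 Fx.
    have [ax|xa] := leP (a N.*2) (dist x F); [by left|right].
    (* The least such index is the successor of the index of the shell that contains [x]. *)
    have ex : exists k, (a k <= dist x F)%R.
      exists (Num.truncn (dist x F)^-1); rewrite /a invf_ple ?posrE//.
      by rewrite ltW// truncnS_gt.
    case: (ex_minnP ex) => m am mmin.
    have Nm : (N.*2 < m)%N.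
      by rewrite ltnNge; apply/negP => /ale h; have := le_lt_trans (le_trans h am) xa; rewrite ltxx.
    case: m Nm am mmin => // m; rewrite ltnS => Nm am mmin.
    have xm : (dist x F < a m)%R.
      by rewrite ltNge; apply/negP => /mmin; rewrite ltnn.
    have Dm : D m x by split=> //; rewrite am.
    have [i mi] : exists i, m./2 = (i + N)%N.
      by exists (m./2 - N)%N; rewrite subnK// -(doubleK N) half_leq.
    exists i => //; rewrite -mi; have := odd_double_half m; case: (odd m) => /= h.
      by right; rewrite add1n in h; rewrite h.
    by left; rewrite add0n in h; rewrite h.
  apply: le_trans (outer_measureU2 mu _ _) _; rewrite leeD2l//.
  apply: le_trans (outer_measure_sigma_subadditive mu _) _.
  rewrite -(nneseries_addn N f0); apply: lee_nneseries => k *.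
    exact: outer_measure_ge0.
  exact: outer_measureU2.
apply/lee_addgt0Pr => e e0.
have [N hN] : exists N, \sum_(N <= k <oo) f k <= e%:E.
  have /fine_cvgP[tf /cvgrPdist_le/(_ e e0)] := tail.
  move=> /(filterI tf)[N _ /(_ N (leqnn N))[/= h1 h2]]; exists N.
  by rewrite -(fineK h1) lee_fin; move: h2; rewrite sub0r normrN; exact: le_trans (ler_norm _).
apply: le_trans (leeD2l _ (cover N)) _; rewrite addeA.
by rewrite leeD// muXA.
Qed.

End metric_outer_measure.

Section hausdorff_metric.
Context {R : realType} {n : nat}.
Notation V := 'rV[R]_n.+1.
Implicit Types (A B U X : set V).
Local Open Scope ereal_scope.

Lemma ediam_ge0 U : 0 <= ediam U.
Proof. by rewrite /ediam le_max lexx. Qed.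

Lemma le_ediam U X : U `<=` X -> ediam U <= ediam X.
Proof.
move=> UX; rewrite /ediam ge_max le_max lexx/= le_max; apply/orP; right.
apply: ge_ereal_sup => _ [x Ux [y Uy <-]]; apply: ereal_sup_ubound.
by exists x; [exact: UX|exists y; [exact: UX|]].
Qed.

Lemma enorm_le_ediam_in U (x y : V) : U x -> U y -> (enorm (x - y))%:E <= ediam U.
Proof.
move=> Ux Uy; rewrite /ediam le_max; apply/orP; right.
by apply: ereal_sup_ubound; exists x => //; exists y.
Qed.

Lemma le_diam_gauge s (d : R) U X : U `<=` X -> diam_gauge s d U <= diam_gauge s d X.
Proof.
move=> UX; have [->|U0] := eqVneq U set0; first by rewrite diam_gauge0 diam_gauge_ge0.
have X0 : X != set0.
  by apply: contra_neq U0 => X0; apply/seteqP; split=> // x; rewrite -X0; exact: UX.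
rewrite /diam_gauge (negbTE U0) (negbTE X0).
have [hX|hX] := boolP (ediam X <= d%:E); last by rewrite leey.
rewrite (le_trans (le_ediam UX) hX).
elim: s => [|s IH]; first by rewrite !expe0.
rewrite !expeS; apply: lee_pmul => //; first exact: ediam_ge0.
  by rewrite expe_ge0// ediam_ge0.
exact: le_ediam.
Qed.

Lemma hausdorff_pre_anti s (d d' : R) A : (d <= d')%R ->
  hausdorff_pre s d' A <= hausdorff_pre s d A.
Proof.
move=> dd'; apply: le_ereal_inf_tmp => _ [F [_ cov] <-].
apply: (@le_trans _ _ (\sum_(k <oo) diam_gauge s d' (F k))).
  by apply: ereal_inf_lbound; exists F.
apply: lee_nneseries => [k _ _|k _]; first exact: diam_gauge_ge0.
rewrite /diam_gauge; case: ifP => // _.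
have [h|h] := boolP (ediam (F k) <= d%:E); last by rewrite leey.
by rewrite (le_trans h) ?lee_fin.
Qed.

(** At a covering scale below [d], a set that meets both [A] and [B] has infinite gauge, so each
    term of a covering of the union pays for at most one of them. The scale then tends to 0. *)
Lemma hausdorff_outer_metric s A B (d : R) : (0 < d)%R ->
  (forall x y, A x -> B y -> (d <= enorm (x - y))%R) ->
  hausdorff_outer s A + hausdorff_outer s B <= hausdorff_outer s (A `|` B).
Proof.
move=> d0 AB.
have pre (e : R) : (0 < e < d)%R ->
    hausdorff_pre s e A + hausdorff_pre s e B <= hausdorff_pre s e (A `|` B).
  move=> /andP[e0 ed]; apply: le_ereal_inf_tmp => _ [F [_ cov] <-].
  apply: (@le_trans _ _ (\sum_(k <oo) (diam_gauge s e (F k `&` A) + diam_gauge s e (F k `&` B)))).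
    rewrite nneseriesD//; [|by move=> *; exact: diam_gauge_ge0..].
    apply: leeD; apply: ereal_inf_lbound.
      exists (fun k => F k `&` A) => //; split=> // x Ax.
      by have [|k _ Fk] := cov x; [left|exists k].
    exists (fun k => F k `&` B) => //; split=> // x Bx.
    by have [|k _ Fk] := cov x; [right|exists k].
  apply: lee_nneseries => [k _ _|k _]; first by rewrite adde_ge0// diam_gauge_ge0.
  have [[x [Fx Ax]]|FA] := pselect (F k `&` A !=set0); last first.
    rewrite (_ : F k `&` A = set0) ?diam_gauge0 ?add0e; first exact: le_diam_gauge.
    by apply/seteqP; split=> // x FAx; apply: FA; exists x.
  have [[y [Fy By]]|FB] := pselect (F k `&` B !=set0); last first.
    rewrite (_ : F k `&` B = set0) ?diam_gauge0 ?adde0; first exact: le_diam_gauge.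
    by apply/seteqP; split=> // y FBy; apply: FB; exists y.
  rewrite [leRHS]/diam_gauge ifF; last by apply/eqP => F0; rewrite F0 in Fx.
  rewrite ifF ?leey//; apply/negbTE; rewrite -ltNge.
  apply: lt_le_trans (enorm_le_ediam_in Fx Fy); rewrite lte_fin.
  exact: lt_le_trans ed (AB _ _ Ax By).
have [->|ABoo] := eqVneq (hausdorff_outer s (A `|` B)) +oo; first exact: leey.
have fin X : X `<=` A `|` B -> hausdorff_outer s X \is a fin_num.
  move=> XAB; rewrite ge0_fin_numE ?hausdorff_outer_ge0//.
  by apply: le_lt_trans (@le_hausdorff_outer R n s _ _ XAB) _; rewrite ltey.
have fA : hausdorff_outer s A \is a fin_num by apply: fin; exact: subsetUl.
have fB : hausdorff_outer s B \is a fin_num by apply: fin; exact: subsetUr.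
apply/lee_addgt0Pr => e e0.
have e20 : (0 < e / 2)%R by rewrite divr_gt0.
have [_ [dA dA0 <-] hA] := ub_ereal_sup_adherent e20 fA.
have [_ [dB dB0 <-] hB] := ub_ereal_sup_adherent e20 fB.
rewrite -/(hausdorff_outer s A) in hA; rewrite -/(hausdorff_outer s B) in hB.
pose m := Num.min (d / 2)%R (Num.min dA dB).
have m0 : (0 < m)%R by rewrite !lt_min divr_gt0//= dA0 dB0.
have md : (m < d)%R.
  by apply: (@le_lt_trans _ _ (d / 2)%R); [rewrite ge_min lexx|lra].
have mA : (m <= dA)%R by rewrite !ge_min lexx orbT.
have mB : (m <= dB)%R by rewrite !ge_min lexx !orbT.
have hm := pre m; rewrite m0 md in hm; have {}hm := hm isT.
apply: (@le_trans _ _ (hausdorff_pre s m A + hausdorff_pre s m B + e%:E)); last first.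
  by rewrite leeD2r//; apply: le_trans hm (hausdorff_pre_le _ _ m0).
have hA' : hausdorff_outer s A <= hausdorff_pre s m A + (e / 2)%:E.
  rewrite -leeBlDr//; apply: le_trans (ltW hA) _; exact: hausdorff_pre_anti.
have hB' : hausdorff_outer s B <= hausdorff_pre s m B + (e / 2)%:E.
  rewrite -leeBlDr//; apply: le_trans (ltW hB) _; exact: hausdorff_pre_anti.
apply: le_trans (leeD hA' hB') _; rewrite addeACA -EFinD.
by rewrite (_ : (e / 2 + e / 2 = e)%R)//; lra.
Qed.

Lemma closed_hausdorff_measurable A : closed A -> measurable (A : set (hausT R n)).
Proof.
move=> cA; apply: (@caratheodory_closed R n (@hausdorff_outer R n n)) => //.
exact: hausdorff_outer_metric.
Qed.

Lemma open_hausdorff_measurable A : open A -> measurable (A : set (hausT R n)).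
Proof.
move=> oA; rewrite -(setCK A); apply: measurableC.
by apply: closed_hausdorff_measurable; rewrite closedC.
Qed.

End hausdorff_metric.

(** * Covering by surface balls *)

Section ahlfors_doubling.
Context {R : realType} {n : nat}.
Notation V := 'rV[R]_n.+1.
Notation H := (@hausdorff_outer R n n).
Context (E : set V) (E_ahlfors : ahlfors_regular E).
Local Open Scope ereal_scope.

Let E_closed : closed E := E_ahlfors.1.

Lemma finite_cover_measure (I : eqType) (s : seq I) (F : I -> set V) (A : set V) (M : R) :
  (A `<=` [set x | exists2 i, i \in s & F i x]) -> (0 <= M)%R ->
  (forall i, i \in s -> H (A `&` F i) <= M%:E) -> H A <= ((size s)%:R * M)%:E.
Proof.
elim: s A => [|i s IH] A As M0 HM.
  rewrite (_ : A = set0) ?outer_measure0 ?mul0r//.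
  by apply/seteqP; split=> // x /As[].
apply: (@le_trans _ _ (H ((A `&` F i) `|` (A `&` ~` F i)))).
  by apply: le_outer_measure; rewrite -setIUr setUv setIT.
apply: le_trans (outer_measureU2 _ _ _) _.
rewrite /= -natr1 mulrDl mul1r (addrC _ M) EFinD; apply: leeD.
  by apply: HM; rewrite mem_head.
apply: IH => // [x [Ax Fx]|j js].
  have [j] := As x Ax; rewrite inE => /orP[/eqP -> //|js Fj].
  by exists j.
apply: le_trans (HM j _); last by rewrite inE js orbT.
by apply: le_outer_measure => x [[]].
Qed.

(** Regularity says nothing about radii above the diameter [D]. A bounded [E] is compact and covered
    by finitely many balls of radius [D]; one open ball of that radius could miss points at distance
    exactly [D]. *)
Lemma ahlfors_upper x0 x1 : E x0 -> E x1 -> x0 != x1 ->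
  exists2 C1 : R, (0 < C1)%R & forall x (r : R), E x -> (0 < r)%R ->
    H (E `&` eball x r) <= (C1 * r ^+ n)%:E.
Proof.
move=> Ex0 Ex1 x01; have [_ [C0 [C00 HC]]] := E_ahlfors.
have [Eoo|Efin] := eqVneq (ediam E) +oo.
  exists C0 => // x r Ex r0; have rE : r%:E <= ediam E by rewrite Eoo leey.
  by have /andP[] := HC x r Ex r0 rE.
have Ef : ediam E \is a fin_num by rewrite ge0_fin_numE ?ediam_ge0// ltey.
pose D := fine (ediam E); have DE : ediam E = D%:E by rewrite /D fineK.
have D0 : (0 < D)%R.
  rewrite -lte_fin -DE; apply: lt_le_trans (enorm_le_ediam_in Ex0 Ex1).
  by rewrite lte_fin enorm_gt0// subr_eq0.
have cE : compact E.
  apply: bounded_closed_compact => //.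
  exists (`|x0| + D)%R; split; first exact: num_real.
  move=> M hM x Ex; rewrite /= (le_trans _ (ltW hM))//.
  have := ler_normD (x - x0)%R x0; rewrite subrK => /le_trans; apply.
  rewrite addrC lerD2l; apply: le_trans (normr_enorm _) _.
  by rewrite -lee_fin -DE; exact: enorm_le_ediam_in.
have := cE; rewrite compact_cover => /(_ V E (fun x => eball x D)).
move=> [||s sE cov].
- by move=> x _; exact: eball_open.
- by move=> x Ex; exists x => //; exact: eballxx.
pose K : R := (size (finmap.enum_fset s))%:R.
have HE : H E <= (K * (C0 * D ^+ n))%:E.
  apply: (@finite_cover_measure _ (finmap.enum_fset s) (fun x => eball x D)).
  - by move=> x /cov[i si xi]; exists i.
  - by rewrite mulr_ge0 ?exprn_ge0// ltW.
  - move=> i si; have Ei : E i by have := sE i si; rewrite inE.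
    have DD : D%:E <= ediam E by rewrite DE.
    by have /andP[] := HC i D Ei D0 DD.
exists ((K + 1) * C0)%R; first by rewrite mulr_gt0// ltr_wpDl// ler0n.
move=> x r Ex r0.
have C0r : (0 <= C0 * r ^+ n)%R by rewrite mulr_ge0 ?exprn_ge0// ltW.
have [rD|Dr] := leP r D.
  have rE : r%:E <= ediam E by rewrite DE lee_fin.
  have /andP[_ h] := HC x r Ex r0 rE; apply: (le_trans h).
  by rewrite lee_fin -mulrA ler_peMl// lerDr ler0n.
apply: (@le_trans _ _ (H E)); first by apply: le_outer_measure; exact: subIsetl.
apply: (le_trans HE); rewrite lee_fin -mulrA.
apply: (@le_trans _ _ (K * (C0 * r ^+ n))%R).
  rewrite ler_wpM2l ?ler0n// ler_wpM2l ?(ltW C00)//.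
  by rewrite lerXn2r ?nnegrE ?(ltW D0) ?(ltW r0) ?(ltW Dr).
by rewrite ler_wpM2r// lerDl.
Qed.

Lemma ahlfors_doubling x0 x1 (Lam : R) : E x0 -> E x1 -> x0 != x1 -> (1 <= Lam)%R ->
  exists2 C2 : R, (0 < C2)%R & forall x (r : R), E x -> (0 < r)%R ->
    H (E `&` eball x (Lam * r)%R) <= C2%:E * H (E `&` eball x r).
Proof.
move=> Ex0 Ex1 x01 L1; have [C1 C10 hC1] := ahlfors_upper Ex0 Ex1 x01.
have L0 : (0 < Lam)%R by exact: lt_le_trans L1.
have [_ [C0 [C00 HC]]] := E_ahlfors.
have Lp : (0 < C1 * Lam ^+ n * C0)%R by rewrite !mulr_gt0// exprn_gt0.
(* The product handles [r <= ediam E]. The summand 1 handles larger [r], for which the smaller ball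
   already contains all of [E]. *)
exists (C1 * Lam ^+ n * C0 + 1)%R; first by rewrite addr_gt0.
move=> x r Ex r0; rewrite EFinD ge0_muleDl ?lee_fin ?ler01 ?(ltW Lp)// mul1e.
have [rE|Er] := leP r%:E (ediam E).
  apply: (@le_trans _ _ ((C1 * Lam ^+ n * C0)%:E * H (E `&` eball x r))); last first.
    by rewrite leeDl// outer_measure_ge0.
  apply: le_trans (hC1 x (Lam * r)%R Ex _) _; first by rewrite mulr_gt0.
  have /andP[h _] := HC x r Ex r0 rE.
  apply: (@le_trans _ _ ((C1 * Lam ^+ n * C0)%:E * (C0^-1 * r ^+ n)%:E)); last first.
    by rewrite lee_wpmul2l// lee_fin ltW.
  rewrite -EFinM lee_fin exprMn le_eqVlt; apply/orP; left; apply/eqP.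
  by field; rewrite gt_eqF.
apply: (@le_trans _ _ (H (E `&` eball x r))).
  apply: le_outer_measure => y [Ey _]; split => //.
  by rewrite /eball/= -lte_fin; apply: le_lt_trans Er; exact: enorm_le_ediam_in.
by rewrite leeDr// mule_ge0 ?outer_measure_ge0// lee_fin ltW.
Qed.

(* Vitali's selection, one ball at a time: peel off the largest ball together
   with all balls that meet it. *)
Lemma vitali_finite (Lam C2 : R) :
  (0 <= Lam)%R -> (0 < C2)%R ->
  (forall x (r : R), E x -> (0 < r)%R ->
    H (E `&` eball x ((Lam + 2) * r)%R) <= C2%:E * H (E `&` eball x r)) ->
  forall s : seq (V * R), (forall i, i \in s -> E i.1 /\ (0 < i.2)%R) ->
  H (E `&` [set y | exists2 i, i \in s & eball i.1 (Lam * i.2)%R y]) <=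
  C2%:E * H (E `&` [set y | exists2 i, i \in s & eball i.1 i.2 y]).
Proof.
move=> L0 C20 dbl s; have [m] := ubnP (size s); elim: m s => // m IH s sm sE.
have [->|[j js]] : s = [::] \/ exists j, j \in s.
  by case: s {sm sE} => [|j s]; [left|right; exists j; rewrite mem_head].
  rewrite (_ : E `&` _ = set0) ?outer_measure0 ?mule_ge0 ?outer_measure_ge0 ?lee_fin ?(ltW C20)//.
  by apply/seteqP; split=> // y [_ []].
have [i0 i0s i0max] : exists2 i0, i0 \in s & forall i, i \in s -> (i.2 <= i0.2)%R.
  elim: s {sm sE} j js {IH} => // j s IHs k _; case: s IHs => [_|k' s IHs].
    by exists j; rewrite ?mem_head// => i; rewrite inE => /eqP ->.
  have [i0 i0s imax] := IHs k' (mem_head _ _).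
  have [h|h] := leP j.2 i0.2.
    by exists i0; [rewrite inE i0s orbT|move=> i; rewrite inE => /orP[/eqP ->|/imax]].
  exists j; first by rewrite mem_head.
  move=> i; rewrite inE => /orP[/eqP -> //|/imax hi]; exact: le_trans (ltW h).
have [Ei0 ri0] := sE i0 i0s.
pose meets (i : V * R) := `[< exists z, [/\ E z, eball i.1 i.2 z & eball i0.1 i0.2 z] >].
pose s' := [seq i <- s | ~~ meets i].
have s's i : i \in s' -> i \in s by rewrite mem_filter => /andP[].
have s'm : (size s' < m)%N.
  apply: leq_trans (_ : size s <= m)%N => //; rewrite size_filter.
  rewrite -(count_predC meets s) addnC -[X in (X < _)%N]addn0 ltn_add2l -has_count.
  apply/hasP; exists i0 => //; apply/asboolP; exists i0.1.
  by split => //; exact: eballxx.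
have IHs := IH s' s'm (fun i h => sE i (s's i h)).
set X := E `&` [set y | exists2 i, i \in s & eball i.1 i.2 y].
(* Measurability of the selected ball splits [H X]. On [E] the remaining balls are disjoint from it,
   so their union is charged to the complementary part. *)
have mB : H.-caratheodory (eball i0.1 i0.2).
  by apply: open_hausdorff_measurable; exact: eball_open.
rewrite (mB X) muleDr ?ge0_adde_def ?inE ?outer_measure_ge0//.
apply: (@le_trans _ _ (H (E `&` eball i0.1 ((Lam + 2) * i0.2)%R) +
   H (E `&` [set y | exists2 i, i \in s' & eball i.1 (Lam * i.2)%R y]))).
  apply: le_trans (outer_measureU2 _ _ _); apply: le_outer_measure.
  (* If ball [i] meets the largest ball, then [y] is within [Lam * r_i + r_i + r_i0], at most
     [(Lam + 2) * r_i0], of the centre of the latter. *)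
  move=> y [Ey [i si iy]]; have [/asboolP[z [Ez iz i0z]]|mi] := boolP (meets i); [left|right].
    split => //; rewrite /eball/= in iy iz i0z *.
    have h1 := enorm_triangle i.1 y i0.1; have h2 := enorm_triangle z i.1 i0.1.
    rewrite (enorm_distC i.1 z) in h2.
    have h3 := i0max i si; have h4 : (Lam * i.2 <= Lam * i0.2)%R by rewrite ler_wpM2l.
    by lra.
  by split=> //; exists i => //; rewrite mem_filter mi.
apply: leeD.
  apply: le_trans (dbl _ _ Ei0 ri0) _; rewrite lee_wpmul2l ?lee_fin ?(ltW C20)//.
  apply: le_outer_measure => y [Ey yi0]; split => //; split => //.
  by exists i0.
apply: (le_trans IHs); rewrite lee_wpmul2l ?lee_fin ?(ltW C20)//.
apply: le_outer_measure => y [Ey [i si iy]]; split.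
  by split => //; exists i => //; exact: s's.
move=> yi0; move: si; rewrite mem_filter => /andP[/negP mi _]; apply: mi.
by apply/asboolP; exists y.
Qed.

(* Lindeloef: countably many of the dilated balls, selected by rational balls,
   have the same union as all of them. *)
Lemma vitali_countable (Lam C2 : R) :
  (0 <= Lam)%R -> (0 < C2)%R ->
  (forall x (r : R), E x -> (0 < r)%R ->
    H (E `&` eball x ((Lam + 2) * r)%R) <= C2%:E * H (E `&` eball x r)) ->
  forall P : set (V * R), (forall i, P i -> E i.1 /\ (0 < i.2)%R) ->
  H (E `&` [set y | exists2 i, P i & eball i.1 (Lam * i.2)%R y]) <=
  C2%:E * H (E `&` [set y | exists2 i, P i & eball i.1 i.2 y]).
Proof.
move=> L0 C20 dbl P PE.
have sel (qs : 'rV[rat]_n.+1 * rat) : exists o : option (V * R),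
    (forall i, o = Some i -> P i) /\
    ((exists2 i, P i & rat_ball qs `<=` eball i.1 (Lam * i.2)%R) ->
     exists2 i, o = Some i & rat_ball qs `<=` eball i.1 (Lam * i.2)%R).
  have [[i Pi hi]|no] := pselect (exists2 i, P i & rat_ball qs `<=` eball i.1 (Lam * i.2)%R).
    by exists (Some i); split=> [_ [<-]//|_]; exists i.
  by exists None; split.
have [F FP] := choice sel.
pose s N := pmap (fun k => obind F (unpickle k)) (iota 0 N).
have sP N i : i \in s N -> P i.
  rewrite mem_pmap => /mapP[k _]; case: unpickle => //= qs Fqs.
  exact: (FP qs).1.
pose W N := E `&` [set y | exists2 i, i \in s N & eball i.1 (Lam * i.2)%R y].
have sS N i : i \in s N -> i \in s N.+1.
  by rewrite /s -(addn1 N) iotaD pmap_cat mem_cat => ->.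
have WS : {homo W : a b / (a <= b)%N >-> (a <= b)%O}.
  apply: homo_leq => [A|A B C|N]; [exact: lexx|exact: le_trans|].
  by apply/subsetPset => y [Ey [i si iy]]; split=> //; exists i => //; exact: sS.
have mE : measurable (E : set (hausT R n)) by exact: closed_hausdorff_measurable.
have mW N : measurable (W N : set (hausT R n)).
  apply: measurableI => //; apply: open_hausdorff_measurable.
  rewrite (_ : [set y | _] = \bigcup_(i in [set i | i \in s N]) eball i.1 (Lam * i.2)%R).
    by apply: bigcup_open => i _; exact: eball_open.
  by apply/seteqP; split=> y [i si iy]; exists i.
have mUW : measurable (\bigcup_N W N : set (hausT R n)) by exact: bigcupT_measurable.
apply: (@le_trans _ _ (@hausdorffRn R n (\bigcup_N W N))).
  apply: le_outer_measure => y [Ey [i Pi iy]].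
  have [qs [qy qi]] := rat_ball_base (open_nbhs_nbhs (conj (@eball_open R n i.1 (Lam * i.2)%R) iy)).
  have [i' Fi' qi'] := (FP qs).2 (ex_intro2 _ _ i Pi qi).
  exists (pickle qs).+1 => //; split => //; exists i'; last exact: qi'.
  rewrite mem_pmap; apply/mapP; exists (pickle qs); first by rewrite mem_iota add0n ltnSn.
  by rewrite pickleK.
(* Continuity from below lets the bound for finitely many balls, uniform in [N], pass to the
   countable union. *)
have cv := @nondecreasing_cvg_mu _ (hausT R n) R (@hausdorffRn R n) W mW mUW WS.
rewrite -(cvg_lim _ cv)//; apply: lime_le; first by apply/cvg_ex; eexists; exact: cv.
apply: nearW => N /=.
apply: le_trans (vitali_finite L0 C20 dbl (fun i h => PE i (sP N i h))) _.
rewrite lee_wpmul2l ?lee_fin ?(ltW C20)//.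
by apply: le_outer_measure => y [Ey [i si iy]]; split=> //; exists i => //; exact: (sP N).
Qed.

End ahlfors_doubling.

(** * Change of aperture *)

Section dyadic_layers.
Context d (T : measurableType d) (R : realType) (mu : {measure set T -> \bar R}).
Context (D : set T) (mD : measurable D).
Implicit Types (h f g : T -> \bar R) (s : nat -> R).
Local Open Scope ereal_scope.

Definition level h (c : R) : set T := D `&` [set x | c%:E < h x].

(** A discrete layer cake whose integral involves only measures of level sets. With the levels
    [2 ^ k] and [2 ^ - k] together it is comparable to [h]: each of the two sums is at most [2 h],
    and [h] is at most twice their total, whence the constant 8 below. *)
Definition layers s h (x : T) : \bar R := \sum_(k <oo) (s k * \1_(level h (s k)) x)%:E.

Lemma measurable_level h c : measurable_fun D h -> measurable (level h c).
Proof. by move=> mh; exact: emeasurable_fun_o_infty. Qed.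

Lemma layer_ge0 s h x k : (forall j, 0 <= s j)%R -> 0 <= (s k * \1_(level h (s k)) x)%:E.
Proof. by move=> s0; rewrite lee_fin mulr_ge0. Qed.

Lemma layers_ge0 s h x : (forall j, 0 <= s j)%R -> 0 <= layers s h x.
Proof. by move=> s0; apply: nneseries_ge0 => k _ _; exact: layer_ge0. Qed.

Lemma measurable_layers s h : (forall j, 0 <= s j)%R -> measurable_fun D h ->
  measurable_fun D (layers s h).
Proof.
move=> s0 mh; apply: ge0_emeasurable_sum => [k x _ _|k _]; first exact: layer_ge0.
apply/measurable_EFinP; apply: measurable_funM => //.
by apply: measurable_indic; exact: measurable_level.
Qed.

Lemma integral_layers s h : (forall j, 0 <= s j)%R -> measurable_fun D h ->
  \int[mu]_(x in D) layers s h x = \sum_(k <oo) (s k)%:E * mu (level h (s k)).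
Proof.
move=> s0 mh.
have mk k : measurable_fun D (fun x => (s k * \1_(level h (s k)) x)%:E).
  apply/measurable_EFinP; apply: measurable_funM => //.
  by apply: measurable_indic; exact: measurable_level.
rewrite integral_nneseries//; last by move=> k x _; exact: layer_ge0.
apply: eq_eseriesr => k _; under eq_integral do rewrite EFinM.
have ml := measurable_level (s k) mh.
rewrite ge0_integralZl//; last 2 first.
- by apply/measurable_EFinP; exact: measurable_indic.
- by rewrite lee_fin.
by rewrite integral_indic// setIidl//; exact: subIsetl.
Qed.

Lemma layers_distribution s f g (C : R) : (forall j, 0 < s j)%R ->
  measurable_fun D f -> measurable_fun D g -> (0 <= C)%R ->
  (forall c : R, (0 < c)%R -> mu (level f c) <= C%:E * mu (level g c)) ->
  \int[mu]_(x in D) layers s f x <= C%:E * \int[mu]_(x in D) layers s g x.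
Proof.
move=> s0 mf mg C0 fg; have s0' j : (0 <= s j)%R by exact: ltW.
rewrite !integral_layers// -nneseriesZl; last first.
  by move=> k _; rewrite mule_ge0 ?lee_fin.
apply: lee_nneseries => [k _ _|k _]; first by rewrite mule_ge0 ?lee_fin.
by rewrite muleCA lee_wpmul2l ?lee_fin// fg.
Qed.

Lemma layers_ge s h x k : (forall j, 0 <= s j)%R -> D x ->
  (s k)%:E < h x -> (s k)%:E <= layers s h x.
Proof.
move=> s0 Dx skx; apply: (@le_trans _ _ (\sum_(0 <= j < k.+1) (s j * \1_(level h (s j)) x)%:E)).
  rewrite big_nat_recr//= indicE mem_set ?mulr1; last by split.
  by rewrite leeDr// sume_ge0// => j _; exact: layer_ge0.
by apply: nneseries_lim_ge => j _ _; exact: layer_ge0.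
Qed.

Definition pow2 k : R := (2 ^+ k)%R.
Definition pow2V k : R := (2 ^- k)%R.

Lemma pow2_gt0 k : (0 < pow2 k)%R. Proof. by rewrite exprn_gt0. Qed.
Lemma pow2V_gt0 k : (0 < pow2V k)%R. Proof. by rewrite invr_gt0 exprn_gt0. Qed.

(** If [2 ^ N] is the largest level below [h x] among the terms summed, the geometric sum up to it
    is at most [2 * 2 ^ N]. *)
Lemma layers_pow2_le h x : 0 <= h x -> layers pow2 h x <= 2%:E * h x.
Proof.
move=> h0; apply: lime_le.
  by apply: is_cvg_nneseries => k _ _; apply: layer_ge0 => j; rewrite ltW// pow2_gt0.
apply: nearW => N; elim: N => [|N IH]; first by rewrite big_geq// mule_ge0 ?lee_fin.
have [Nx|xN] := boolP ((pow2 N)%:E < h x); last first.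
  rewrite big_nat_recr//= indicE memNset ?mulr0 ?adde0//.
  by move=> [_ /=]; exact/negP.
apply: (@le_trans _ _ (2%:E * (pow2 N)%:E)); last by rewrite lee_wpmul2l ?lee_fin// ltW.
apply: (@le_trans _ _ (\sum_(0 <= k < N.+1) (pow2 k)%:E)).
  apply: lee_sum => k _; rewrite lee_fin; apply: ler_piMr; first exact: ltW (pow2_gt0 _).
  by rewrite indicE; case: (_ \in _).
rewrite sumEFin -EFinM lee_fin; elim: {Nx IH} N => [|N IH].
  by rewrite big_nat1 /pow2 expr0; lra.
rewrite big_nat_recr//= (_ : pow2 N.+1 = 2 * pow2 N)%R; last by rewrite /pow2 exprS.
by move: IH; lra.
Qed.

Lemma layers_pow2V_le h x : 0 <= h x -> layers pow2V h x <= 2%:E * h x.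
Proof.
move=> h0; have s0 j : (0 <= pow2V j)%R by rewrite ltW// pow2V_gt0.
apply: lime_le.
  by apply: is_cvg_nneseries => k _ _; exact: layer_ge0.
apply: nearW => N.
(* Here the levels decrease and the first one below [h x] dominates, so inactive terms are stripped
   from the front; hence the variable starting index. *)
have main m j : \sum_(m <= k < m + j) (pow2V k * \1_(level h (pow2V k)) x)%:E <= 2%:E * h x.
  elim: j m => [|j IH] m; first by rewrite addn0 big_geq// mule_ge0 ?lee_fin.
  have [mx|xm] := boolP ((pow2V m)%:E < h x); last first.
    rewrite big_ltn ?addnS ?ltnS ?leq_addr// indicE memNset; last first.
      by move=> [_ /=]; exact/negP.
    by rewrite mulr0 add0e -addSn.
  apply: (@le_trans _ _ (2%:E * (pow2V m)%:E)); last by rewrite lee_wpmul2l ?lee_fin// ltW.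
  apply: (@le_trans _ _ (\sum_(m <= k < m + j.+1) (pow2V k)%:E)).
    apply: lee_sum => k _; rewrite lee_fin; apply: ler_piMr => //.
  rewrite sumEFin -EFinM lee_fin.
  have -> : (\sum_(m <= k < m + j.+1) pow2V k = 2 * pow2V m - pow2V (m + j))%R.
    elim: j {IH} => [|j IHj]; first by rewrite addn1 big_nat1 addn0; lra.
    rewrite (addnS m j.+1) big_nat_recr ?leq_addr//= IHj.
    have -> : (pow2V (m + j) = 2 * pow2V (m + j.+1))%R; last lra.
    by rewrite addnS /pow2V exprS invfM mulrA mulfV ?mul1r.
  by rewrite lerBlDr lerDl.
by have := main 0%N N; rewrite add0n.
Qed.

Lemma dyadic_ge (r : R) : (0 < r)%R -> exists2 c : R,
  (exists k, c = pow2 k \/ c = pow2V k) & (c <= r <= 2 * c)%R.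
Proof.
have ge1 (q : R) : (1 <= q)%R -> exists k, (pow2 k <= q < 2 * pow2 k)%R.
  move=> q1; have q0 : (0 <= q)%R by exact: le_trans q1.
  have t0 : (0 < Num.truncn q)%N by rewrite truncn_gt0.
  have /andP[h1 h2] := trunc_log_bounds (isT : 1 < 2)%N t0.
  have /andP[h3 h4] := truncn_itv q0.
  exists (trunc_log 2 (Num.truncn q)); rewrite /pow2 -exprS -!natrX.
  rewrite (le_trans _ h3) ?ler_nat//=; apply: (lt_le_trans h4).
  by rewrite ler_nat.
move=> r0; have [r1|r1] := leP 1%R r.
  have [k /andP[h1 h2]] := ge1 r r1; exists (pow2 k); first by exists k; left.
  by rewrite h1 ltW.
have rV1 : (1 <= r^-1)%R by rewrite invf_ge1// ltW.
have [k /andP[h1 h2]] := ge1 _ rV1.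
have k0 := pow2_gt0 k.
exists (pow2V k.+1); first by exists k.+1; right.
have -> : pow2V k.+1 = ((2 * pow2 k)^-1)%R by rewrite /pow2V exprS.
apply/andP; split.
  by rewrite invf_ple ?posrE ?mulr_gt0// ltW.
rewrite invfM mulrA mulfV// mul1r -[leLHS]invrK lef_pV2 ?posrE ?invr_gt0//.
Qed.

(** Every positive real [r] below [h x] is at most twice a dyadic level that is itself below [h x].
    Comparing through such [r] also covers [h x = +oo]. *)
Lemma le_layers h x : D x -> 0 <= h x ->
  h x <= 2%:E * (layers pow2 h x + layers pow2V h x).
Proof.
move=> Dx h0.
have p0 j : (0 <= pow2 j)%R by rewrite ltW// pow2_gt0.
have pV0 j : (0 <= pow2V j)%R by rewrite ltW// pow2V_gt0.
set X := 2%:E * _; have X0 : 0 <= X by rewrite mule_ge0 ?lee_fin// adde_ge0// layers_ge0.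
have below (r : R) : (0 < r)%R -> r%:E < h x -> r%:E <= X.
  move=> r0 rh; have [c ck /andP[cr rc]] := dyadic_ge r0.
  have ch : c%:E < h x by apply: le_lt_trans rh; rewrite lee_fin.
  apply: (@le_trans _ _ (2%:E * c%:E)); first by rewrite -EFinM lee_fin.
  rewrite /X lee_wpmul2l ?lee_fin//; case: ck => k [] ck; rewrite ck in ch *.
    by apply: le_trans (layers_ge p0 Dx ch) _; rewrite leeDl// layers_ge0.
  by apply: le_trans (layers_ge pV0 Dx ch) _; rewrite leeDr// layers_ge0.
rewrite leNgt; apply/negP => Xh.
have Xfin : X \is a fin_num by rewrite ge0_fin_numE// (lt_le_trans Xh)// leey.
have [r Xr rh] : exists2 r : R, (fine X < r)%R & r%:E < h x.
  move: Xh; rewrite -(fineK Xfin); case: (h x) => [b| |] //.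
    rewrite lte_fin => Xb; exists ((fine X + b) / 2)%R; rewrite ?lte_fin; lra.
  by move=> _; exists (fine X + 1)%R; rewrite ?ltry// ltrDl.
have := below r _ rh; rewrite -(fineK Xfin) lee_fin leNgt Xr => /(_ _)/negP; apply => //.
by apply: le_lt_trans Xr; exact: fine_ge0.
Qed.

(* A layer cake comparison over the levels 2^k, k an integer: unlike the
   continuous layer cake formula it needs no sigma-finiteness. *)
Lemma le_integral_distribution f g (C : R) : measurable_fun D f -> measurable_fun D g ->
  (forall x, D x -> 0 <= f x) -> (forall x, D x -> 0 <= g x) -> (0 <= C)%R ->
  (forall c : R, (0 < c)%R -> mu (level f c) <= C%:E * mu (level g c)) ->
  \int[mu]_(x in D) f x <= (8 * C)%:E * \int[mu]_(x in D) g x.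
Proof.
move=> mf mg f0 g0 C0 fg.
have p0 j : (0 <= pow2 j)%R by rewrite ltW// pow2_gt0.
have pV0 j : (0 <= pow2V j)%R by rewrite ltW// pow2V_gt0.
have ml s h := @measurable_layers s h.
have I0 : 0 <= \int[mu]_(x in D) g x by apply: integral_ge0.
have half s : (forall j, 0 < s j)%R -> (forall x, D x -> layers s g x <= 2%:E * g x) ->
    \int[mu]_(x in D) layers s f x <= (2 * C)%:E * \int[mu]_(x in D) g x.
  move=> s0 sg; have s0' j : (0 <= s j)%R by exact: ltW.
  apply: le_trans (layers_distribution s0 mf mg C0 fg) _.
  rewrite mulrC EFinM -muleA lee_wpmul2l ?lee_fin// -ge0_integralZl ?lee_fin//.
  apply: ge0_le_integral => //.
  - by move=> x _; exact: layers_ge0.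
  - exact: ml.
  - exact: emeasurable_funM.
apply: (@le_trans _ _ (\int[mu]_(x in D) (2%:E * (layers pow2 f x + layers pow2V f x)))).
  apply: ge0_le_integral => //.
  - by apply: emeasurable_funM => //; apply: emeasurable_funD; exact: ml.
  - by move=> x Dx; apply: le_layers => //; exact: f0.
rewrite ge0_integralZl ?lee_fin//; last 2 first.
- by apply: emeasurable_funD; exact: ml.
- by move=> x _; rewrite adde_ge0// layers_ge0.
rewrite ge0_integralD//; [|by move=> *; exact: layers_ge0|exact: ml
  |by move=> *; exact: layers_ge0|exact: ml].
have h1 := half pow2 pow2_gt0 (fun x Dx => layers_pow2_le (g0 x Dx)).
have h2 := half pow2V pow2V_gt0 (fun x Dx => layers_pow2V_le (g0 x Dx)).
apply: (@le_trans _ _ (2%:E * ((2 * C)%:E * \int[mu]_(x in D) g x + (2 * C)%:E * \int[mu]_(x in D) g x))).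
  by apply: lee_wpmul2l => //; exact: (leeD h1 h2).
rewrite -ge0_muleDl ?lee_fin ?mulr_ge0// muleA -EFinD -EFinM.
by rewrite (_ : 2 * (2 * C + 2 * C) = 8 * C)%R//; ring.
Qed.

End dyadic_layers.

(** * Level sets of the nontangential maximal function *)

Section aperture.
Context {R : realType} {n : nat}.
Notation V := 'rV[R]_n.+1.
Notation sigma := (@hausdorffRn R n).
Context (Omega : set V) (Omega_open : open Omega).
Notation E := (boundary Omega).
Context (gradu : V -> V).
Notation mean y := (sqrt_mean_square gradu y (4^-1 * dist y E)).
Local Open Scope ereal_scope.

Lemma nt_maximal_gtP (alpha c : R) (x : V) : (0 <= c)%R ->
  c%:E < nt_maximal alpha Omega gradu x <->
  exists y, [/\ Omega y, (enorm (x - y) < (1 + alpha) * dist y E)%R & c%:E < mean y].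
Proof.
move=> c0; rewrite /nt_maximal; split.
  rewrite lt_max => /orP[|/ereal_sup_gt[_ [y [Oy xy] <-] cy]]; last by exists y; split.
  by rewrite lte_fin => /(le_lt_trans c0); rewrite ltxx.
move=> [y [Oy xy cy]]; rewrite lt_max; apply/orP; right.
by apply: lt_le_trans cy _; apply: ereal_sup_ubound; exists y.
Qed.

Lemma boundary_dist_gt0 x y : E x -> Omega y -> (0 < dist y E)%R.
Proof.
move=> Ex Oy; apply: dist_gt0; [exact: boundary_closed|by exists x|].
by move=> Ey; exact: (boundary_not_open Omega_open Ey).
Qed.

Lemma measurable_boundary : measurable (E : set (hausT R n)).
Proof. by apply: closed_hausdorff_measurable; exact: boundary_closed. Qed.

(** For [c >= 0] the superlevel set is relatively open in [E]: it is the trace of the union of the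
    balls around those [y] whose mean exceeds [c]. *)
Lemma measurable_nt_maximal (alpha : R) :
  measurable_fun (E : set (hausT R n)) (nt_maximal alpha Omega gradu : hausT R n -> \bar R).
Proof.
apply: (measurability _ (ErealGenOInfty.measurableE R)) => _ [_ [c ->] <-].
have [c0|c0] := leP 0%R c; last first.
  rewrite (_ : _ `&` _ = E); first exact: measurable_boundary.
  apply/seteqP; split=> [x []//|x Ex]; split => //=; rewrite in_itv/= andbT.
  by rewrite lt_max lte_fin c0.
rewrite (_ : _ `&` _ = E `&` \bigcup_(y in [set y | Omega y /\ c%:E < mean y])
    eball y ((1 + alpha) * dist y E)%R); last first.
  apply/seteqP; split=> x [Ex].
    rewrite /= in_itv/= andbT => /(nt_maximal_gtP _ _ c0)[y [Oy xy cy]].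
    by split => //; exists y.
  move=> [y [Oy cy] xy]; split=> //=; rewrite in_itv/= andbT.
  by apply/(nt_maximal_gtP _ _ c0); exists y.
apply: measurableI; first exact: measurable_boundary.
by apply: open_hausdorff_measurable; apply: bigcup_open => y _; exact: eball_open.
Qed.

Lemma nt_maximal_ge0 (alpha : R) x : 0 <= nt_maximal alpha Omega gradu x.
Proof. by rewrite /nt_maximal le_max lexx. Qed.

End aperture.

Section change_of_aperture.
Context {R : realType} {n : nat}.
Notation V := 'rV[R]_n.+1.
Notation sigma := (@hausdorffRn R n).
Context (Omega : set V) (Omega_open : open Omega).
Notation E := (boundary Omega).
Hypothesis E_ahlfors : ahlfors_regular E.
Local Open Scope ereal_scope.

(* A point y with large mean value near which x lies forces the smaller-aperture
   maximal function to be large on the whole surface ball of radius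
   (alpha / 2) d(y) centred at an almost nearest boundary point of y. *)
Lemma nt_maximal_level_aperture (alpha beta : R) x0 x1 : (0 < alpha)%R -> (0 < beta)%R ->
  E x0 -> E x1 -> x0 != x1 -> exists2 C : R, (0 < C)%R &
  forall (gradu : V -> V) (c : R), (0 <= c)%R ->
    sigma (E `&` [set x | c%:E < nt_maximal beta Omega gradu x]) <=
    C%:E * sigma (E `&` [set x | c%:E < nt_maximal alpha Omega gradu x]).
Proof.
move=> a0 b0 Ex0 Ex1 x01.
(* With [d] the distance of [y] to the boundary, [|x - z| < (1 + beta) d + (1 + alpha / 2) d], which
   is [Lam] times the radius [alpha / 2 * d]. Conversely, points of the undilated ball are within
   [(alpha / 2 + 1 + alpha / 2) d] of [y], that is, they see [y] with aperture [alpha]. *)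
pose Lam : R := ((2 + beta + alpha / 2) / (alpha / 2))%R.
have L0 : (0 <= Lam)%R by rewrite /Lam divr_ge0//; lra.
have L2 : (1 <= Lam + 2)%R by lra.
have [C C0 dbl] := ahlfors_doubling E_ahlfors Ex0 Ex1 x01 L2.
exists C => // gradu c c0.
pose P := [set i : V * R | E i.1 /\ exists y, [/\ Omega y,
  c%:E < sqrt_mean_square gradu y (4^-1 * dist y E),
  (enorm (y - i.1) < (1 + alpha / 2) * dist y E)%R & i.2 = (alpha / 2 * dist y E)%R]].
have PE i : P i -> E i.1 /\ (0 < i.2)%R.
  move=> [Ei [y [Oy _ _ ->]]]; split => //; rewrite mulr_gt0 ?divr_gt0//.
  exact: (@boundary_dist_gt0 R n Omega Omega_open i.1 y Ei Oy).
have Vit := vitali_countable E_ahlfors L0 C0 dbl PE.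
apply: (@le_trans _ _ (sigma (E `&` [set y | exists2 i, P i & eball i.1 (Lam * i.2)%R y]))).
  apply: le_outer_measure => x [Ex] /(@nt_maximal_gtP R n Omega gradu beta c x c0)[y [Oy xy cy]]; split => //.
  have d0 := @boundary_dist_gt0 R n Omega Omega_open x y Ex Oy.
  have E0 : E !=set0 by exists x.
  have yd : (dist y E < (1 + alpha / 2) * dist y E)%R.
    by rewrite mulrDl mul1r ltrDl mulr_gt0// divr_gt0.
  have [z Ez yz] := dist_near E0 yd.
  exists (z, (alpha / 2 * dist y E)%R); first by split => //; exists y.
  rewrite /eball/= /Lam mulrA divfK; last by rewrite gt_eqF// divr_gt0.
  by apply: le_lt_trans (enorm_triangle y x z) _; lra.
apply: (le_trans Vit); rewrite lee_wpmul2l ?lee_fin ?(ltW C0)//.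
apply: le_outer_measure => x [Ex [[z r] [/= Ez [y [Oy cy yz rE]]] xz]]; split => //.
apply/(@nt_maximal_gtP R n Omega gradu alpha c x c0); exists y; split => //.
rewrite /eball/= rE in xz; have := enorm_triangle z x y.
by rewrite (enorm_distC z y); lra.
Qed.

Lemma integral_nt_maximal_aperture (alpha beta : R) x0 x1 : (0 < alpha)%R -> (0 < beta)%R ->
  E x0 -> E x1 -> x0 != x1 -> exists2 C : R, (0 < C)%R &
  forall gradu : V -> V, \int[sigma]_(x in E) nt_maximal beta Omega gradu x <=
    C%:E * \int[sigma]_(x in E) nt_maximal alpha Omega gradu x.
Proof.
move=> a0 b0 Ex0 Ex1 x01.
have [C C0 HC] := nt_maximal_level_aperture a0 b0 Ex0 Ex1 x01.
exists (8 * C)%R => [|gradu]; first by rewrite mulr_gt0.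
apply: (@le_integral_distribution _ (hausT R n) R sigma E (measurable_boundary _)).
- exact: measurable_nt_maximal.
- exact: measurable_nt_maximal.
- by move=> x _; exact: nt_maximal_ge0.
- by move=> x _; exact: nt_maximal_ge0.
- exact: ltW.
- by move=> c /ltW; exact: HC.
Qed.

End change_of_aperture.

(** * The inequality *)

(** Only an inequality, because [fine] sends infinite values to 0. *)
Lemma integral_fine_le d (T : measurableType d) (R : realType)
  (mu : {measure set T -> \bar R}) (D : set T) (f : T -> \bar R) (C : R) :
  measurable D -> measurable_fun D f -> (forall x, D x -> (0 <= f x)%E) -> 0 <= C ->
  (\int[mu]_(x in D) `|C * fine (f x)|%:E <= C%:E * \int[mu]_(x in D) f x)%E.
Proof.
move=> mD mf f0 C0; rewrite -ge0_integralZl ?lee_fin//.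
apply: ge0_le_integral => //.
- apply/measurable_EFinP; apply: measurableT_comp => //.
  by apply: measurable_funM => //; exact: measurableT_comp.
- exact: emeasurable_funM.
- move=> x Dx; have := f0 x Dx; case: (f x) => [r| |] //= r0.
    by rewrite -EFinM lee_fin ger0_norm// mulr_ge0.
  by rewrite mulr0 normr0 mule_ge0.
Qed.

Theorem proposition1p10 (R : realType) (n : nat) (hn : (2 <= n)%N)
    (Omega : set 'rV[R]_n.+1) (Omega_open : open Omega)
    (Omega_ahlfors : ahlfors_regular (boundary Omega))
    (Omega_john : local_john Omega)
    (lambda : R) (hlambda : 0 < lambda < 1)
    (A : 'rV[R]_n.+1 -> 'M[R]_n.+1) (A_elliptic : elliptic Omega lambda A)
    (alpha : R) (halpha : 0 < alpha) :
  exists C : R, 0 < C /\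
    forall f : 'rV[R]_n.+1 -> R,
      lipschitz_fun (boundary Omega) f -> M11 (boundary Omega) f ->
    forall u : 'rV[R]_n.+1 -> R, dirichlet_solution Omega A f u ->
    forall gradu : 'rV[R]_n.+1 -> 'rV[R]_n.+1, weak_gradient Omega u gradu ->
      (hajlasz_seminorm (boundary Omega) f <=
       C%:E * \int[@hausdorffRn R n]_(x in boundary Omega)
                nt_maximal alpha Omega gradu x)%E.
Proof.
have mE := measurable_boundary Omega.
have int_ge0 (g : 'rV[R]_n.+1 -> 'rV[R]_n.+1) b :
    (0 <= \int[@hausdorffRn R n]_(x in boundary Omega) nt_maximal b Omega g x)%E.
  by apply: integral_ge0 => x _; exact: nt_maximal_ge0.
(* Doubling is derived from two distinct boundary points. With at most one point, the zero function
   is a Hajlasz gradient and the seminorm vanishes. *)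
have [[x0 [x1 [Ex0 Ex1 x01]]]|one] := pselect (exists x0 x1,
    [/\ boundary Omega x0, boundary Omega x1 & x0 != x1]); last first.
  exists 1; split => // f _ _ u _ gradu _; rewrite mul1e.
  apply: le_trans (int_ge0 gradu alpha); apply: ereal_inf_lbound.
  exists (fun=> 0); last by rewrite normr0 integral0.
  split => //; exists set0; split; first exact: negligible_set0.
  move=> x z [Ex _] [Ez _]; have [->|xz] := eqVneq x z.
    by rewrite subrr normr0 mulr_ge0 ?addr0// enorm_ge0.
  by exfalso; apply: one; exists x, z.
have [theta th0 [C C0 hC]] := john_hajlasz Omega_open Omega_john.
have tV0 : 0 < theta^-1 by rewrite invr_gt0.
have [C' C'0 hC'] := integral_nt_maximal_aperture Omega_open Omega_ahlfors
  halpha tV0 Ex0 Ex1 x01.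
exists (C * C'); split; first exact: mulr_gt0.
move=> f _ _ u [uc [ul _] _ uf _] gradu ug.
set N := nt_maximal theta^-1 Omega gradu.
have mN : measurable_fun (boundary Omega : set (hausT R n)) (N : hausT R n -> \bar R).
  exact: measurable_nt_maximal.
have N0 x : (0 <= N x)%E by exact: nt_maximal_ge0.
(* An infinite right-hand side is trivial. Otherwise the maximal function with aperture [theta^-1]
   is integrable, hence finite almost everywhere. *)
have [Ioo|Ifin] := eqVneq (\int[@hausdorffRn R n]_(x in boundary Omega)
    nt_maximal alpha Omega gradu x)%E +oo%E.
  by rewrite Ioo gt0_muley ?leey// lte_fin mulr_gt0.
have IN : (\int[@hausdorffRn R n]_(x in boundary Omega) N x < +oo)%E.
  apply: le_lt_trans (hC' gradu) _.
  by rewrite lte_mul_pinfty ?lee_fin ?(ltW C'0)// ltey.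
have iN : (@hausdorffRn R n).-integrable (boundary Omega) N.
  apply/integrableP; split => //.
  by under eq_integral do rewrite gee0_abs//.
apply: (@le_trans _ _ (C%:E * \int[@hausdorffRn R n]_(x in boundary Omega) N x)%E); last first.
  rewrite EFinM -muleA lee_wpmul2l ?lee_fin ?(ltW C0)//; exact: hC'.
apply: le_trans (@integral_fine_le _ (hausT R n) R (@hausdorffRn R n) (boundary Omega) N C
  mE mN (fun x _ => N0 x) (ltW C0)).
apply: ereal_inf_lbound; exists (fun x => C * fine (N x)); last by reflexivity.
split.
- apply: measurable_funM; first exact: measurable_cst.
    exact: (measurableT_comp (@fine_measurable R setT measurableT) mN).
- by move=> x _; rewrite mulr_ge0 ?(ltW C0)// fine_ge0.
- have [B [mB B0 hB]] := integrable_ae mE iN.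
    exists B; split; first by exists B; split.
    have fin x : (boundary Omega `\` B) x -> (N x < +oo)%E.
      move=> [Ex Bx]; have : N x \is a fin_num.
        by apply: contrapT => Nx; apply: Bx; apply: hB => /(_ Ex).
      by rewrite ge0_fin_numE.
    move=> x z hx hz; have [[Ex _] [Ez _]] := (hx, hz).
    rewrite -(uf x Ex) -(uf z Ez); apply: hC => //; exact: fin.
Qed.
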